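(* Let $M$ be a smooth manifold equipped with a nowhere-vanishing smooth measure, $S\to M$ a smooth Hermitian complex vector bundle, and $D$ a symmetric (first order linear) differential operator acting on the sections of $S$. Let $u\in\mathrm{L}^2(M;S)$ be compactly supported. Then $u\in\operatorname{dom}\overline{D}$ if and only if $u\in\operatorname{dom}D^*$. In particular, if $M$ is compact, then $D$ is essentially self-adjoint.
   Context: Setting. $S\stackrel{\pi}{\to}M$ is a smooth complex vector bundle of rank $k$ over a smooth manifold $M$ of dimension $n$, with smoothly varying inner products $(\cdot|\cdot)^{S_p}$ on the fibres $S_p$. $\Gamma^\infty(M;S)$ (resp. $\Gamma_c^\infty(M;S)$) denotes the smooth (resp. smooth compactly supported) sections. A nowhere-vanishing smooth measure on $M$ is a Borel measure $\mu$ such that for every chart $(U,\varphi)$ there is a smooth $f\colon\varphi(U)\to(0,\infty)$ with $\mathrm{d}(\varphi_*\mu|_U)=f\,\mathrm{d}\lambda$, $\lambda$ being Lebesgue measure. Standing assumption: there is an atlas and a number $L$ such that for all charts of the atlas the density $f$ and $g=1/f$ satisfy $\|f\|_\infty,\|g\|_\infty\le L$. $\mathrm{L}^2(M;S)$ is the completion of $\Gamma_c^\infty(M;S)$ for $\langle u|v\rangle=\int_M(u(p)|v(p))^{S_p}\,\mathrm{d}\mu(p)$. Differential operators. A (first order linear) differential operator acting on the sections of $S$ is a $\mathbb{C}$-linear map $D\colon\Gamma^\infty(M;S)\to\Gamma^\infty(M;S)$ such that (a) if $u,v$ agree on an open set $U$, then so do $Du,Dv$; and (b) for every chart $\varphi\colon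 U\to V\subseteq\mathbb{R}^n$ and trivialization $\Psi=(\pi,\psi)\colon S|_U\to U\times\mathbb{C}^k$ there are $A^1,\dots,A^n,B\in C^\infty(U,\mathrm{M}_k(\mathbb{C}))$ with $$(Du)(p)=\sum_{j=1}^n\Psi^{-1}\bigl(p,A^j(p)\,\partial_j(\psi\circ u\circ\varphi^{-1})|_{\varphi(p)}\bigr)+\Psi^{-1}\bigl(p,B(p)(\psi\circ u)(p)\bigr)$$ for all $p\in U$, $u\in\Gamma^\infty(M;S)$. It is regarded as an unbounded operator on $\mathrm{L}^2(M;S)$ with domain $\Gamma_c^\infty(M;S)$. Symmetric means $\langle D\xi|\eta\rangle=\langle\xi|D\eta\rangle$ for $\xi,\eta$ in the domain; $D^*$ is the adjoint; $\overline D$ is the closure; essentially self-adjoint means symmetric with $\operatorname{dom}\overline D=\operatorname{dom}D^*$. *)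

(* Defs.v *)
From HB Require Import structures.
From mathcomp Require Import all_boot all_order all_algebra.
From mathcomp Require Import all_classical all_reals all_analysis.
From mathcomp Require Import measurable_realfun.
From mathcomp Require Import complex.
From mathcomp Require Import sesquilinear.

Set Implicit Arguments.
Unset Strict Implicit.
Unset Printing Implicit Defensive.

Import Order.TTheory GRing.Theory Num.Theory.
Import numFieldNormedType.Exports.

Local Open Scope classical_set_scope.
Local Open Scope ring_scope.

Notation borel T := (g_sigma_algebraType (@open T)).

Lemma rV_open_bigcup (R : realType) n (A : set 'rV[R]_n) : open A ->
  A = \bigcup_(q in [set q : 'rV[rat]_n * nat |
        ball (map_mx ratr q.1 : 'rV[R]_n) (q.2.+1%:R^-1) `<=` A])
      ball (map_mx ratr q.1 : 'rV[R]_n) (q.2.+1%:R^-1).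
Proof.
move=> oA; apply/seteqP; split => [x Ax|x [q qA]]; last exact: qA.
have /nbhs_ballP[e /= e0 xeA] : nbhs x A by exact: open_nbhs_nbhs.
have [m me] : exists m, m.+1%:R^-1 < e / 2 :> R.
  exists (Num.truncn (e / 2)^-1).
  rewrite invf_plt ?posrE// ?divr_gt0//.
  exact: truncnS_gt.
have /choice[q hq] : forall i, exists q : rat,
    ball (x ord0 i) (m.+1%:R^-1) (ratr q : R).
  move=> i; set e' : R := m.+1%:R^-1.
  have /rat_in_itvoo[q /itvP qe] : x ord0 i - e' < x ord0 i + e'.
    by rewrite ltrBlDr -addrA ltrDl addr_gt0// /e' invr_gt0.
  by exists q; rewrite /ball/= distrC ltr_distl !qe.
have bqx : ball (map_mx ratr (\row_i q i) : 'rV[R]_n) (m.+1%:R^-1) x.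
  apply: ball_sym; split => // i j; rewrite !mxE.
  by rewrite (ord1 i); exact: hq.
exists ((\row_i q i), m) => //= y hy; apply: xeA.
apply: (@le_ball _ _ _ (m.+1%:R^-1 + m.+1%:R^-1)).
  by rewrite [leRHS]splitr lerD// ltW.
exact: (ball_triangle (ball_sym bqx)).
Qed.

Lemma measurable_fun_rV (R : realType) n d (T : measurableType d)
    (f : T -> 'rV[R]_n) :
  (forall i, measurable_fun setT (fun t => f t ord0 i)) ->
  measurable_fun setT (f : T -> borel 'rV[R]_n).
Proof.
move=> mf; have H : @measurable _ (borel 'rV[R]_n) = <<s @open 'rV[R]_n >> by [].
apply: (measurability _ H).
move=> _ [A oA <-]; rewrite setTI (rV_open_bigcup oA) preimage_bigcup.
rewrite bigcup_mkcond; apply: countable_bigcupT_measurable; first exact: countableP.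
move=> q; case: ifPn => // _.
rewrite (_ : _ @^-1` _ = \bigcap_(i in [set: 'I_n])
    [set t | ball (ratr (q.1 ord0 i) : R) (q.2.+1%:R^-1) (f t ord0 i)]).
  apply: fin_bigcap_measurable => // i _; rewrite -[X in measurable X]setTI.
  by apply: (mf i) => //; apply: open_measurable; apply: ball_open; rewrite ?invr_gt0.
apply/seteqP; split => [t [_ h] i _|t h] /=.
  by have := h ord0 i; rewrite mxE.
split=> [|j i]; first by rewrite invr_gt0.
by rewrite (ord1 j) mxE; exact: h.
Qed.

Lemma continuous_borel_measurable (R : realType) (T : ptopologicalType)
    (f : T -> R) : continuous f -> measurable_fun setT (f : borel T -> R).
Proof.
move=> /continuousP cf; apply: (measurability _ (RGenOpens.measurableE R)).
move=> _ [_ [a [b ->] <-]]; rewrite setTI.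
by apply: sub_sigma_algebra; apply: cf; exact: interval_open.
Qed.

Section lebesgue_rV.
Variable R : realType.

Definition cons_rV n (z : R * 'rV[R]_n) : 'rV[R]_n.+1 :=
  \row_j if unlift ord0 j is Some i then z.2 ord0 i else z.1.

Lemma cons_rV0 n z : @cons_rV n z ord0 ord0 = z.1.
Proof. by rewrite mxE unlift_none. Qed.

Lemma cons_rVS n z i : @cons_rV n z ord0 (lift ord0 i) = z.2 ord0 i.
Proof. by rewrite mxE liftK. Qed.

Definition uncons_rV n (v : 'rV[R]_n.+1) : R * 'rV[R]_n :=
  (v ord0 ord0, \row_i v ord0 (lift ord0 i)).

Lemma cons_rVK n : cancel (@cons_rV n) (@uncons_rV n).
Proof.
move=> [x y]; rewrite /uncons_rV cons_rV0; congr pair.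
by apply/rowP => i; rewrite mxE cons_rVS.
Qed.

Lemma uncons_rVK n : cancel (@uncons_rV n) (@cons_rV n).
Proof.
move=> v; apply/rowP => j; rewrite mxE; case: unliftP => [i|] -> //=.
by rewrite mxE.
Qed.

Lemma measurable_coord n (i : 'I_n) :
  measurable_fun setT ((fun v => v ord0 i) : borel 'rV[R]_n -> R).
Proof. by apply: continuous_borel_measurable; exact: coord_continuous. Qed.

Lemma measurable_cons_rV n : measurable_fun setT
  (@cons_rV n : measurableTypeR R * borel 'rV[R]_n -> borel 'rV[R]_n.+1).
Proof.
apply: measurable_fun_rV => j.
case: (unliftP ord0 j) => [i|] ->.
  under eq_fun do rewrite cons_rVS.
  exact: measurableT_comp (@measurable_coord n i) measurable_snd.
under eq_fun do rewrite cons_rV0.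
exact: measurable_fst.
Qed.

Lemma measurable_uncons_rV n : measurable_fun setT
  (@uncons_rV n : borel 'rV[R]_n.+1 -> measurableTypeR R * borel 'rV[R]_n).
Proof.
apply: measurable_fun_pair; first exact: measurable_coord.
apply: measurable_fun_rV => i.
under eq_fun do rewrite mxE.
exact: measurable_coord.
Qed.

Section step.
Variables (n : nat) (m : {sigma_finite_measure set (borel 'rV[R]_n) -> \bar R}).

Definition leb_step : set (borel 'rV[R]_n.+1) -> \bar R :=
  pushforward (@lebesgue_measure R \x m)%E
    (@cons_rV n : _ -> borel 'rV[R]_n.+1).

HB.instance Definition _ := Measure.copy leb_step
  (measure_function_pushforward__canonical__measure_function_Measure
     (@lebesgue_measure R \x m)%E (@measurable_cons_rV n)).

Let leb_step_sigma_finite : sigma_finite setT leb_step.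
Proof.
have /sigma_finiteP[F [TF ndF Foo]] := sigma_finiteT (@lebesgue_measure R).
have /sigma_finiteP[G [TG ndG Goo]] := sigma_finiteT m.
exists (fun i => @uncons_rV n @^-1` (F i `*` G i)).
  rewrite -preimage_bigcup; apply/seteqP; split => // v _ /=.
  have [i _ Fi] : (\bigcup_i F i) (uncons_rV v).1 by rewrite -TF.
  have [j _ Gj] : (\bigcup_i G i) (uncons_rV v).2 by rewrite -TG.
  exists (maxn i j) => //; split.
  - by move: Fi; exact/subsetPset/ndF/leq_maxl.
  - by move: Gj; exact/subsetPset/ndG/leq_maxr.
move=> i; have [mFi Fi] := Foo i; have [mGi Gi] := Goo i; split.
  rewrite -[X in measurable X]setTI; apply: measurable_uncons_rV => //.
  exact: measurableX.
rewrite /leb_step /pushforward -comp_preimage.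
rewrite (_ : _ \o _ = id); last by apply/funext => z; exact: cons_rVK.
by rewrite /= product_measure1E// lte_mul_pinfty// ge0_fin_numE.
Qed.

HB.instance Definition _ := Measure_isSigmaFinite.Build _ _ _ leb_step
  leb_step_sigma_finite.

End step.

Fixpoint lebesgue_rV n :
    {sigma_finite_measure set (borel 'rV[R]_n) -> \bar R} :=
  match n with
  | 0 => [the {sigma_finite_measure set _ -> \bar R} of
            dirac (0 : borel 'rV[R]_0)]
  | n'.+1 => [the {sigma_finite_measure set _ -> \bar R} of
            leb_step (lebesgue_rV n')]
  end.

Lemma lebesgue_rV_box n (A : 'I_n -> set (measurableTypeR R)) :
  (forall i, measurable (A i)) ->
  lebesgue_rV n [set v : 'rV[R]_n | forall i, A i (v ord0 i)] =
    (\prod_(i < n) @lebesgue_measure R (A i))%E.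
Proof.
elim: n A => [|n IHn] A mA.
  rewrite big_ord0 /= /dirac indicE mem_set// => -[] //.
rewrite big_ord_recl /= /leb_step /pushforward.
have -> : (@cons_rV n @^-1` [set v | forall i, A i (v ord0 i)]) =
    A ord0 `*` [set v : 'rV[R]_n | forall i, A (lift ord0 i) (v ord0 i)].
  apply/seteqP; split=> [z h|z [h0 h] j] /=.
    split=> [|i]; first by have := h ord0; rewrite cons_rV0.
    by have := h (lift ord0 i); rewrite cons_rVS.
  by case: (unliftP ord0 j) => [i|] ->; rewrite ?cons_rVS ?cons_rV0.
have mB : measurable ([set v : 'rV[R]_n | forall i, A (lift ord0 i) (v ord0 i)] :
    set (borel 'rV[R]_n)).
  have -> : [set v : 'rV[R]_n | forall i, A (lift ord0 i) (v ord0 i)] =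
      \bigcap_(i in [set: 'I_n]) ((fun v => v ord0 i) @^-1` A (lift ord0 i)).
    by apply/seteqP; split=> v h i => [_|]; [exact: h|exact: (h i I)].
  apply: fin_bigcap_measurable => // i _; rewrite -[X in measurable X]setTI.
  exact: (@measurable_coord n i measurableT _ (mA _)).
by rewrite product_measure1E// -IHn.
Qed.

End lebesgue_rV.

Section smooth_euclidean.
Context {R : realType} {n : nat}.
Implicit Types V : set 'rV[R]_n.

(* For V open; f is only constrained on V.  The partial derivatives at points
   of V do not depend on the values of f outside V. *)
Fixpoint Ck (m : nat) V (f : 'rV[R]_n -> R) : Prop :=
  (forall x, V x -> {for x, continuous f}) /\
  if m is m'.+1 then
    forall j : 'I_n, (forall x, V x -> derivable f x (delta_mx ord0 j)) /\
                     Ck m' V ('D_(delta_mx ord0 j) f)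
  else True.

Definition smooth V (f : 'rV[R]_n -> R) : Prop := forall m, Ck m V f.

(* The j-th partial derivative of a function with values in C^k = R^2k. *)
Definition partial k (j : 'I_n) (f : 'rV[R]_n -> 'cV[R[i]]_k) (x : 'rV[R]_n) :
    'cV[R[i]]_k :=
  \col_a ('D_(delta_mx ord0 j) (fun y => complex.Re (f y a ord0)) x +i*
          'D_(delta_mx ord0 j) (fun y => complex.Im (f y a ord0)) x)%C.

End smooth_euclidean.

Section manifold.
Context {R : realType} {M : ptopologicalType} {n : nat}.

(* Only the restrictions of cmap to cdom and of cinv to cimg matter. *)
Record chart := Chart {
  cdom : set M;
  cimg : set 'rV[R]_n;
  cmap : M -> 'rV[R]_n;
  cinv : 'rV[R]_n -> M;
  cdom_open : open cdom;
  cimg_open : open cimg;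
  cmap_img : forall p, cdom p -> cimg (cmap p);
  cinv_dom : forall x, cimg x -> cdom (cinv x);
  cmapK : forall p, cdom p -> cinv (cmap p) = p;
  cinvK : forall x, cimg x -> cmap (cinv x) = x;
  cmap_continuous : forall p, cdom p -> {for p, continuous cmap};
  cinv_continuous : forall x, cimg x -> {for x, continuous cinv}
}.

Definition chart_compatible (c d : chart) : Prop :=
  forall j : 'I_n,
    smooth (cmap c @` (cdom c `&` cdom d)) (fun x => cmap d (cinv c x) ord0 j)
    /\
    smooth (cmap d @` (cdom c `&` cdom d)) (fun x => cmap c (cinv d x) ord0 j).

Record smooth_atlas := SmoothAtlas {
  charts : set chart;
  charts_cover : forall p, exists2 c, charts c & cdom c p;
  charts_compatible : forall c d, charts c -> charts d -> chart_compatible c d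
}.

Variable A : smooth_atlas.

(* The charts of the smooth manifold, i.e., of the maximal atlas. *)
Definition is_chart (c : chart) : Prop :=
  forall d, charts A d -> chart_compatible c d.

(* For W open. *)
Definition smooth_on (W : set M) (f : M -> R) : Prop :=
  forall c, is_chart c -> smooth (cmap c @` (W `&` cdom c)) (f \o cinv c).

Definition csmooth_on (W : set M) (f : M -> R[i]) : Prop :=
  smooth_on W (fun p => complex.Re (f p)) /\
  smooth_on W (fun p => complex.Im (f p)).

Definition mxsmooth_on k (W : set M) (f : M -> 'M[R[i]]_k) : Prop :=
  forall a b, csmooth_on W (fun p => f p a b).

(* f is a smooth positive density on cimg c of the push-forward of mu by c. *)
Definition is_density (mu : set (borel M) -> \bar R) (c : chart)
    (f : 'rV[R]_n -> R) : Prop :=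
  [/\ smooth (cimg c) f, forall x, cimg c x -> 0 < f x &
      forall B : set (borel 'rV[R]_n), measurable B ->
        mu (cdom c `&` cmap c @^-1` B) =
        (\int[@lebesgue_rV R n]_(x in cimg c `&` B) (f x)%:E)%E].

Definition nowhere_vanishing_smooth (mu : set (borel M) -> \bar R) : Prop :=
  forall c, is_chart c -> exists f, is_density mu c f.

Definition uniformly_bounded_density (mu : set (borel M) -> \bar R) : Prop :=
  exists (B : set chart) (L : R),
    [/\ forall c, B c -> is_chart c,
        forall p, exists2 c, B c & cdom c p &
        forall c, B c -> exists2 f, is_density mu c f &
          forall x, cimg c x -> `|f x| <= L /\ `|(f x)^-1| <= L].

End manifold.

Arguments chart : clear implicits.
Arguments smooth_atlas : clear implicits.

Section vector_bundle.
Context {R : realType} {M : ptopologicalType} {n : nat}.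
Variables (A : smooth_atlas R M n) (k : nat) (E : M -> lmodType R[i]).

(* A trivialization Psi = (pi, psi) over tdom: tmap p is psi restricted to the
   fibre over p, and tinv p v is Psi^-1(p, v). *)
Record trivialization := Trivialization {
  tdom : set M;
  tmap : forall p, E p -> 'cV[R[i]]_k;
  tinv : forall p, 'cV[R[i]]_k -> E p;
  tdom_open : open tdom;
  tmap_linear : forall p, tdom p -> forall (a : R[i]) (v w : E p),
    tmap (a *: v + w) = a *: tmap v + tmap w;
  tmapK : forall p, tdom p -> cancel (@tmap p) (@tinv p);
  tinvK : forall p, tdom p -> cancel (@tinv p) (@tmap p)
}.

Definition triv_compatible (s t : trivialization) : Prop :=
  exists g g' : M -> 'M[R[i]]_k,
    [/\ mxsmooth_on A (tdom s `&` tdom t) g,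
        mxsmooth_on A (tdom s `&` tdom t) g',
        forall p v, tdom s p -> tdom t p -> tmap t (tinv s p v) = g p *m v &
        forall p v, tdom s p -> tdom t p -> tmap s (tinv t p v) = g' p *m v].

(* A smooth vector bundle of rank k over M with fibres E p: the topology and
   the smooth structure of the total space are those for which the members of
   trivs are diffeomorphisms onto tdom x C^k. *)
Record vector_bundle := VectorBundle {
  trivs : set trivialization;
  trivs_cover : forall p, exists2 t, trivs t & tdom t p;
  trivs_compatible : forall s t, trivs s -> trivs t -> triv_compatible s t
}.

Variable S : vector_bundle.

Definition is_trivialization (t : trivialization) : Prop :=
  forall s, trivs S s -> triv_compatible t s.

Definition section := forall p, E p.

(* For W open. *)
Definition smooth_section_on (W : set M) (u : section) : Prop :=
  forall t, is_trivialization t ->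
  forall a, csmooth_on A (W `&` tdom t) (fun p => tmap t (u p) a ord0).

Definition smooth_section (u : section) : Prop := smooth_section_on setT u.

Definition compactly_supported_smooth (u : section) : Prop :=
  smooth_section u /\ compact (closure [set p | u p <> 0]).

Definition measurable_section (u : section) : Prop :=
  forall t, is_trivialization t -> forall a,
    measurable_fun (tdom t : set (borel M))
      ((fun p => complex.Re (tmap t (u p) a ord0)) : borel M -> R) /\
    measurable_fun (tdom t : set (borel M))
      ((fun p => complex.Im (tmap t (u p) a ord0)) : borel M -> R).

Definition hermitian_structure := forall p, {dot (E p) for (@Num.conj R[i])}.

Definition smooth_hermitian (h : hermitian_structure) : Prop :=
  forall (W : set M) (u v : section), open W ->
    smooth_section_on W u -> smooth_section_on W v ->
    csmooth_on A W (fun p => h p (u p) (v p)).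

(* Only the values of D on smooth sections matter. *)
Definition differential_operator (D : section -> section) : Prop :=
  [/\ forall u, smooth_section u -> smooth_section (D u),
      forall (a : R[i]) u v, smooth_section u -> smooth_section v ->
        D (fun p => a *: u p + v p) = (fun p => a *: D u p + D v p),
      forall (U : set M) u v, open U -> smooth_section u -> smooth_section v ->
        (forall p, U p -> u p = v p) -> forall p, U p -> D u p = D v p &
      forall (c : chart R M n) (t : trivialization),
        is_chart A c -> is_trivialization t -> cdom c = tdom t ->
        exists (a : 'I_n -> M -> 'M[R[i]]_k) (b : M -> 'M[R[i]]_k),
          [/\ forall j, mxsmooth_on A (cdom c) (a j),
              mxsmooth_on A (cdom c) b &
              forall p u, cdom c p -> smooth_section u ->
                D u p =
                \sum_j tinv t p (a j p *m
                  partial j (fun x => tmap t (u (cinv c x))) (cmap c p)) +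
                tinv t p (b p *m tmap t (u p))]].

End vector_bundle.

Section L2.
Context {R : realType} {M : ptopologicalType} {n k : nat}.
Context {A : smooth_atlas R M n} {E : M -> lmodType R[i]}.
Variables (S : vector_bundle A k E) (h : hermitian_structure E).
Variable mu : {measure set (borel M) -> \bar R}.
Implicit Types (u v w : section E) (D : section E -> section E).

Definition inner u v : R[i] :=
  (Rintegral mu setT (fun p : borel M => complex.Re (h p (u p) (v p))) +i*
   Rintegral mu setT (fun p : borel M => complex.Im (h p (u p) (v p))))%C.

Definition normsq u : \bar R :=
  (\int[mu]_p (complex.Re (h p (u p) (u p)))%:E)%E.

Definition L2_cvg (x : nat -> section E) u : Prop :=
  normsq (fun p => x m p - u p) @[m --> \oo] --> 0%E.

(* Sections representing the elements of L^2(M; S), equal elements being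
   represented by sections equal almost everywhere: the completion of the
   compactly supported smooth sections is realized as their closure in the
   (complete) space of square-integrable measurable sections. *)
Definition in_L2 u : Prop :=
  [/\ measurable_section S u, (normsq u < +oo)%E &
      exists2 x : nat -> section E,
        forall m, compactly_supported_smooth S (x m) & L2_cvg x u].

Definition compactly_supported u : Prop :=
  exists2 K : set M, compact K &
    {ae mu, forall p : borel M, ~ K p -> u p = 0}.

Definition symmetric_operator D : Prop :=
  forall u v,
    compactly_supported_smooth S u -> compactly_supported_smooth S v ->
    inner (D u) v = inner u (D v).

Definition dom_adjoint D u : Prop :=
  in_L2 u /\ exists2 w, in_L2 w &
    forall v, compactly_supported_smooth S v -> inner (D v) u = inner v w.

Definition dom_closure D u : Prop :=
  in_L2 u /\ exists2 w, in_L2 w &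
    exists x : nat -> section E,
      [/\ forall m, compactly_supported_smooth S (x m), L2_cvg x u &
          L2_cvg (fun m => D (x m)) w].

Definition essentially_self_adjoint D : Prop :=
  symmetric_operator D /\ forall u, dom_closure D u <-> dom_adjoint D u.

End L2.

(* Main.v *)
(* Friedrichs' mollifier argument.  That the domain of the closure is contained in
   the domain of the adjoint is a passage to the limit.  Conversely, let u be
   supported in a compact set and let w be D u in the weak sense.  In local frames
   one regularizes by averaging over small translations, and a finite partition of
   unity glues these regularizations into operators T converging to the
   multiplication by a function phi equal to 1 near the support of u.  The commutators
   [D, T] are bounded on L^2 uniformly in the scale, because the derivative can be
   integrated by parts onto the coefficients of D, and they tend to 0 on smooth
   sections; hence T u -> u and D T u = T w + [D, T] u -> phi w.

   Two devices keep everything within smooth sections.  The averages are taken over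
   the finitely many points of a grid, so that no convolution integral occurs: the
   grid is refined first, and then the scale tends to 0.  And T is applied not to u
   but to chi u_m, where chi is a cutoff and the smooth u_m converge to u; with smooth
   w_m converging to w, the difference D (chi u_m) - w_m is small only in the dual of
   the graph norm of D, but at a fixed scale T turns this into smallness in L^2. *)

Require Import Defs.
From mathcomp Require Import all_boot all_order all_algebra.
From mathcomp Require Import all_classical all_reals all_analysis.
From mathcomp Require Import measurable_realfun.
From mathcomp Require Import complex.
From mathcomp Require Import ring lra.

Set Implicit Arguments.
Unset Strict Implicit.
Unset Printing Implicit Defensive.

Import Order.TTheory GRing.Theory Num.Theory.
Import numFieldNormedType.Exports.

Local Open Scope classical_set_scope.
Local Open Scope ring_scope.

(** * Smooth functions on Euclidean space *)

(** The obstacle is that [D (a m)] converges to [w] only when tested against sections, so [a m] with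
    large [m] may enter only through estimates whose constants do not depend on the section. Plain
    convergence, with no rate, is available for one section fixed beforehand.

    A grid average replaces a derivative by a difference quotient, with an error governed by second
    derivatives of the averaged section. This error is not uniform in the section, but it carries
    the mesh as a factor. It is therefore absorbed into an additive [eta] once [N] is large, while
    the constants in front of the norms depend on the operator and, for the smoothing bound, on the
    scale.

    Weak smallness becomes smallness in L^2 by a [T T*] argument: the section [g] is tested against
    the inverse Gram matrix applied to two successive averages of its own coordinates. The pairing
    is then exactly the square norm of the averaged coordinates, and at a fixed scale the graph norm
    of the test section is bounded by the same quantity.

    Young's inequality with a free weight [s] replaces Cauchy-Schwarz for sections, which keeps all
    estimates quadratic and free of square roots. *)

Section Ck_calculus.
Context {R : realType} {n : nat}.
Implicit Types (V W : set 'rV[R]_n) (f g : 'rV[R]_n -> R).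
Local Notation e j := (delta_mx ord0 j : 'rV[R]_n).

Lemma near_open_eq V f g x : open V -> V x ->
  (forall y, V y -> f y = g y) -> \near x, f x = g x.
Proof. by move=> oV Vx fg; exact: filterS fg (open_nbhs_nbhs (conj oV Vx)). Qed.

Lemma Ck_continuous m V f x : Ck m V f -> V x -> {for x, continuous f}.
Proof. by case: m => [|m] [+ _]; exact. Qed.

Lemma CkS m V f : Ck m.+1 V f -> Ck m V f.
Proof.
elim: m f => [|m IH] f [cf df]; first by split.
by split=> // j; have [dj Dj] := df j; split=> //; exact: IH.
Qed.

Lemma for_continuous_ext V f g x : open V -> V x ->
  (forall y, V y -> f y = g y) -> {for x, continuous f} -> {for x, continuous g}.
Proof.
move=> oV Vx fg cf; have : g @ x --> f x.
  apply: cvg_trans cf => P /= Pf.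
  by apply: filterS2 (near_open_eq oV Vx fg) Pf => y /= <-.
by rewrite fg.
Qed.

Lemma Ck_ext m V f g : open V -> (forall x, V x -> f x = g x) ->
  Ck m V f -> Ck m V g.
Proof.
move=> oV; elim: m f g => [|m IH] f g fg [cf df].
  by split=> // x Vx; exact: for_continuous_ext fg (cf x Vx).
split=> [x Vx|j]; first exact: for_continuous_ext fg (cf x Vx).
have [dj Dj] := df j; split=> [x Vx|].
  by apply: near_eq_derivable (dj x Vx); exact: (near_open_eq oV Vx fg).
apply: IH Dj => x Vx.
by apply: near_eq_derive; exact: (near_open_eq oV Vx fg).
Qed.

Lemma Ck_sub m V W f : W `<=` V -> Ck m V f -> Ck m W f.
Proof.
move=> WV; elim: m f => [|m IH] f [cf df]; first by split=> // x /WV/cf.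
split=> [x /WV/cf//|j]; have [dj Dj] := df j; split=> [x /WV/dj//|].
exact: IH.
Qed.

(** The clauses of [Ck] are conditions at single points on the germ of [f], so they can be checked
    with a different set [W] at each point. *)
Lemma Ck_local m V f :
  (forall x, V x -> exists2 W, W x & Ck m W f) -> Ck m V f.
Proof.
elim: m f => [|m IH] f H.
  by split=> // x /H[W Wx [+ _]]; exact.
split=> [x /H[W Wx [+ _]]|j]; first exact.
split=> [x /H[W Wx [_ /(_ j)[+ _]]]|]; first exact.
by apply: IH => x /H[W Wx [_ /(_ j)[_ ?]]]; exists W.
Qed.

Lemma Ck_cst m V c : Ck m V (cst c).
Proof.
elim: m c => [|m IH] c; first by split=> // x _; exact: cst_continuous.
split=> [x _|j]; first exact: cst_continuous.
split=> [x _|]; first exact: derivable_cst.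
by rewrite (_ : 'D__ _ = cst 0) //; apply/funext => x; rewrite derive_cst.
Qed.

Lemma CkD m V f g : open V -> Ck m V f -> Ck m V g -> Ck m V (fun x => f x + g x).
Proof.
move=> oV; elim: m f g => [|m IH] f g [cf df] [cg dg].
  by split=> // x Vx; apply: continuousD; [exact: cf|exact: cg].
split=> [x Vx|j]; first by apply: continuousD; [exact: cf|exact: cg].
have [fj Fj] := df j; have [gj Gj] := dg j; split=> [x Vx|].
  by apply: derivableD; [exact: fj|exact: gj].
apply: Ck_ext (IH _ _ Fj Gj) => // x Vx.
by rewrite -deriveD; [|exact: fj|exact: gj].
Qed.

Lemma CkM m V f g : open V -> Ck m V f -> Ck m V g -> Ck m V (fun x => f x * g x).
Proof.
move=> oV; elim: m f g => [|m IH] f g cf cg.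
  by split=> // x Vx; apply: continuousM; [exact: Ck_continuous cf Vx|exact: Ck_continuous cg Vx].
split=> [x Vx|j].
  by apply: continuousM; [exact: Ck_continuous cf Vx|exact: Ck_continuous cg Vx].
have [_ /(_ j)[fj Fj]] := cf; have [_ /(_ j)[gj Gj]] := cg; split=> [x Vx|].
  by apply: derivableM; [exact: fj|exact: gj].
apply: Ck_ext (CkD oV (IH _ _ (CkS cf) Gj) (IH _ _ (CkS cg) Fj)) => // x Vx.
by rewrite [RHS]deriveM; [|exact: fj|exact: gj].
Qed.

(** The induction closes because the derivative [- f' / f ^ 2] contains the inverse only at the
    order already known. *)
Lemma CkV m V f : open V -> (forall x, V x -> f x != 0) -> Ck m V f ->
  Ck m V (fun x => (f x)^-1).
Proof.
move=> oV f0; elim: m => [|m IH] cf.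
  by split=> // x Vx; apply: continuousV; [exact: f0|exact: Ck_continuous cf Vx].
split=> [x Vx|j].
  by apply: continuousV; [exact: f0|exact: Ck_continuous cf Vx].
have [_ /(_ j)[fj Fj]] := cf; split=> [x Vx|].
  by apply: derivableV; [exact: f0|exact: fj].
have iV := IH (CkS cf).
apply: Ck_ext (CkM oV (CkM oV (Ck_cst m V (-1)) (CkM oV iV iV)) Fj) => // x Vx.
rewrite [RHS]deriveV; [|exact: f0|exact: fj].
by rewrite mulN1r -invfM -expr2.
Qed.

Lemma Ck_sum m V (I : Type) (r : seq I) (P : pred I) (F : I -> 'rV[R]_n -> R) :
  open V -> (forall i, Ck m V (F i)) -> Ck m V (fun x => \sum_(i <- r | P i) F i x).
Proof.
move=> oV cF; elim: r => [|i r IH].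
  by apply: Ck_ext (Ck_cst m V 0) => // x _; rewrite big_nil.
case Pi : (P i).
  by apply: Ck_ext (CkD oV (cF i) IH) => // x _; rewrite big_cons Pi.
by apply: Ck_ext IH => // x _; rewrite big_cons Pi.
Qed.

Lemma Ck_prod m V (I : Type) (r : seq I) (P : pred I) (F : I -> 'rV[R]_n -> R) :
  open V -> (forall i, Ck m V (F i)) -> Ck m V (fun x => \prod_(i <- r | P i) F i x).
Proof.
move=> oV cF; elim: r => [|i r IH].
  by apply: Ck_ext (Ck_cst m V 1) => // x _; rewrite big_nil.
case Pi : (P i).
  by apply: Ck_ext (CkM oV (cF i) IH) => // x _; rewrite big_cons Pi.
by apply: Ck_ext IH => // x _; rewrite big_cons Pi.
Qed.

Lemma derive_coord (i j : 'I_n) (x : 'rV[R]_n) :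
  is_derive x (e j) (fun y : 'rV[R]_n => y ord0 i) (i == j)%:R.
Proof.
have H : (fun h : R => h^-1 *: ((h *: e j + x) ord0 i - x ord0 i)) @ 0^' -->
    ((i == j)%:R : R).
  apply: cvg_near_cst; near=> t; rewrite !mxE addrK eqxx /=.
  by rewrite /GRing.scale/= mulrA mulVf ?mul1r//; near: t; exact: nbhs_dnbhs_neq.
apply: DeriveDef; first by apply/cvg_ex; exists ((i == j)%:R : R).
exact: cvg_lim H.
Unshelve. all: by end_near. Qed.

Lemma Ck_coord m V (i : 'I_n) : open V -> Ck m V (fun x => x ord0 i).
Proof.
move=> oV; case: m => [|m]; first by split=> // x _; exact: coord_continuous.
split=> [x _|j]; first exact: coord_continuous.
split=> [x _|]; first by have [] := derive_coord i j x.
apply: Ck_ext (Ck_cst m V (i == j)%:R) => // x _.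
by have [_ ->] := derive_coord i j x.
Qed.

End Ck_calculus.

(** * Mean value formulas and the chain rule *)

Section mean_value.
Context {R : realType} {n : nat}.
Implicit Types (f : 'rV[R]_n -> R) (x h : 'rV[R]_n).
Local Notation e j := (delta_mx ord0 j : 'rV[R]_n).

Lemma is_derive_line f x (v : 'rV[R]_n) (s : R) : derivable f (x + s *: v) v ->
  is_derive s 1 (fun s : R => f (x + s *: v)) ('D_v f (x + s *: v)).
Proof.
move=> df; have E : (fun h : R => h^-1 *: (f (h *: v + (x + s *: v)) - f (x + s *: v))) =
    (fun h : R => h^-1 *: (f (x + (h *: 1 + s) *: v) - f (x + s *: v))).
  by apply/funext => h; congr (_ *: (f _ - _)); rewrite [h *: 1]mulr1 scalerDl addrCA.
apply: DeriveDef; first by move: df; rewrite /derivable /= E.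
by rewrite /derive /= -E.
Qed.

Lemma mean_value_coord f x (j : 'I_n) (t : R) :
  (forall s, 0 <= s <= 1 -> derivable f (x + (s * t) *: e j) (e j)) ->
  exists2 s, 0 <= s <= 1 &
    f (x + t *: e j) - f x = t * 'D_(e j) f (x + (s * t) *: e j).
Proof.
move=> df; pose g (s : R) := f (x + (s * t) *: e j).
have dg (s : R) : 0 <= s <= 1 ->
    is_derive s 1 g (t * 'D_(e j) f (x + (s * t) *: e j)).
  move=> s01; have := is_derive_line (df s s01) => d1.
  have d2 : is_derive s 1 (fun s : R => s * t) t.
    by apply: is_derive_eq; rewrite /GRing.scale /= mulr0 add0r mulr1.
  by rewrite [t * _]mulrC; exact: (@is_derive1_comp R (fun s : R => f (x + s *: e j)) (fun s => s * t) s _ _ d1 d2).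
have [s||s s01] := @MVT_segment R g (fun s => t * 'D_(e j) f (x + (s * t) *: e j)) 0 1 ler01.
- by rewrite in_itv /= => /andP[a b]; apply: dg; rewrite !ltW.
- apply: derivable_within_continuous => s; rewrite in_itv /= => s01.
  by have [] := dg s s01.
rewrite subr0 mulr1 /g mul1r mul0r scale0r addr0 => ->; by exists s => //; rewrite in_itv /= in s01.
Qed.

(** The increment is telescoped along the coordinate axes: [tr m] carries the first [m] coordinates
    of [h], and each step is a one-variable mean value. The points [xi i] differ with [i], which is
    harmless in estimates, since all of them lie in the box spanned by [h]. *)
Lemma mean_value_box f x h :
  (forall y : 'rV[R]_n, (forall l, `|y ord0 l - x ord0 l| <= `|h ord0 l|) ->
    forall i, derivable f y (e i)) ->
  exists xi : 'I_n -> 'rV[R]_n,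
    (forall i l, `|xi i ord0 l - x ord0 l| <= `|h ord0 l|) /\
    f (x + h) - f x = \sum_i h ord0 i * 'D_(e i) f (xi i).
Proof.
move=> df; pose tr (m : nat) : 'rV[R]_n := \row_l (if (l < m)%N then h ord0 l else 0).
have trS (i : 'I_n) (s : R) l : (tr i + (s * h ord0 i) *: e i) ord0 l =
    if (l < i)%N then h ord0 l else if l == i then s * h ord0 i else 0.
  rewrite !mxE eqxx /= eq_sym; have [->|nli] := eqVneq l i.
    by rewrite ltnn add0r mulr1.
  by rewrite !mulr0 addr0; case: ifP.
have box (i : 'I_n) (s : R) l : 0 <= s <= 1 ->
   `|(x + tr i + (s * h ord0 i) *: e i) ord0 l - x ord0 l| <= `|h ord0 l|.
  move=> /andP[s0 s1]; rewrite -addrA mxE addrC addKr trS.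
  case: ifP => // _; have [->|_] := eqVneq l i; last by rewrite normr0.
  by rewrite normrM ger0_norm// ler_piMl.
have step (i : 'I_n) : exists xi : 'rV[R]_n,
    (forall l, `|xi ord0 l - x ord0 l| <= `|h ord0 l|) /\
    f (x + tr i.+1) - f (x + tr i) = h ord0 i * 'D_(e i) f xi.
  have [s s01|s s01 H] := @mean_value_coord f (x + tr i) i (h ord0 i).
    by apply: df => l; exact: box.
  exists (x + tr i + (s * h ord0 i) *: e i); split=> [l|]; first exact: box.
  rewrite -H; congr (f _ - _); rewrite -addrA; congr (_ + _).
  apply/rowP => l; have := trS i 1 l; rewrite mul1r => ->.
  by rewrite mxE ltnS -val_eqE /=; case: ltngtP => // /val_inj->.
have [xi Hxi] := choice step; exists xi; split=> [i l|].
  by have [] := Hxi i.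
under eq_bigr => i _ do rewrite -(Hxi i).2.
rewrite -(big_mkord xpredT (fun i => f (x + tr i.+1) - f (x + tr i))).
rewrite telescope_sumr//; congr (f _ - f _).
  by congr (_ + _); apply/rowP => l; rewrite mxE ltn_ord.
by rewrite (_ : tr 0%N = 0) ?addr0//; apply/rowP => l; rewrite !mxE.
Qed.

End mean_value.

Lemma mx_norm_le {R : realType} m n (x : 'M[R]_(m, n)) (c : R) : 0 <= c ->
  (`|x| <= c) <-> (forall i j, `|x i j| <= c).
Proof.
move=> c0; split=> [xc i j|H].
  by apply: le_trans xc; rewrite [leRHS]mx_normrE; apply: (le_bigmax _ _ (i, j)).
by rewrite [leLHS]mx_normrE; apply: bigmax_le.
Qed.

Lemma rV_norm_coord {R : realType} n (x : 'rV[R]_n) i : `|x ord0 i| <= `|x|.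
Proof. by apply: (mx_norm_le x (normr_ge0 x)).1. Qed.

Lemma continuous_rV {R : realType} n (T : topologicalType) (f : T -> 'rV[R]_n) x :
  (forall i, {for x, continuous (fun t => f t ord0 i)}) -> {for x, continuous f}.
Proof.
move=> cf; apply/cvgrPdist_le => eps e0.
have : \forall t \near x, forall i, `|f x ord0 i - f t ord0 i| <= eps.
  by apply: filter_forall => i; move/cvgrPdist_le: (cf i); exact.
apply: filterS => t H; apply/mx_norm_le; first exact: ltW.
by move=> i j; rewrite (ord1 i) !mxE.
Qed.

Lemma cvg_sumr {R : realType} (T : Type) (F : set_system T) {FF : Filter F}
    (I : Type) (r : seq I) (f : I -> T -> R) (l : I -> R) :
  (forall i, f i @ F --> l i) ->
  (fun x => \sum_(i <- r) f i x) @ F --> \sum_(i <- r) l i.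
Proof.
move=> fl; elim: r => [|i r IH].
  rewrite big_nil (_ : (fun _ => _) = cst 0); first exact: cvg_cst.
  by apply/funext => x; rewrite big_nil.
rewrite big_cons (_ : (fun _ => _) = (fun x => f i x + \sum_(i <- r) f i x)).
  by apply: cvgD.
by apply/funext => x; rewrite big_cons.
Qed.

Section chain_rule.
Context {R : realType} {m n : nat}.
Implicit Types (f : 'rV[R]_n -> R) (g : 'rV[R]_m -> 'rV[R]_n).

(** By [mean_value_box] the difference quotient of [f \o g] is a sum of partial derivatives of [f]
    at points [xi t i] in the box spanned by the increment [q t]. These points tend to [g x], where
    the partial derivatives are continuous. *)
Lemma is_derive_comp_rV f g (V : set 'rV[R]_n) x (v : 'rV[R]_m) : open V -> V (g x) ->
  (forall y i, V y -> derivable f y (delta_mx ord0 i)) ->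
  (forall i, {for g x, continuous ('D_(delta_mx ord0 i) f)}) ->
  (forall i, derivable (fun y => g y ord0 i) x v) ->
  is_derive x v (f \o g)
    (\sum_i 'D_(delta_mx ord0 i) f (g x) * 'D_v (fun y => g y ord0 i) x).
Proof.
move=> oV Vgx df cf dg.
pose q (t : R) := g (t *: v + x) - g x.
have cq i : (fun t => q t ord0 i) @ 0^' --> (0 : R).
  have /derivable1P/derivable1_diffP/differentiable_continuous := dg i.
  move=> /continuous_withinNx; rewrite scale0r add0r => c.
  have -> : (fun t => q t ord0 i) = (fun t => g (t *: v + x) ord0 i - g x ord0 i).
    by apply/funext => t; rewrite /q !mxE.
  by apply/subr_cvg0; exact: c.
have [d d0 dV] : exists2 d : R, 0 < d & forall y, `|g x - y| <= d -> V y.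
  have /nbhs_ballP[d /= d0 dV] := open_nbhs_nbhs (conj oV Vgx).
  exists (d / 2) => [|y yd]; first by rewrite divr_gt0.
  apply: dV; rewrite -ball_normE /ball_ /=; apply: le_lt_trans yd _.
  by rewrite ltr_pdivrMr// ltr_pMr// ltr1n.
(* For large increments the value [g x] is a dummy, so that one choice function serves all [t]; the
   formula is only claimed when [q t] has norm at most [d]. *)
have step (t : R) : exists xi : 'I_n -> 'rV[R]_n,
    (forall i l, `|xi i ord0 l - g x ord0 l| <= `|q t ord0 l|) /\
    (`|q t| <= d -> f (g (t *: v + x)) - f (g x) =
      \sum_i q t ord0 i * 'D_(delta_mx ord0 i) f (xi i)).
  have [qd|qd] := leP `|q t| d; last first.
    by exists (fun=> g x); split=> // i l; rewrite subrr normr0.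
  have [y yq i|xi [H1 H2]] := @mean_value_box R n f (g x) (q t).
    apply: df; apply: dV; apply/mx_norm_le => [|a b]; first exact: ltW.
    rewrite (ord1 a) !mxE distrC; apply: le_trans (yq b) _.
    exact: le_trans (rV_norm_coord _ _) qd.
  by exists xi; split=> // _; rewrite -H2 /q [g x + _]addrC subrK.
have [xi Hxi] := choice step.
have cxi i : (fun t => xi t i) @ 0^' --> g x.
  apply/cvgrPdist_le => eps e0.
  have : \forall t \near 0^', forall l, `|q t ord0 l| <= eps.
    apply: filter_forall => l; have /cvgr0Pnorm_le := cq l; exact.
  apply: filterS => t H; apply/mx_norm_le; first exact: ltW.
  move=> a b; rewrite (ord1 a) !mxE distrC.
  exact: le_trans ((Hxi t).1 i b) (H b).
have qd : \forall t \near 0^', `|q t| <= d.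
  have : \forall t \near 0^', forall l, `|q t ord0 l| <= d.
    apply: filter_forall => l; have /cvgr0Pnorm_le := cq l; exact.
  apply: filterS => t H; apply/mx_norm_le => [|a b]; first exact: ltW.
  by rewrite (ord1 a).
have L : (fun t : R => t^-1 *: (f (g (t *: v + x)) - f (g x))) @ 0^' -->
   \sum_i 'D_(delta_mx ord0 i) f (g x) * 'D_v (fun y => g y ord0 i) x.
  have : (fun t : R => \sum_i 'D_(delta_mx ord0 i) f (xi t i) *
       (t^-1 *: (g (t *: v + x) ord0 i - g x ord0 i))) @ 0^' -->
     \sum_i 'D_(delta_mx ord0 i) f (g x) * 'D_v (fun y => g y ord0 i) x.
    apply: cvg_sumr => i; apply: cvgM; last exact: dg.
    exact: (cvg_comp _ _ (cxi i) (cf i)).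
  apply: cvg_trans => P /= HP.
  apply: filterS2 qd HP => t qdt /=; rewrite ((Hxi t).2 qdt).
  rewrite /GRing.scale /= mulr_sumr; congr (P _); apply: eq_bigr => i _.
  by rewrite mulrCA; congr (_ * _); rewrite mulrC; congr (_ * _); rewrite /q !mxE.
apply: DeriveDef; first by apply/cvg_ex; eexists; exact: L.
exact: cvg_lim L.
Qed.

(** Induction on the order with [f] varying: the partial derivatives of [f], composed with [g], are
    again of this form one order lower, and [CkS] lowers the order asked of [g]. *)
Lemma Ck_comp k (V : set 'rV[R]_n) (W : set 'rV[R]_m) f g : open V -> open W ->
  (forall x, W x -> V (g x)) -> (forall i, Ck k W (fun x => g x ord0 i)) ->
  Ck k V f -> Ck k W (f \o g).
Proof.
move=> oV oW WV cg cf.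
have cfg x : W x -> {for x, continuous (f \o g)}.
  move=> Wx; apply: continuous_comp; last exact: Ck_continuous cf (WV x Wx).
  by apply: continuous_rV => i; exact: Ck_continuous (cg i) Wx.
elim: k f cg cf cfg => [|k IH] f cg cf cfg; first by split.
split=> // j.
have D x : W x -> is_derive x (delta_mx ord0 j) (f \o g) (\sum_i
    'D_(delta_mx ord0 i) f (g x) * 'D_(delta_mx ord0 j) (fun y => g y ord0 i) x).
  move=> Wx; apply: (@is_derive_comp_rV _ _ V) => //; first exact: WV.
  - by move=> y i; have [_ /(_ i)[+ _]] := cf; exact.
  - by move=> i; have [_ /(_ i)[_ h]] := cf; exact: Ck_continuous h (WV x Wx).
  - by move=> i; have [_ /(_ j)[+ _]] := cg i; exact.
split=> [x /D[]//|].
apply: (@Ck_ext _ _ k W (fun x => \sum_i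
    'D_(delta_mx ord0 i) f (g x) * 'D_(delta_mx ord0 j) (fun y => g y ord0 i) x)) => //.
  by move=> x /D[_ ->].
apply: Ck_sum => // i; apply: CkM => //.
  have cf' : Ck k V ('D_(delta_mx ord0 i) f) by have [_ /(_ i)[]] := cf.
  apply: (IH ('D_(delta_mx ord0 i) f)) => // [i'|x Wx]; first exact: CkS.
  apply: continuous_comp; last exact: Ck_continuous cf' (WV x Wx).
  by apply: continuous_rV => i'; exact: Ck_continuous (cg i') Wx.
by have [_ /(_ j)[]] := cg i.
Qed.

End chain_rule.

(** * Flat functions and bump functions *)

Section flat_function.
Context {R : realType}.

(* The family is stable under differentiation, which makes [flat 0], i.e.
   [exp (- 1 / x)] extended by 0, smooth. *)
Definition flat (m : nat) (x : R) : R :=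
  if 0 < x then x ^- m * expR (- x^-1) else 0.

(** With [y = 1 / x], the bound [expR y >= (y / (m + 1)) ^ (m + 1)], a power of [expR z >= 1 + z],
    cancels [x ^- m] and leaves one factor [x] to spare. *)
Lemma flat_le m (x : R) : 0 <= flat m x <= m.+1%:R ^+ m.+1 * `|x|.
Proof.
rewrite /flat; case: ltP => [x0|x0]; last first.
  by rewrite lexx mulr_ge0// exprn_ge0.
rewrite mulr_ge0 ?expR_ge0 ?invr_ge0 ?exprn_ge0 ?(ltW x0)//= gtr0_norm//.
have m0 : (0 : R) < m.+1%:R by rewrite ltr0n.
have H : (x^-1 / m.+1%:R) ^+ m.+1 <= expR x^-1.
  have -> : expR x^-1 = expR (x^-1 / m.+1%:R) ^+ m.+1.
    by rewrite -expRM_natl mulrC divfK// gt_eqF.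
  rewrite lerXn2r ?nnegrE ?expR_ge0 ?divr_ge0 ?invr_ge0 ?(ltW x0)//.
  by apply: le_trans (expR_ge1Dx _); rewrite lerDr.
rewrite expRN ler_pdivrMr ?expR_gt0//.
have -> : x ^- m = m.+1%:R ^+ m.+1 * x * (x^-1 / m.+1%:R) ^+ m.+1.
  rewrite exprMn !exprVn; set c := _%:R ^+ _; rewrite exprS.
  have cn0 : c != 0 by rewrite expf_neq0 ?gt_eqF.
  have xn0 : x ^+ m != 0 by rewrite expf_neq0 ?gt_eqF.
  by move: (x ^+ m) xn0 => y yn0; field; rewrite cn0 yn0 gt_eqF.
by rewrite ler_wpM2l// mulr_ge0 ?exprn_ge0 ?ltW.
Qed.

Lemma flat_ge0 m (x : R) : 0 <= flat m x.
Proof. by have /andP[] := flat_le m x. Qed.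

Lemma flat_gt0 m (x : R) : 0 < x -> 0 < flat m x.
Proof. by rewrite /flat => x0; rewrite x0 mulr_gt0 ?expR_gt0 ?invr_gt0 ?exprn_gt0. Qed.

Lemma flat_npos m (x : R) : x <= 0 -> flat m x = 0.
Proof. by rewrite /flat ltNge => ->. Qed.

(** At 0 the difference quotient of [flat m] is [flat m.+1] itself, which tends to 0 by [flat_le];
    on either side of 0 the function coincides near [x] with an elementary one. *)
Lemma is_derive_flat m (x : R) :
  is_derive x 1 (flat m) (- m%:R * flat m.+1 x + flat m.+2 x).
Proof.
have [x0|x0|x0] := ltgtP x 0.
- rewrite !flat_npos ?ltW// mulr0 addr0.
  apply: (@near_eq_is_derive R R R (cst 0) (flat m) x 1 0).
  near=> y; rewrite flat_npos//; apply: ltW; near: y.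
  exact: lt_nbhsl.
- apply: (@near_eq_is_derive R R R (fun x => x ^- m * expR (- x^-1)) (flat m)).
    near=> y; rewrite /flat ifT//; near: y.
    exact: (open_nbhs_nbhs (conj (@open_gt R 0) x0)).
  have xn0 : x != 0 by rewrite gt_eqF.
  have d1 : is_derive x 1 (fun y : R => y^-1) (- x ^- 2).
    by apply: DeriveDef; [exact: derivableV|rewrite deriveV// derive_id /GRing.scale/= mulr1].
  have d2 := @is_derive1_comp R expR (fun y => - y^-1) x _ _ (is_derive_expR _) (is_deriveN d1).
  have d3 : is_derive x 1 (fun y : R => y ^- m) (- m%:R * x ^- m.+1).
    have := is_deriveX m d1.
    rewrite (_ : (fun y : R => y^-1) ^+ m = (fun y : R => y ^- m)); last first.
      by apply/funext => y; rewrite exprfctE exprVn.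
    move=> h; apply: is_derive_eq h _; rewrite /GRing.scale/=.
    case: m => [|m]; first by rewrite !mul0r oppr0 mul0r.
    by rewrite -pred_Sn !exprVn !exprS; field; rewrite expf_neq0.
  have := is_deriveM d3 d2.
  move=> h; apply: is_derive_eq h _; rewrite /GRing.scale/= /flat x0.
  by rewrite !exprS; field; rewrite expf_neq0.
rewrite x0 !flat_npos// mulr0 addr0.
have L : (fun h : R => h^-1 *: (flat m (h *: 1 + 0) - flat m 0)) @ 0^' --> (0 : R).
  apply/cvgr0Pnorm_le => eps e0; near=> h.
  have hn0 : h != 0 by near: h; exact: nbhs_dnbhs_neq.
  rewrite (flat_npos m (lexx 0)) subr0 addr0 [h *: 1]mulr1 /GRing.scale/=.
  have -> : h^-1 * flat m h = flat m.+1 h.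
    by rewrite /flat; case: ifP; rewrite ?mulr0// exprS invfM mulrA.
  rewrite ger0_norm ?flat_ge0//.
  have /andP[_ /le_trans] := flat_le m.+1 h; apply.
  have c0 : 0 < m.+2%:R ^+ m.+2 :> R by rewrite exprn_gt0 ?ltr0n.
  rewrite -ler_pdivlMl// mulrC; near: h; apply: nbhs_dnbhs.
  have := @nbhs0_le R R (eps / m.+2%:R ^+ m.+2); apply; by rewrite divr_gt0.
apply: DeriveDef; first by apply/cvg_ex; exists (0 : R); exact: L.
exact: cvg_lim L.
Unshelve. all: by end_near. Qed.

(** The denominator is positive because [t] and [1 - t] are never both nonpositive; the transition
    from 0 to 1 takes place on the unit interval. *)
Definition smoothstep (t : R) : R := flat 0 t / (flat 0 t + flat 0 (1 - t)).

Lemma smoothstep_den (t : R) : 0 < flat 0 t + flat 0 (1 - t).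
Proof.
have [t0|t0] := ltP 0 t; first by rewrite ltr_wpDr ?flat_ge0 ?flat_gt0.
by rewrite ltr_wpDl ?flat_ge0 ?flat_gt0// subr_gt0 (le_lt_trans t0).
Qed.

Lemma smoothstep_ge0 (t : R) : 0 <= smoothstep t.
Proof. by rewrite divr_ge0 ?flat_ge0// ltW ?smoothstep_den. Qed.

Lemma smoothstep_le1 (t : R) : smoothstep t <= 1.
Proof. by rewrite ler_pdivrMr ?smoothstep_den// mul1r lerDl flat_ge0. Qed.

Lemma smoothstep_npos (t : R) : t <= 0 -> smoothstep t = 0.
Proof. by move=> t0; rewrite /smoothstep flat_npos// mul0r. Qed.

Lemma smoothstep_ge1 (t : R) : 1 <= t -> smoothstep t = 1.
Proof.
move=> t1; have := smoothstep_den t; rewrite /smoothstep (@flat_npos _ (1 - t)) ?subr_le0//.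
by rewrite addr0 => /gt_eqF/negbT h; rewrite divff.
Qed.

End flat_function.

Section smooth_calculus.
Context {R : realType} {n : nat}.
Implicit Types (V W : set 'rV[R]_n) (f g : 'rV[R]_n -> R).
Local Notation e j := (delta_mx ord0 j : 'rV[R]_n).

Lemma smooth_ext V f g : open V -> (forall x, V x -> f x = g x) ->
  smooth V f -> smooth V g.
Proof. by move=> oV fg sf m; exact: Ck_ext (sf m). Qed.

Lemma smooth_sub V W f : W `<=` V -> smooth V f -> smooth W f.
Proof. by move=> WV sf m; exact: Ck_sub (sf m). Qed.

Lemma smooth_local V f :
  (forall x, V x -> exists2 W, W x & smooth W f) -> smooth V f.
Proof. by move=> H m; apply: Ck_local => x /H[W Wx sW]; exists W. Qed.

Lemma smooth_cst V c : smooth V (cst c).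
Proof. by move=> m; exact: Ck_cst. Qed.

Lemma smoothD V f g : open V -> smooth V f -> smooth V g -> smooth V (fun x => f x + g x).
Proof. by move=> oV sf sg m; exact: CkD. Qed.

Lemma smoothM V f g : open V -> smooth V f -> smooth V g -> smooth V (fun x => f x * g x).
Proof. by move=> oV sf sg m; exact: CkM. Qed.

Lemma smoothN V f : open V -> smooth V f -> smooth V (fun x => - f x).
Proof.
move=> oV sf; apply: (smooth_ext oV _ (smoothM oV (smooth_cst V (-1)) sf)) => x _.
by rewrite mulN1r.
Qed.

Lemma smoothB V f g : open V -> smooth V f -> smooth V g -> smooth V (fun x => f x - g x).
Proof. by move=> oV sf sg; apply: smoothD => //; exact: smoothN. Qed.

Lemma smoothV V f : open V -> (forall x, V x -> f x != 0) -> smooth V f ->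
  smooth V (fun x => (f x)^-1).
Proof. by move=> oV f0 sf m; exact: CkV. Qed.

Lemma smooth_sum V (I : Type) (r : seq I) (P : pred I) (F : I -> 'rV[R]_n -> R) :
  open V -> (forall i, smooth V (F i)) -> smooth V (fun x => \sum_(i <- r | P i) F i x).
Proof. by move=> oV sF m; apply: Ck_sum => // i; exact: sF. Qed.

Lemma smooth_prod V (I : Type) (r : seq I) (P : pred I) (F : I -> 'rV[R]_n -> R) :
  open V -> (forall i, smooth V (F i)) -> smooth V (fun x => \prod_(i <- r | P i) F i x).
Proof. by move=> oV sF m; apply: Ck_prod => // i; exact: sF. Qed.

Lemma smooth_coord V i : open V -> smooth V (fun x => x ord0 i).
Proof. by move=> oV m; exact: Ck_coord. Qed.

Lemma smooth_derive V f j : smooth V f -> smooth V ('D_(e j) f).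
Proof. by move=> sf m; have [_ /(_ j)[]] := sf m.+1. Qed.

Lemma smooth_derivable V f x j : smooth V f -> V x -> derivable f x (e j).
Proof. by move=> sf Vx; have [_ /(_ j)[+ _]] := sf 1%N; exact. Qed.

Lemma smooth_continuous V f x : smooth V f -> V x -> {for x, continuous f}.
Proof. by move=> sf; exact: Ck_continuous (sf 0%N). Qed.

Lemma is_derive_of_line f x v d :
  is_derive (0 : R) 1 (fun s : R => f (x + s *: v)) d -> is_derive x v f d.
Proof.
have E : (fun h : R => h^-1 *: (f (h *: v + x) - f x)) =
    (fun h : R => h^-1 *: (f (x + (h *: 1 + 0) *: v) - f (x + 0 *: v))).
  apply/funext => h; congr (_ *: (f _ - f _)); last by rewrite scale0r addr0.
  by rewrite addrC [h *: 1]mulr1 addr0.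
move=> [H1 H2]; apply: DeriveDef; first by rewrite /derivable /= E.
by rewrite -H2 /derive /= -E.
Qed.

(** The induction on the order treats all [m] at once, since differentiation raises the index of
    [flat] by one and by two. *)
Lemma smooth_flat m V f : open V -> smooth V f -> smooth V (fun x => flat m (f x)).
Proof.
move=> oV sf k; elim: k m => [|k IH] m;
  have c (x : 'rV[R]_n) : V x -> {for x, continuous (fun x => flat m (f x))}.
- move=> Vx; apply: continuous_comp; first exact: smooth_continuous sf Vx.
  by apply/differentiable_continuous/derivable1_diffP; have [] := is_derive_flat m (f x).
- by split.
- move=> Vx; apply: continuous_comp; first exact: smooth_continuous sf Vx.
  by apply/differentiable_continuous/derivable1_diffP; have [] := is_derive_flat m (f x).
split=> // j.
have D (x : 'rV[R]_n) : V x -> is_derive x (e j) (fun x => flat m (f x))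
    ((- m%:R * flat m.+1 (f x) + flat m.+2 (f x)) * 'D_(e j) f x).
  move=> Vx; apply: is_derive_of_line.
  have := @is_derive_line R n f x (e j) 0; rewrite scale0r addr0.
  move=> /(_ (smooth_derivable sf Vx)) d1.
  have d2 := is_derive_flat m (f x).
  have E : f x = f (x + 0 *: e j) by rewrite scale0r addr0.
  rewrite {1}E in d2.
  exact: (@is_derive1_comp R (flat m) (fun s => f (x + s *: e j)) 0 _ _ d2 d1).
split=> [x /D[]//|].
apply: (@Ck_ext _ _ k V (fun x => (- m%:R * flat m.+1 (f x) + flat m.+2 (f x)) * 'D_(e j) f x)) => //.
  by move=> x /D[_ ->].
by apply: CkM => //; [apply: CkD => //; apply: CkM => //; exact: Ck_cst|exact: smooth_derive].
Qed.

Lemma smooth_smoothstep V f : open V -> smooth V f -> smooth V (fun x => smoothstep (f x)).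
Proof.
move=> oV sf; have s1 : smooth V (fun x => flat 0 (1 - f x)).
  by apply: smooth_flat => //; apply: smoothB => //; exact: smooth_cst.
apply: smoothM => //; first exact: smooth_flat.
apply: smoothV => //; first by move=> x _; rewrite gt_eqF ?smoothstep_den.
by apply: smoothD => //; exact: smooth_flat.
Qed.

(** Balls of the sup norm are cubes, so a product of one-variable bumps suffices. With [s] the
    rescaled coordinate, [2 - s] and [2 + s] are both at least 1 when [|s| <= 1], and one of them is
    nonpositive when [|s| >= 2]. *)
Lemma bump_exists (x0 : 'rV[R]_n) (r : R) : 0 < r -> exists b : 'rV[R]_n -> R,
  [/\ smooth setT b, forall x, 0 <= b x <= 1,
      forall x, `|x - x0| <= r -> b x = 1 &
      forall x, 2 * r <= `|x - x0| -> b x = 0].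
Proof.
move=> r0.
pose s (i : 'I_n) (x : 'rV[R]_n) := (x ord0 i - x0 ord0 i) / r.
pose b x := \prod_i (smoothstep (2 - s i x) * smoothstep (2 + s i x)).
have ss i : smooth setT (s i).
  apply: smoothM; [exact: openT| |exact: smooth_cst].
  by apply: smoothB; [exact: openT|apply: smooth_coord; exact: openT|exact: smooth_cst].
have sr i (x : 'rV[R]_n) : `|s i x| = `|(x - x0) ord0 i| / r.
  by rewrite !mxE /s normrM normfV (gtr0_norm r0).
exists b; split.
- apply: smooth_prod => [|i]; first exact: openT.
  apply: smoothM; first exact: openT.
    by apply: smooth_smoothstep; [exact: openT|apply: smoothB => //; [exact: openT|exact: smooth_cst]].
  by apply: smooth_smoothstep; [exact: openT|apply: smoothD => //; [exact: openT|exact: smooth_cst]].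
- move=> x; rewrite /b; apply/andP; split.
    by apply: prodr_ge0 => i _; rewrite mulr_ge0 ?smoothstep_ge0.
  apply: prodr_ile1 => i _; rewrite mulr_ge0 ?smoothstep_ge0//=.
  by rewrite mulr_ile1 ?smoothstep_ge0 ?smoothstep_le1.
- move=> x xr; rewrite /b big1// => i _.
  have : `|s i x| <= 1.
    by rewrite sr ler_pdivrMr// mul1r; apply: le_trans xr; exact: rV_norm_coord.
  rewrite ler_norml => /andP[h1 h2].
  by rewrite !smoothstep_ge1 ?mulr1//; lra.
- move=> x xr; have [i xi] : exists i, 2 * r <= `|(x - x0) ord0 i|.
    have : mx_norm (x - x0) != 0 by apply: lt0r_neq0; apply: lt_le_trans xr; rewrite mulr_gt0.
    by move=> /mx_norm_neq0[[a i] h]; exists i; move: xr; rewrite [X in _ <= X]h (ord1 a).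
  have : 2 <= `|s i x| by rewrite sr ler_pdivlMr.
  rewrite /b (bigD1 i)//= ler_normr => /orP[] h.
    by rewrite (@smoothstep_npos _ (2 - s i x)) ?mul0r//; lra.
  by rewrite (@smoothstep_npos _ (2 + s i x)) ?mulr0 ?mul0r//; lra.
Qed.

Lemma norm_le_closed (x0 : 'rV[R]_n) (r : R) : closed [set x : 'rV[R]_n | `|x - x0| <= r].
Proof.
have -> : [set x : 'rV[R]_n | `|x - x0| <= r] = (fun x => `|x - x0|) @^-1` [set t | t <= r] by [].
apply: preimage_closed; last exact: closed_le.
by move=> x _; apply: continuous_comp; [apply: continuousB; [exact: cvg_id|exact: cst_continuous]|exact: norm_continuous].
Qed.

Lemma norm_le_compact (x0 : 'rV[R]_n) (r : R) : compact [set x : 'rV[R]_n | `|x - x0| <= r].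
Proof.
apply: bounded_closed_compact; last exact: norm_le_closed.
exists (r + `|x0|); split; first exact: num_real.
move=> M rM x /= xr; apply: ltW; apply: le_lt_trans rM.
by rewrite -[x in `|x|](subrK x0); apply: le_trans (ler_normD _ _) _; rewrite lerD2r.
Qed.

Definition zero_extend V f (x : 'rV[R]_n) : R := if x \in V then f x else 0.

Lemma zero_extendE V f x : V x -> zero_extend V f x = f x.
Proof. by move=> Vx; rewrite /zero_extend mem_set. Qed.

(** [V] and the complement of [F] are open and cover the space; on the latter the extension is 0. *)
Lemma smooth_zero_extend V (F : set 'rV[R]_n) f : open V -> closed F -> F `<=` V ->
  (forall x, V x -> ~ F x -> f x = 0) -> smooth V f -> smooth setT (zero_extend V f).
Proof.
move=> oV cF FV f0 sf; apply: smooth_local => x _.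
have [Vx|nVx] := pselect (V x).
  by exists V => //; apply: smooth_ext sf => // y Vy; rewrite zero_extendE.
exists (~` F); first by move=> /FV.
apply: (smooth_ext _ _ (smooth_cst _ 0)); first exact: closed_openC.
move=> y nFy; rewrite /zero_extend; case: ifPn => // /set_mem Vy.
by rewrite f0.
Qed.

Lemma bounded_on_compact (K : set 'rV[R]_n) f : compact K ->
  (forall x, K x -> {for x, continuous f}) -> exists2 B, 0 < B & forall x, K x -> `|f x| <= B.
Proof.
move=> cK cf; have : compact (f @` K).
  apply: continuous_compact => //; apply: continuous_in_subspaceT => x /set_mem; exact: cf.
move=> /compact_bounded[M [_ HM]]; exists (`|M| + 1).
  by rewrite ltr_wpDl.
move=> x Kx; apply: (HM (`|M| + 1)); last by exists x.
by rewrite (le_lt_trans (ler_norm M))// ltrDl.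
Qed.

Lemma bounded_csupp f (x0 : 'rV[R]_n) (r : R) : smooth setT f ->
  (forall x, r < `|x - x0| -> f x = 0) -> exists2 B, 0 < B & forall x, `|f x| <= B.
Proof.
move=> sf f0; have [x _|B B0 HB] := bounded_on_compact (@norm_le_compact x0 r) (f := f).
  exact: smooth_continuous sf I.
exists B => // x; have [/HB//|/f0->] := leP `|x - x0| r.
by rewrite normr0 ltW.
Qed.

Lemma derive_csupp f (x0 : 'rV[R]_n) (r : R) j :
  (forall x, r < `|x - x0| -> f x = 0) -> forall x, r < `|x - x0| -> 'D_(e j) f x = 0.
Proof.
move=> f0 x rx; rewrite -(@derive_cst R _ _ (0 : R) x (e j)).
apply: near_eq_derive; apply: (@near_open_eq _ _ [set x | r < `|x - x0|]) => //.
have := closed_openC (@norm_le_closed x0 r); congr open.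
by apply/seteqP; split=> y /=; rewrite ltNge => /negP.
Qed.

(** The constant is the sum of bounds for the partial derivatives, by [mean_value_box]; the added 1
    keeps it positive in dimension 0. *)
Lemma lipschitz_csupp f (x0 : 'rV[R]_n) (r : R) : smooth setT f ->
  (forall x, r < `|x - x0| -> f x = 0) ->
  exists2 L, 0 < L & forall x h, `|f (x + h) - f x| <= L * `|h|.
Proof.
move=> sf f0.
have /choice[B HB] : forall j : 'I_n, exists B : R, 0 < B /\ forall x, `|'D_(e j) f x| <= B.
  move=> j; have [B B0 HB] := bounded_csupp (smooth_derive j sf) (derive_csupp j f0).
  by exists B.
have B0 : 0 <= \sum_j B j by apply: sumr_ge0 => j _; rewrite ltW// (HB j).1.
exists (\sum_j B j + 1) => [|x h]; first by rewrite ltr_wpDl.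
have [y _ i|xi [_ ->]] := @mean_value_box R n f x h; first exact: smooth_derivable sf I.
rewrite mulrDl mul1r; apply: (@le_trans _ _ ((\sum_j B j) * `|h|)); last by rewrite lerDl.
rewrite mulr_suml; apply: le_trans (ler_norm_sum _ _ _) _.
apply: ler_sum => j _; rewrite normrM mulrC ler_pM//; first exact: (HB j).2.
exact: rV_norm_coord.
Qed.

Lemma norm_delta_mx_le (j : 'I_n) (t : R) : `|t *: e j| <= `|t|.
Proof.
apply/mx_norm_le => // a b; rewrite !mxE normrM -[leRHS]mulr1 ler_wpM2l//.
by case: (_ && _); rewrite ?normr1 ?normr0.
Qed.

(** [L] is a Lipschitz constant of the partial derivative. The bound measures the error of replacing
    a derivative by a difference quotient over one mesh. *)
Lemma difference_quotient f (x0 : 'rV[R]_n) (r : R) j : smooth setT f ->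
  (forall x, r < `|x - x0| -> f x = 0) ->
  exists2 L, 0 < L &
    forall x t, `|f (x + t *: e j) - f x - t * 'D_(e j) f x| <= L * t ^+ 2.
Proof.
move=> sf f0.
have [L L0 HL] := lipschitz_csupp (smooth_derive j sf) (derive_csupp j f0).
exists L => // x t.
have [s _|s /andP[s0 s1] ->] := @mean_value_coord R n f x j t; first exact: smooth_derivable sf I.
rewrite -mulrBr normrM; apply: (@le_trans _ _ (`|t| * (L * `|t|))); last first.
  by rewrite mulrCA -expr2 real_normK ?num_real.
rewrite ler_wpM2l//; apply: le_trans (HL _ _) _; rewrite ler_pM2l//.
apply: le_trans (norm_delta_mx_le _ _) _.
by rewrite normrM (ger0_norm s0) ler_piMl.
Qed.

End smooth_calculus.

(** * Integrals and grid averages of compactly supported functions *)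

Section translation_invariance.
Variable R : realType.

Lemma continuous_measurable_borel (T U : ptopologicalType) (f : T -> U) :
  continuous f -> measurable_fun setT (f : borel T -> borel U).
Proof.
move=> /continuousP cf.
have H : @measurable _ (borel U) = <<s @open U >> by [].
apply: (measurability _ H) => _ [A oA <-]; rewrite setTI.
by apply: sub_sigma_algebra; exact: cf.
Qed.

Lemma measurable_shift_rV n (z : 'rV[R]_n) :
  measurable_fun setT (fun x : borel 'rV[R]_n => (x + z : borel 'rV[R]_n)).
Proof.
apply: (@continuous_measurable_borel 'rV[R]_n 'rV[R]_n (fun x => x + z)) => x.
by apply: continuousD; [exact: cvg_id|exact: cst_continuous].
Qed.

Lemma measurable_shift_R (z : R) :
  measurable_fun setT (fun x : measurableTypeR R => (x + z : measurableTypeR R)).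
Proof. exact: measurable_funD. Qed.

Lemma lebesgue_measure_shift (z : R) (A : set (measurableTypeR R)) : measurable A ->
  @lebesgue_measure R ((fun x => x + z) @^-1` A) = @lebesgue_measure R A.
Proof.
move=> mA; apply: esym.
apply: (@lebesgue_measure_unique R
  (measure_function_pushforward__canonical__measure_function_Measure
     (@lebesgue_measure R) (measurable_shift_R z))) => // X /=.
move=> [] [a b] _ <- /=.
rewrite /pushforward.
have -> : (fun x => x + z) @^-1` `]a, b] = `]a - z, b - z]%classic.
  by apply/seteqP; split=> x /=; rewrite !in_itv /= ltrBlDr lerBrDr.
rewrite !lebesgue_measure_itv/= !lte_fin ltrD2r; case: ifP => // _.
by rewrite -!EFinB; congr (_%:E); lra.
Qed.

(** Induction on the dimension: through [cons_rV] a translation becomes the product of a translation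
    of the line and one of the lower-dimensional space, and the product measure is determined by its
    values on rectangles. *)
Lemma lebesgue_rV_shift n (z : 'rV[R]_n) (A : set (borel 'rV[R]_n)) : measurable A ->
  lebesgue_rV R n ((fun x => x + z) @^-1` A) = lebesgue_rV R n A.
Proof.
elim: n z A => [|n IH] z A mA.
  congr (lebesgue_rV R 0 _); apply/seteqP; split=> x /=.
    by rewrite (_ : x + z = x)//; apply/rowP => -[].
  by rewrite (_ : x + z = x)//; apply/rowP => -[].
pose sh (t : measurableTypeR R * borel 'rV[R]_n) : measurableTypeR R * borel 'rV[R]_n :=
  (t.1 + (uncons_rV z).1, t.2 + (uncons_rV z).2).
have msh : measurable_fun setT sh.
  apply: measurable_fun_pair.
    exact: (measurableT_comp (measurable_shift_R _) measurable_fst).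
  exact: (measurableT_comp (measurable_shift_rV _) measurable_snd).
rewrite /= /leb_step /pushforward.
have mB : measurable (@cons_rV R n @^-1` A : set (measurableTypeR R * borel 'rV[R]_n)).
  by rewrite -[X in measurable X]setTI; exact: measurable_cons_rV.
rewrite [RHS](@product_measure_unique _ _ _ _ R (@lebesgue_measure R) (lebesgue_rV R n)
  (measure_function_pushforward__canonical__measure_function_Measure
     (@lebesgue_measure R \x lebesgue_rV R n)%E msh))//=.
  rewrite /pushforward; congr ((_ \x _)%E _).
  apply/seteqP; split=> t /=; rewrite (_ : cons_rV t + z = cons_rV (sh t))//.
    apply/rowP => j; rewrite !mxE; case: unliftP => [i|] -> /=; last by [].
    by rewrite !mxE.
  apply/rowP => j; rewrite !mxE; case: unliftP => [i|] -> /=; last by [].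
  by rewrite !mxE.
move=> B C mBB mC; rewrite /pushforward.
have -> : sh @^-1` (B `*` C) =
   ((fun x => x + (uncons_rV z).1) @^-1` B) `*` ((fun x => x + (uncons_rV z).2) @^-1` C).
  by [].
rewrite product_measure1E.
- by congr (_ * _)%E; [exact: lebesgue_measure_shift|exact: IH].
- by rewrite -[X in measurable X]setTI; exact: measurable_shift_R.
- by rewrite -[X in measurable X]setTI; exact: measurable_shift_rV.
Qed.

End translation_invariance.

Section Riesz_functional.
Context {R : realType} {n : nat}.
Local Notation T := 'rV[R]_n.
Local Notation leb := (@lebesgue_rV R n).
Implicit Types (f g : T -> R).

Definition bounded_support f : Prop := exists r, forall x, r < `|x| -> f x = 0.

(** The class on which [Int] is used: it is stable under sums, products and translations, so
    integrability follows from membership alone. *)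
Definition ccont f : Prop := continuous f /\ bounded_support f.

Definition Int f : R := Rintegral leb setT (f : borel T -> R).

Lemma lebesgue_rV_ball_lty (r : R) : (leb [set x : T | (`|x| <= r)%R] < +oo)%E.
Proof.
have [r0|r0] := ltP r 0.
  rewrite (_ : [set x | _] = set0) ?measure0//.
  by apply/seteqP; split=> // x /= xr; have := le_lt_trans xr r0; rewrite ltNge normr_ge0.
rewrite (_ : [set x | _] = [set v : T | forall i, `[-r, r]%classic (v ord0 i)]); last first.
  apply/seteqP; split=> x /=.
    by move=> /(mx_norm_le x r0).1 H i; rewrite in_itv /= -ler_norml; exact: H.
  move=> H; apply/mx_norm_le => // a b; rewrite (ord1 a) ler_norml.
  by have := H b; rewrite in_itv.
have -> := @lebesgue_rV_box R n (fun=> `[-r, r]%classic) (fun=> measurable_itv _).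
suff /andP[_ //] : (0 <= \prod_(i < n) @lebesgue_measure R `[(- r)%R, r]%classic < +oo)%E.
elim/big_ind: _ => [|x y /andP[x0 xoo] /andP[y0 yoo]|i _].
- by rewrite lee_fin ler01 ltry.
- by rewrite mule_ge0//= lte_mul_pinfty// ge0_fin_numE.
rewrite measure_ge0/= lebesgue_measure_itv/=; case: ifP => _; last exact: ltry.
by rewrite -EFinB ltry.
Qed.

Lemma measurable_norm_le (r : R) : measurable ([set x : T | `|x| <= r] : set (borel T)).
Proof.
rewrite -[X in measurable X]setCK; apply: measurableC; apply: sub_sigma_algebra.
apply: closed_openC; have := @norm_le_closed R n 0 r.
by congr closed; apply/seteqP; split=> x /=; rewrite subr0.
Qed.

Lemma ccont_bounded f : ccont f -> exists2 B, 0 < B & forall x, `|f x| <= B.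
Proof.
move=> [cf [r f0]]; have [x _|B B0 HB] := bounded_on_compact (@norm_le_compact R n 0 r) (f := f).
  exact: cf.
exists B => // x; have [h|/f0->] := leP `|x| r; last by rewrite normr0 ltW.
by apply: HB; rewrite /= subr0.
Qed.

Lemma ccont_measurable f : continuous f -> measurable_fun setT (f : borel T -> R).
Proof. exact: continuous_borel_measurable. Qed.

Lemma ccont_integrable f : ccont f -> leb.-integrable setT (EFin \o (f : borel T -> R)).
Proof.
move=> cf; have [B B0 HB] := ccont_bounded cf; have [cf1 [r f0]] := cf.
apply: (@le_integrable _ _ _ leb setT _ _
  (fun x => (B%:E * (\1_([set x : T | (`|x| <= r)%R] : set (borel T)) x)%:E)%E)) => //.
- by apply/measurable_EFinP; exact: ccont_measurable.
- move=> x _ /=; rewrite lee_fin indicE; have [h|h] := leP `|x| r.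
    by rewrite mem_set// mulr1 (gtr0_norm B0).
  by rewrite f0// normr0.
apply: integrableZl => //; apply/integrableP; split.
  by apply/measurable_EFinP; apply: measurable_indic; exact: measurable_norm_le.
under eq_integral do rewrite gee0_abs ?lee_fin//.
rewrite integral_indic//; last exact: measurable_norm_le.
by rewrite setIT; exact: lebesgue_rV_ball_lty.
Qed.

Lemma ccontD f g : ccont f -> ccont g -> ccont (fun x => f x + g x).
Proof.
move=> [cf [r f0]] [cg [s g0]]; split.
  by move=> x; apply: continuousD; [exact: cf|exact: cg].
exists (Num.max r s) => x; rewrite gt_max => /andP[rx sx].
by rewrite f0// g0// addr0.
Qed.

Lemma ccontM f g : continuous f -> ccont g -> ccont (fun x => f x * g x).
Proof.
move=> cf [cg [s g0]]; split.
  by move=> x; apply: continuousM; [exact: cf|exact: cg].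
by exists s => x sx; rewrite g0// mulr0.
Qed.

Lemma ccontZ c f : ccont f -> ccont (fun x => c * f x).
Proof. by apply: ccontM => x; exact: cst_continuous. Qed.

Lemma ccont0 : ccont (fun=> 0).
Proof. by split=> [x|]; [exact: cst_continuous|exists 0]. Qed.

Lemma ccont_sum (I : Type) (r : seq I) (P : pred I) (F : I -> T -> R) :
  (forall i, ccont (F i)) -> ccont (fun x => \sum_(i <- r | P i) F i x).
Proof.
move=> cF; elim: r => [|i r IH].
  by under eq_fun do rewrite big_nil; exact: ccont0.
under eq_fun do rewrite big_cons.
by case: (P i) => //; exact: ccontD.
Qed.

Lemma ccont_shift f (z : T) : ccont f -> ccont (fun x => f (x + z)).
Proof.
move=> [cf [r f0]]; split.
  move=> x; apply: continuous_comp; last exact: cf.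
  by apply: continuousD; [exact: cvg_id|exact: cst_continuous].
exists (r + `|z|) => x rx; apply: f0.
rewrite -(ltrD2r `|z|); apply: lt_le_trans rx _.
by rewrite -[x in leLHS](addrK z); apply: le_trans (ler_normB _ _) _.
Qed.

Lemma Int_ge0 f : (forall x, 0 <= f x) -> 0 <= Int f.
Proof. by move=> f0; apply: Rintegral_ge0. Qed.

Lemma Int_le f g : ccont f -> ccont g -> (forall x, f x <= g x) -> Int f <= Int g.
Proof. by move=> cf cg fg; apply: le_Rintegral => //; exact: ccont_integrable. Qed.

Lemma IntD f g : ccont f -> ccont g -> Int (fun x => f x + g x) = Int f + Int g.
Proof. by move=> cf cg; apply: RintegralD => //; exact: ccont_integrable. Qed.

Lemma IntZ c f : ccont f -> Int (fun x => c * f x) = c * Int f.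
Proof. by move=> cf; apply: RintegralZl => //; exact: ccont_integrable. Qed.

Lemma Int0 : Int (fun=> 0) = 0.
Proof.
have := IntZ 0 ccont0; rewrite [RHS]mul0r => {2}<-.
by congr Int; apply/funext => x; rewrite mul0r.
Qed.

Lemma Int_sum (I : Type) (r : seq I) (P : pred I) (F : I -> T -> R) :
  (forall i, ccont (F i)) ->
  Int (fun x => \sum_(i <- r | P i) F i x) = \sum_(i <- r | P i) Int (F i).
Proof.
move=> cF; elim: r => [|i r IH].
  by rewrite big_nil; under eq_fun do rewrite big_nil; exact: Int0.
rewrite big_cons -IH; case: ifP => Pi.
  by rewrite -IntD//; [congr Int; apply/funext => x; rewrite big_cons Pi|exact: ccont_sum].
by congr Int; apply/funext => x; rewrite big_cons Pi.
Qed.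

Lemma Int_shift f (z : T) : ccont f -> Int (fun x => f (x + z)) = Int f.
Proof.
move=> cf; rewrite /Int /Rintegral; congr fine.
rewrite [RHS](@eq_measure_integral _ _ _ _
  (measure_function_pushforward__canonical__measure_function_Measure leb (measurable_shift_rV z))).
  rewrite integral_pushforward//.
  - exact: measurable_shift_rV.
  - by apply/measurable_EFinP; apply: ccont_measurable; exact: cf.1.
  - by have := ccont_integrable (ccont_shift z cf).
by move=> A mA _; rewrite /= /pushforward lebesgue_rV_shift.
Qed.

End Riesz_functional.

Section finite_sums.
Context {R : realType}.

(** Cauchy-Schwarz in variance form: the squared deviations from the mean [s / c] have a nonnegative
    sum. *)
Lemma sqr_sum_le (I : finType) (P : pred I) (f : I -> R) :
  (\sum_(i | P i) f i) ^+ 2 <= #|P|%:R * \sum_(i | P i) f i ^+ 2.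
Proof.
set c := #|P|%:R; have [c0|c0] := eqVneq #|P| 0%N.
  rewrite big_pred0 ?expr0n//= ?mulr_ge0 ?sumr_ge0// => [i _|i].
    by rewrite sqr_ge0.
  by have := card0_eq c0 i.
have cp : 0 < c by rewrite ltr0n lt0n.
set s := \sum_(i | P i) f i.
have : 0 <= \sum_(i | P i) (f i - s / c) ^+ 2 by apply: sumr_ge0 => i _; exact: sqr_ge0.
under eq_bigr do rewrite sqrrB.
rewrite big_split/= sumrB.
have -> : \sum_(i | P i) f i * (s / c) *+ 2 = 2 * (s ^+ 2 / c).
  by rewrite sumrMnl -mulr_suml -/s mulr_natl; congr (_ *+ _); rewrite expr2 mulrA.
have -> : \sum_(i | P i) (s / c) ^+ 2 = s ^+ 2 / c.
  rewrite sumr_const -mulr_natl -/c; field; exact: lt0r_neq0.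
move=> H; rewrite -ler_pdivrMl// mulrC; lra.
Qed.

Lemma sqrD_le (a b : R) : (a + b) ^+ 2 <= 2 * a ^+ 2 + 2 * b ^+ 2.
Proof. by have := sqr_ge0 (a - b); nra. Qed.

Lemma sqrD3_le (a b c : R) : (a + b + c) ^+ 2 <= 3 * a ^+ 2 + 3 * b ^+ 2 + 3 * c ^+ 2.
Proof. by have := sqr_ge0 (a - b); have := sqr_ge0 (a - c); have := sqr_ge0 (b - c); nra. Qed.

Lemma norm_le_sqr (a M : R) : `|a| <= M -> a ^+ 2 <= M ^+ 2.
Proof.
move=> aM; rewrite -(real_normK (num_real a)) lerXn2r// nnegrE//.
exact: le_trans aM.
Qed.

End finite_sums.

Section derive_shift.
Context {R : realType} {n : nat}.
Implicit Types (f : 'rV[R]_n -> R).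

Lemma shift_quotient f (x v z : 'rV[R]_n) :
  (fun h : R => h^-1 *: (f (h *: v + x + z) - f (x + z))) =
  (fun h : R => h^-1 *: (f (h *: v + (x + z)) - f (x + z))).
Proof. by apply/funext => h; rewrite addrA. Qed.

Lemma derive_shiftE f x v z : 'D_v (fun y => f (y + z)) x = 'D_v f (x + z).
Proof. by rewrite /derive /= shift_quotient. Qed.

Lemma derivable_shift f x v z : derivable f (x + z) v -> derivable (fun y => f (y + z)) x v.
Proof. by rewrite /derivable /= shift_quotient. Qed.

Lemma smooth_shift f z : smooth setT f -> smooth setT (fun x => f (x + z)).
Proof.
move=> sf k; apply: (@Ck_comp R n n k setT setT f (fun x => x + z)) => //; try exact: openT.
move=> i; apply: (@Ck_ext _ _ _ _ (fun x : 'rV[R]_n => x ord0 i + z ord0 i)); first exact: openT.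
  by move=> x _; rewrite mxE.
by apply: CkD; [exact: openT|apply: Ck_coord; exact: openT|exact: Ck_cst].
Qed.

Lemma is_derive_bigsum (I : Type) (r : seq I) (P : pred I) (F : I -> 'rV[R]_n -> R) x v
    (dF : I -> R) : (forall i, P i -> is_derive x v (F i) (dF i)) ->
  is_derive x v (fun x => \sum_(i <- r | P i) F i x) (\sum_(i <- r | P i) dF i).
Proof.
move=> H; elim: r => [|i r IH].
  by under eq_fun do rewrite big_nil; rewrite big_nil; exact: is_derive_cst.
under eq_fun do rewrite big_cons; rewrite big_cons.
by case: ifP => // Pi; apply: is_deriveD => //; exact: H.
Qed.

End derive_shift.

(** * Averages over a grid and discrete integration by parts *)

Section grid_average.
Context {R : realType} {n : nat}.
Implicit Types (f g : 'rV[R]_n -> R).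
Local Notation e j := (delta_mx ord0 j : 'rV[R]_n).
Local Notation grid N := {ffun 'I_n -> 'I_N.+1}.

Definition mesh (eps : R) (N : nat) : R := eps / N.+1%:R.

Definition grid_vec (eps : R) N (a : grid N) : 'rV[R]_n := \row_i (mesh eps N * (a i)%:R).

Definition grid_size (N : nat) : R := N.+1%:R ^+ n.

(** A Riemann sum for the mean over the cube of side [eps] with corner [x]. The sign of [eps] is
    free, because the adjoint of the average at [eps] is the one at [- eps]. *)
Definition avg (eps : R) (N : nat) f (x : 'rV[R]_n) : R :=
  (grid_size N)^-1 * \sum_(a : grid N) f (x + grid_vec eps a).

Lemma card_grid N : #|[pred a : grid N | true]|%:R = grid_size N.
Proof. by rewrite /grid_size -natrX; congr _%:R; rewrite -[RHS]card_ord; apply/eqP; rewrite card_ffun !card_ord. Qed.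

Lemma grid_size_gt0 N : 0 < grid_size N.
Proof. by rewrite exprn_gt0// ltr0n. Qed.

Lemma mesh_norm eps N : `|mesh eps N| * N.+1%:R = `|eps|.
Proof. by rewrite /mesh normrM normfV normr_nat divfK// pnatr_eq0. Qed.

Lemma mesh_le eps N (t : R) : 0 <= t <= N.+1%:R -> `|mesh eps N * t| <= `|eps|.
Proof. by case/andP=> t0 t1; rewrite normrM (ger0_norm t0) -(mesh_norm eps N) ler_wpM2l. Qed.

Lemma grid_vec_le eps N (a : grid N) : `|grid_vec eps a| <= `|eps|.
Proof.
apply/mx_norm_le => // i j; rewrite !mxE; apply: mesh_le.
by rewrite ler0n ler_nat ltnW.
Qed.

(** One further step stays within [|eps|] because indices stop at [N] while the mesh is
    [eps / (N + 1)]. *)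
Lemma grid_vec_succ_le eps N (a : grid N) j :
  `|grid_vec eps a + mesh eps N *: e j| <= `|eps|.
Proof.
apply/mx_norm_le => // i l; rewrite !mxE -mulrDr; apply: mesh_le.
rewrite addr_ge0//= -natrD ler_nat; case: (_ && _); rewrite ?addn1 ?addn0//.
by rewrite ltnW.
Qed.

Lemma avg_ext eps N f g : f =1 g -> avg eps N f =1 avg eps N g.
Proof. by move=> fg x; congr (_ * _); apply: eq_bigr => a _; rewrite fg. Qed.

Lemma avgD eps N f g x : avg eps N (fun x => f x + g x) x = avg eps N f x + avg eps N g x.
Proof. by rewrite /avg big_split/= mulrDr. Qed.

Lemma avgZ eps N c f x : avg eps N (fun x => c * f x) x = c * avg eps N f x.
Proof. by rewrite /avg -mulr_sumr mulrCA. Qed.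

Lemma avgB eps N f g x : avg eps N (fun x => f x - g x) x = avg eps N f x - avg eps N g x.
Proof. by rewrite /avg sumrB mulrBr. Qed.

Lemma avg_sum eps N (I : Type) (r : seq I) (P : pred I) (F : I -> 'rV[R]_n -> R) x :
  avg eps N (fun x => \sum_(i <- r | P i) F i x) x = \sum_(i <- r | P i) avg eps N (F i) x.
Proof. by rewrite /avg exchange_big mulr_sumr. Qed.

Lemma avg_cst eps N c x : avg eps N (fun=> c) x = c.
Proof.
rewrite /avg sumr_const (_ : #|_| = #|[pred a : grid N | true]|)//.
by rewrite -mulr_natr card_grid mulrC mulfK// gt_eqF ?grid_size_gt0.
Qed.

Lemma avg_norm_le eps N f x M : (forall a : grid N, `|f (x + grid_vec eps a)| <= M) ->
  `|avg eps N f x| <= M.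
Proof.
move=> fM; rewrite /avg normrM normfV (gtr0_norm (grid_size_gt0 N)) ler_pdivrMl ?grid_size_gt0//.
apply: le_trans (ler_norm_sum _ _ _) _.
apply: (@le_trans _ _ (\sum_(a : grid N) M)); first exact: ler_sum.
by rewrite sumr_const (_ : #|_| = #|[pred a : grid N | true]|)// -mulr_natl card_grid.
Qed.

Lemma avg_supp eps N f (x0 : 'rV[R]_n) r : (forall x, r < `|x - x0| -> f x = 0) ->
  forall x, r + `|eps| < `|x - x0| -> avg eps N f x = 0.
Proof.
move=> f0 x rx; rewrite /avg big1 ?mulr0// => a _; apply: f0.
rewrite -(ltrD2r `|eps|); apply: lt_le_trans rx _.
have -> : x - x0 = (x + grid_vec eps a - x0) - grid_vec eps a.
  by rewrite addrAC addrK.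
by apply: le_trans (ler_normB _ _) _; rewrite lerD2l grid_vec_le.
Qed.

Lemma avg_near eps N f L x : (forall x h, `|f (x + h) - f x| <= L * `|h|) -> 0 <= L ->
  `|avg eps N f x - f x| <= L * `|eps|.
Proof.
move=> fL L0; rewrite -(avg_cst eps N (f x) x) -avgB.
apply: avg_norm_le => a; apply: le_trans (fL _ _) _.
by rewrite ler_wpM2l ?grid_vec_le.
Qed.

(** Jensen's inequality for uniform weights; with [Int_avg] it makes averaging a contraction of
    L^2. *)
Lemma avg_sqr_le eps N f x : (avg eps N f x) ^+ 2 <= avg eps N (fun y => f y ^+ 2) x.
Proof.
rewrite /avg exprMn; have := sqr_sum_le (fun _ => true) (fun a : grid N => f (x + grid_vec eps a)).
rewrite card_grid => H; have P0 := grid_size_gt0 N.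
rewrite expr2 -mulrA ler_pM2l ?invr_gt0// ler_pdivrMl//.
Qed.

Lemma avg_smooth eps N f : smooth setT f -> smooth setT (avg eps N f).
Proof.
move=> sf; apply: smoothM; [exact: openT|exact: smooth_cst|].
by apply: smooth_sum => [|a]; [exact: openT|exact: smooth_shift].
Qed.

Lemma avg_derive eps N f j x : smooth setT f ->
  'D_(e j) (avg eps N f) x = avg eps N ('D_(e j) f) x.
Proof.
move=> sf.
have H : is_derive x (e j) (fun x => \sum_(a : grid N) f (x + grid_vec eps a))
    (\sum_(a : grid N) 'D_(e j) f (x + grid_vec eps a)).
  apply: is_derive_bigsum => a _; apply: DeriveDef; last exact: derive_shiftE.
  by apply: derivable_shift; exact: smooth_derivable sf I.
rewrite /avg; have := is_deriveZ (grid_size N)^-1 H.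
by move=> [_]; exact.
Qed.

Lemma avg_ccont eps N f : ccont f -> ccont (avg eps N f).
Proof. by move=> cf; apply: ccontZ; apply: ccont_sum => a; exact: ccont_shift. Qed.

Lemma Int_avg eps N f : ccont f -> Int (avg eps N f) = Int f.
Proof.
move=> cf; rewrite /avg IntZ; last by apply: ccont_sum => a; exact: ccont_shift.
rewrite Int_sum; last by move=> a; exact: ccont_shift.
under eq_bigr do rewrite Int_shift//.
rewrite sumr_const (_ : #|_| = #|[pred a : grid N | true]|)//.
by rewrite -mulr_natl card_grid mulrA mulVf ?mul1r// gt_eqF ?grid_size_gt0.
Qed.

Lemma ccont_sqr f : ccont f -> ccont (fun x => f x ^+ 2).
Proof. by move=> cf; have := ccontM cf.1 cf; under eq_fun do rewrite -expr2. Qed.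

Lemma Int_avg_sqr eps N f : ccont f ->
  Int (fun x => (avg eps N f x) ^+ 2) <= Int (fun x => f x ^+ 2).
Proof.
move=> cf; rewrite -(Int_avg eps N (ccont_sqr cf)); apply: Int_le.
- by apply: ccont_sqr; exact: avg_ccont.
- by apply: avg_ccont; exact: ccont_sqr.
- by move=> x; exact: avg_sqr_le.
Qed.

(** Translating the integration variable by the opposite grid vector moves each term of the average
    onto the other factor. *)
Lemma Int_avg_adj eps N f g : ccont f -> ccont g ->
  Int (fun x => avg eps N f x * g x) = Int (fun x => f x * avg (- eps) N g x).
Proof.
move=> cf cg; rewrite /avg.
have cc (a : grid N) : ccont (fun x => f (x + grid_vec eps a) * g x).
  by apply: ccontM => //; case: (ccont_shift (grid_vec eps a) cf).
have cc' (a : grid N) : ccont (fun x => f x * g (x + grid_vec (- eps) a)).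
  by apply: ccontM; [exact: cf.1|exact: ccont_shift].
transitivity ((grid_size N)^-1 * \sum_(a : grid N) Int (fun x => f (x + grid_vec eps a) * g x)).
  rewrite -Int_sum// -IntZ; last exact: ccont_sum.
  by congr Int; apply/funext => x; rewrite -mulrA mulr_suml.
transitivity ((grid_size N)^-1 * \sum_(a : grid N) Int (fun x => f x * g (x + grid_vec (- eps) a))); last first.
  rewrite -Int_sum// -IntZ; last exact: ccont_sum.
  by congr Int; apply/funext => x; rewrite [RHS]mulrCA -mulr_sumr.
congr (_ * _); apply: eq_bigr => a _.
rewrite -(Int_shift (grid_vec (- eps) a) (cc a)).
have E : grid_vec (- eps) a + grid_vec eps a = 0.
  by apply/rowP => i; rewrite !mxE /mesh mulNr mulNr addNr.
by congr Int; apply/funext => x; rewrite -addrA E addr0.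
Qed.

(** A bijection of the grid that is translation by one mesh, except on the last face, where it wraps
    around to the first. Reindexing by it makes a grid sum of forward differences collapse to the
    last face. *)
Definition cyc (N : nat) (j : 'I_n) (a : grid N) : grid N :=
  [ffun i => if i == j then ordS (a i) else a i].

Lemma cyc_bij N j : bijective (@cyc N j).
Proof.
exists (fun a : grid N => [ffun i => if i == j then ord_pred (a i) else a i]) => a;
  by apply/ffunP => i; rewrite !ffunE; case: eqP => // _; rewrite ?ordSK ?ord_predK.
Qed.

Lemma grid_vec_cyc eps N j (a : grid N) : a j != ord_max ->
  grid_vec eps (cyc j a) = grid_vec eps a + mesh eps N *: e j.
Proof.
move=> aj; apply/rowP => i; rewrite !mxE !ffunE eqxx /=.
have [->|_] := eqVneq i j; last by rewrite mulr0 addr0.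
rewrite -mulrDr; congr (_ * _); rewrite /= modn_small ?natr1//.
by rewrite ltnS ltn_neqAle -ltnS ltn_ord andbT; apply: contra aj => /eqP h; apply/eqP/val_inj.
Qed.

(** The face is counted as a product over the coordinates of sums of indicators: coordinate [j]
    contributes 1, every other one [N + 1]. *)
Lemma face_card N (j : 'I_n) :
  N.+1%:R * #|[pred a : grid N | a j == ord_max]|%:R = grid_size N.
Proof.
have -> : #|[pred a : grid N | a j == ord_max]|%:R =
    \sum_(a : grid N) \prod_i (if i == j then (a i == ord_max)%:R else 1 : R).
  rewrite -sum1_card natr_sum big_mkcond /=; apply: eq_bigr => a _.
  rewrite (bigD1 j)//= eqxx big1 ?mulr1; last by move=> i /negbTE ->.
  by rewrite inE; case: eqP.
rewrite -(bigA_distr_bigA (fun i c => if i == j then (c == ord_max)%:R else 1 : R)) /=.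
rewrite (bigD1 j)//= eqxx (bigD1 ord_max)//= eqxx big1 ?addr0 ?mul1r; last first.
  by move=> c /negbTE ->.
rewrite (eq_bigr (fun=> N.+1%:R)); last first.
  by move=> i /negbTE ->; rewrite sumr_const card_ord.
rewrite /grid_size -[X in _ = _ ^+ X](card_ord n) -prodr_const [RHS](bigD1 j)//=.
Qed.

(* Discrete integration by parts: after replacing the derivative by a difference
   quotient, the sum over each grid line telescopes, leaving only the two end
   faces and the increments of [c]. *)
Lemma telescoping_bound eps N f (c : 'rV[R]_n -> R) j x (L M Lc : R) :
  eps != 0 -> 0 <= L -> 0 <= M -> 0 <= Lc ->
  (forall x t, `|f (x + t *: e j) - f x - t * 'D_(e j) f x| <= L * t ^+ 2) ->
  (forall h, `|h| <= `|eps| -> `|c (x + h)| <= M) ->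
  (forall y, `|c (y + mesh eps N *: e j) - c y| <= Lc * `|mesh eps N|) ->
  (avg eps N (fun y => c y * 'D_(e j) f y) x) ^+ 2 <=
    3 * (M * L * `|mesh eps N|) ^+ 2 +
    3 * ((2 * M ^+ 2) * (grid_size N)^-2 * mesh eps N ^-2 *
      #|[pred a : grid N | a j == ord_max]|%:R *
      \sum_(a : grid N | a j == ord_max)
        (f (x + (grid_vec eps a + mesh eps N *: e j)) ^+ 2 + f (x + grid_vec eps (cyc j a)) ^+ 2)) +
    3 * (Lc ^+ 2 * avg eps N (fun y => f (y + mesh eps N *: e j) ^+ 2) x).
Proof.
move=> eps0 L0 M0 Lc0 dqf cM cL.
set d := mesh eps N; set P := grid_size N.
have P0 : 0 < P by exact: grid_size_gt0.
have dn0 : d != 0 by rewrite mulf_neq0// invr_eq0 pnatr_eq0.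
set z := fun a : grid N => x + grid_vec eps a.
pose v := d *: e j.
pose F y := c y * f y.
(* Discrete product rule: [T1] is the error of the difference quotient, [T2] the difference quotient
   of the product [F = c * f], written as it is after telescoping, and [T3] the part where the
   difference falls on [c]. *)
pose T1 := avg eps N (fun y => c y * ('D_(e j) f y - d^-1 * (f (y + v) - f y))) x.
pose T2 := P^-1 * d^-1 * \sum_(a : grid N | a j == ord_max) (F (z a + v) - F (z (cyc j a))).
pose T3 := avg eps N (fun y => - (d^-1 * (c (y + v) - c y)) * f (y + v)) x.
have tele : \sum_(a : grid N) (F (z a + v) - F (z a)) =
    \sum_(a : grid N | a j == ord_max) (F (z a + v) - F (z (cyc j a))).
  have E : \sum_(a : grid N) F (z a) = \sum_(a : grid N) F (z (cyc j a)).
    by rewrite (reindex (@cyc N j))//; exact/onW_bij/cyc_bij.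
  rewrite sumrB E -sumrB.
  rewrite (bigID (fun a : grid N => a j == ord_max))/= [X in _ + X]big1 ?addr0// => a aj.
  by rewrite /z grid_vec_cyc// addrA subrr.
have -> : avg eps N (fun y => c y * 'D_(e j) f y) x = T1 + T2 + T3.
  have -> : T2 = avg eps N (fun y => d^-1 * (F (y + v) - F y)) x.
    by rewrite /T2 -tele /avg -mulr_sumr mulrA.
  rewrite -!avgD; apply: avg_ext => y; rewrite /F; ring.
apply: le_trans (sqrD3_le _ _ _) _.
have b1 : T1 ^+ 2 <= (M * L * `|d|) ^+ 2.
  apply: norm_le_sqr; apply: avg_norm_le => a; rewrite normrM -mulrA.
  apply: ler_pM => //; first by apply: cM; exact: grid_vec_le.
  have -> : 'D_(e j) f (z a) - d^-1 * (f (z a + v) - f (z a)) =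
      - d^-1 * (f (z a + v) - f (z a) - d * 'D_(e j) f (z a)) by field.
  rewrite normrM normrN normfV ler_pdivrMl ?normr_gt0//.
  apply: le_trans (dqf _ _) _.
  by rewrite -(real_normK (num_real d)) expr2 mulrCA.
have b3 : T3 ^+ 2 <= Lc ^+ 2 * avg eps N (fun y => f (y + v) ^+ 2) x.
  apply: le_trans (avg_sqr_le _ _ _ _) _; rewrite -avgZ /avg ler_pM2l ?invr_gt0//.
  apply: ler_sum => a _; rewrite exprMn ler_wpM2r ?sqr_ge0//.
  apply: norm_le_sqr; rewrite normrN normrM normfV ler_pdivrMl ?normr_gt0// mulrC.
  exact: cL.
(* Cauchy-Schwarz is applied on the face only, so its cardinality appears here; this is what later
   compensates [d ^-2]. *)
have b2 : T2 ^+ 2 <= (2 * M ^+ 2) * P ^-2 * d ^-2 *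
      #|[pred a : grid N | a j == ord_max]|%:R *
      \sum_(a : grid N | a j == ord_max)
        (f (x + (grid_vec eps a + v)) ^+ 2 + f (x + grid_vec eps (cyc j a)) ^+ 2).
  rewrite /T2 exprMn exprMn !exprVn.
  have Q0 : 0 <= P ^-2 * d ^-2 by rewrite mulr_ge0// invr_ge0 sqr_ge0.
  apply: (@le_trans _ _ (P ^- 2 * d ^- 2 * (#|[pred a : grid N | a j == ord_max]|%:R *
     \sum_(a : grid N | a j == ord_max) (F (z a + v) - F (z (cyc j a))) ^+ 2))).
    by rewrite ler_wpM2l// sqr_sum_le.
  rewrite [leRHS](_ : _ = P ^- 2 * d ^- 2 * (#|[pred a : grid N | a j == ord_max]|%:R *
     (2 * M ^+ 2 * \sum_(a : grid N | a j == ord_max)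
        (f (x + (grid_vec eps a + v)) ^+ 2 + f (x + grid_vec eps (cyc j a)) ^+ 2)))); last by ring.
  rewrite ler_wpM2l// ler_wpM2l// mulr_sumr; apply: ler_sum => a _.
  have B (h : 'rV[R]_n) : `|h| <= `|eps| -> F (x + h) ^+ 2 <= M ^+ 2 * f (x + h) ^+ 2.
    by move=> /cM/norm_le_sqr h1; rewrite /F exprMn ler_wpM2r ?sqr_ge0.
  have := sqrD_le (F (z a + v)) (- F (z (cyc j a))); rewrite sqrrN.
  have := B _ (grid_vec_succ_le eps a j); have := B _ (grid_vec_le eps (cyc j a)).
  rewrite -/d -/v /z -[x + _ + v]addrA => h1 h2 h3; lra.
lra.
Qed.

(** Translation invariance turns every translate of [f ^ 2] into the same integral. The constant 12
    is [3 * 2 * 2]: three terms, the square of a difference, two end faces. The function [theta]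
    dominates the indicator of the support and makes the constant error term integrable. The kernel
    [K x y] may depend on the base point [x], so that derivatives and commutators are covered
    together. *)
Lemma Int_telescoping_bound eps N f (K : 'rV[R]_n -> 'rV[R]_n -> R) j (L M Lc : R) theta :
  eps != 0 -> 0 <= L -> 0 <= M -> 0 <= Lc ->
  ccont f -> ccont theta -> (forall x, 0 <= theta x) ->
  ccont (fun x => avg eps N (fun y => K x y * 'D_(e j) f y) x) ->
  (forall x, avg eps N (fun y => K x y * 'D_(e j) f y) x != 0 -> 1 <= theta x) ->
  (forall x t, `|f (x + t *: e j) - f x - t * 'D_(e j) f x| <= L * t ^+ 2) ->
  (forall x h, `|h| <= `|eps| -> `|K x (x + h)| <= M) ->
  (forall x y, `|K x (y + mesh eps N *: e j) - K x y| <= Lc * `|mesh eps N|) ->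
  Int (fun x => (avg eps N (fun y => K x y * 'D_(e j) f y) x) ^+ 2) <=
    3 * (M * L * `|mesh eps N|) ^+ 2 * Int theta +
    (12 * (M / eps) ^+ 2 + 3 * Lc ^+ 2) * Int (fun x => f x ^+ 2).
Proof.
move=> eps0 L0 M0 Lc0 cf cth th0 cK Kth dqf KM KL.
set d := mesh eps N; set P := grid_size N; set v := d *: e j.
pose S : R := #|[pred a : grid N | a j == ord_max]|%:R.
have cf2 := ccont_sqr cf.
pose G x := \sum_(a : grid N | a j == ord_max)
        (f (x + (grid_vec eps a + v)) ^+ 2 + f (x + grid_vec eps (cyc j a)) ^+ 2).
pose H x := avg eps N (fun y => f (y + v) ^+ 2) x.
have cG : ccont G.
  by apply: ccont_sum => a; apply: ccontD; apply: (ccont_shift _ cf2).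
have cH : ccont H by apply: avg_ccont; exact: (ccont_shift _ cf2).
set c2 := 3 * ((2 * M ^+ 2) * P ^- 2 * d ^- 2 * S).
apply: (@le_trans _ _ (Int (fun x => 3 * (M * L * `|d|) ^+ 2 * theta x + (c2 * G x + 3 * Lc ^+ 2 * H x)))).
  apply: Int_le.
  - exact: ccont_sqr.
  - by apply: ccontD; [exact: ccontZ|apply: ccontD; exact: ccontZ].
  - move=> x; have [->|/Kth tx] := eqVneq (avg eps N (fun y => K x y * 'D_(e j) f y) x) 0.
      rewrite expr0n /=; apply: addr_ge0; first by rewrite mulr_ge0// mulr_ge0// sqr_ge0.
      apply: addr_ge0; apply: mulr_ge0.
      + by rewrite /c2 !mulr_ge0 ?invr_ge0 ?sqr_ge0 ?ler0n.
      + by apply: sumr_ge0 => a _; rewrite addr_ge0 ?sqr_ge0.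
      + by rewrite mulr_ge0 ?sqr_ge0.
      + by rewrite mulr_ge0 ?invr_ge0 ?(ltW (grid_size_gt0 N))// sumr_ge0// => a _; rewrite sqr_ge0.
    apply: le_trans (telescoping_bound eps0 L0 M0 Lc0 dqf (KM x) (KL x)) _.
    rewrite -/d -/v -/P -/S -/(H x) -/(G x) -[leLHS]addrA; apply: lerD.
      by rewrite ler_peMr// mulr_ge0// sqr_ge0.
    by rewrite /c2 !mulrA.
rewrite IntD; [|exact: ccontZ|by apply: ccontD; exact: ccontZ].
rewrite (IntZ _ cth) (IntD (ccontZ c2 cG) (ccontZ _ cH)) (IntZ c2 cG) (IntZ _ cH) lerD2l.
have -> : Int H = Int (fun x => f x ^+ 2).
  by rewrite /H Int_avg ?(Int_shift v cf2)//; exact: (ccont_shift _ cf2).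
have -> : Int G = S * (2 * Int (fun x => f x ^+ 2)).
  rewrite /G Int_sum; last by move=> a; apply: ccontD; apply: (ccont_shift _ cf2).
  rewrite (eq_bigr (fun=> 2 * Int (fun x => f x ^+ 2))) => [|a _].
    by rewrite sumr_const -[LHS]mulr_natl.
  rewrite IntD; [|exact: (ccont_shift _ cf2)|exact: (ccont_shift _ cf2)].
  by rewrite !(Int_shift _ cf2) mulr_natl.
set If := Int (fun x => f x ^+ 2).
have -> : c2 * (S * (2 * If)) = c2 * S * 2 * If by ring.
rewrite [leRHS]mulrDl lerD2r ler_wpM2r//; first by apply: Int_ge0 => x; exact: sqr_ge0.
(* The face is the fraction [1 / (N + 1)] of the grid; its square turns the inverse squared mesh
   into [eps ^- 2], so the bound survives refinement of the grid. *)
have SP : S = P / N.+1%:R.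
  by rewrite /P -(face_card N j) mulrAC divff ?mul1r ?pnatr_eq0.
rewrite le_eqVlt; apply/orP; left; apply/eqP; rewrite /c2 SP /d /mesh.
have : N.+1%:R != 0 :> R by rewrite pnatr_eq0.
have : P != 0 by rewrite gt_eqF ?grid_size_gt0.
by move: (N.+1%:R) (P) => a b b0 a0; field; rewrite eps0 a0.
Qed.

(** The kernel 1 has no increments, so only the end faces contribute. At a fixed scale averaging
    thus gains one derivative, at the price [12 / eps ^ 2]. *)
Lemma Int_avg_derive eps N f j (L : R) theta : eps != 0 -> 0 <= L ->
  smooth setT f -> ccont f -> ccont theta -> (forall x, 0 <= theta x) ->
  ccont ('D_(e j) f) ->
  (forall x, avg eps N ('D_(e j) f) x != 0 -> 1 <= theta x) ->
  (forall x t, `|f (x + t *: e j) - f x - t * 'D_(e j) f x| <= L * t ^+ 2) ->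
  Int (fun x => (avg eps N ('D_(e j) f) x) ^+ 2) <=
    3 * (L * `|mesh eps N|) ^+ 2 * Int theta + 12 / eps ^+ 2 * Int (fun x => f x ^+ 2).
Proof.
move=> eps0 L0 sf cf cth th0 cdf Hth dqf.
have E x : avg eps N ('D_(e j) f) x = avg eps N (fun y => 1 * 'D_(e j) f y) x.
  by apply: avg_ext => y; rewrite mul1r.
have := @Int_telescoping_bound eps N f (fun _ _ => 1) j L 1 0 theta eps0 L0 ler01 (lexx _) cf cth th0.
have -> : (fun x => avg eps N (fun y => 1 * 'D_(e j) f y) x) = avg eps N ('D_(e j) f).
  by apply/funext => x; rewrite E.
move=> /(_ (avg_ccont eps N cdf)).
under [X in Int X]eq_fun do rewrite -E.
rewrite expr0n /= mulr0 addr0 [1 * L]mul1r [1 / eps]mul1r exprVn; apply => //.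
- by move=> x; rewrite -E; exact: Hth.
- by move=> x h _; rewrite normr1.
- by move=> x y; rewrite subrr normr0 mul0r.
Qed.

(* Friedrichs' lemma: the increments of [A] over the mesh box, of size [LA * eps],
   compensate the factor [1 / eps] produced by the integration by parts. *)
Lemma Int_avg_commutator eps N (A : 'rV[R]_n -> R) f j (L LA : R) theta :
  eps != 0 -> 0 <= L -> 0 <= LA -> continuous A ->
  smooth setT f -> ccont f -> ccont theta -> (forall x, 0 <= theta x) ->
  ccont ('D_(e j) f) ->
  (forall x, avg eps N ('D_(e j) f) x != 0 \/ avg eps N (fun y => A y * 'D_(e j) f y) x != 0 ->
     1 <= theta x) ->
  (forall x t, `|f (x + t *: e j) - f x - t * 'D_(e j) f x| <= L * t ^+ 2) ->
  (forall x h, `|A (x + h) - A x| <= LA * `|h|) ->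
  Int (fun x => (avg eps N (fun y => A y * 'D_(e j) f y) x - A x * avg eps N ('D_(e j) f) x) ^+ 2) <=
    3 * (LA * `|eps| * L * `|mesh eps N|) ^+ 2 * Int theta + 15 * LA ^+ 2 * Int (fun x => f x ^+ 2).
Proof.
move=> eps0 L0 LA0 cA sf cf cth th0 cdf Hth dqf lipA.
have E x : avg eps N (fun y => (A y - A x) * 'D_(e j) f y) x =
    avg eps N (fun y => A y * 'D_(e j) f y) x - A x * avg eps N ('D_(e j) f) x.
  by rewrite -avgZ -avgB; apply: avg_ext => y; rewrite mulrBl.
have cK : ccont (fun x => avg eps N (fun y => (A y - A x) * 'D_(e j) f y) x).
  have -> : (fun x => avg eps N (fun y => (A y - A x) * 'D_(e j) f y) x) =
      (fun x => avg eps N (fun y => A y * 'D_(e j) f y) x + (- A x) * avg eps N ('D_(e j) f) x).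
    by apply/funext => x; rewrite E mulNr.
  apply: ccontD; first by apply: avg_ccont; exact: ccontM.
  by apply: ccontM; [move=> x; apply: continuousN; exact: cA|exact: avg_ccont].
have LAe : 0 <= LA * `|eps| by rewrite mulr_ge0.
have := @Int_telescoping_bound eps N f (fun x y => A y - A x) j L (LA * `|eps|) LA theta
  eps0 L0 LAe LA0 cf cth th0 cK.
have -> : (fun x => avg eps N (fun y => (A y - A x) * 'D_(e j) f y) x ^+ 2) =
   (fun x => (avg eps N (fun y => A y * 'D_(e j) f y) x - A x * avg eps N ('D_(e j) f) x) ^+ 2).
  by apply/funext => x; rewrite E.
(* The end faces give 12, with increments of size [LA * |eps|], and the increments over one mesh
   give 3; the scale cancels. *)
have -> : 12 * (LA * `|eps| / eps) ^+ 2 + 3 * LA ^+ 2 = 15 * LA ^+ 2.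
  rewrite !exprMn exprVn (real_normK (num_real eps)) mulfK; last by rewrite sqrf_eq0.
  by rewrite -mulrDl -natrD.
apply => //.
- move=> x; rewrite E => h; apply: Hth; apply/orP; rewrite -negb_and; apply: contra h.
  by move=> /andP[/eqP-> /eqP->]; rewrite mulr0 subrr.
- by move=> x h he; apply: le_trans (lipA x h) _; rewrite ler_wpM2l.
- move=> x y; rewrite opprB addrA subrK; apply: le_trans (lipA _ _) _.
  by rewrite ler_wpM2l// norm_delta_mx_le.
Qed.

End grid_average.

(** * Smooth functions and sections in charts and frames *)

Section realification.
Context {R : realType}.

Lemma ReD (x y : R[i]) : complex.Re (x + y) = complex.Re x + complex.Re y.
Proof. by case: x y => a b [c d]. Qed.
Lemma ImD (x y : R[i]) : complex.Im (x + y) = complex.Im x + complex.Im y.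
Proof. by case: x y => a b [c d]. Qed.
Lemma ReM (x y : R[i]) :
  complex.Re (x * y) = complex.Re x * complex.Re y - complex.Im x * complex.Im y.
Proof. by case: x y => a b [c d]. Qed.
Lemma ImM (x y : R[i]) :
  complex.Im (x * y) = complex.Re x * complex.Im y + complex.Im x * complex.Re y.
Proof. by case: x y => a b [c d]. Qed.

Lemma Re_sum (I : Type) (r : seq I) (P : pred I) (F : I -> R[i]) :
  complex.Re (\sum_(i <- r | P i) F i) = \sum_(i <- r | P i) complex.Re (F i).
Proof. by elim/big_rec2: _ => //= i x y _ <-; rewrite ReD. Qed.
Lemma Im_sum (I : Type) (r : seq I) (P : pred I) (F : I -> R[i]) :
  complex.Im (\sum_(i <- r | P i) F i) = \sum_(i <- r | P i) complex.Im (F i).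
Proof. by elim/big_rec2: _ => //= i x y _ <-; rewrite ImD. Qed.

Lemma ReZ (r : R) (x : R[i]) : complex.Re (r%:C%C * x) = r * complex.Re x.
Proof. by rewrite ReM /= mul0r subr0. Qed.
Lemma ImZ (r : R) (x : R[i]) : complex.Im (r%:C%C * x) = r * complex.Im x.
Proof. by rewrite ImM /= mul0r addr0. Qed.

Definition realv k (v : 'cV[R[i]]_k) : 'cV[R]_(k + k) :=
  col_mx (map_mx (@complex.Re R) v) (map_mx (@complex.Im R) v).

Definition cplxv k (w : 'cV[R]_(k + k)) : 'cV[R[i]]_k :=
  \col_a (w (lshift k a) ord0 +i* w (rshift k a) ord0)%C.

Lemma realvK k : cancel (@realv k) (@cplxv k).
Proof.
move=> v; apply/colP => a; rewrite !mxE (unsplitK (inl a : 'I_k + 'I_k)%type).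
by rewrite (unsplitK (inr a : 'I_k + 'I_k)%type) !mxE; case: (v a ord0).
Qed.

Lemma cplxvK k : cancel (@cplxv k) (@realv k).
Proof.
move=> w; apply/colP => a; rewrite mxE.
by case: (split_ordP a) => b -> /=; rewrite !mxE.
Qed.

Lemma realv_l k (v : 'cV[R[i]]_k) a : realv v (lshift k a) ord0 = complex.Re (v a ord0).
Proof. by rewrite col_mxEu mxE. Qed.
Lemma realv_r k (v : 'cV[R[i]]_k) a : realv v (rshift k a) ord0 = complex.Im (v a ord0).
Proof. by rewrite col_mxEd mxE. Qed.

Lemma realvD k (v w : 'cV[R[i]]_k) : realv (v + w) = realv v + realv w.
Proof.
apply/colP => a; rewrite mxE [RHS]mxE.
by case: (split_ordP a) => b -> /=; rewrite !mxE ?(unsplitK (inl b : 'I_k + 'I_k)%type)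
  ?(unsplitK (inr b : 'I_k + 'I_k)%type) !mxE ?ReD ?ImD.
Qed.

Lemma realvZ k (r : R) (v : 'cV[R[i]]_k) : realv (r%:C%C *: v) = r *: realv v.
Proof.
apply/colP => a; rewrite mxE [RHS]mxE.
by case: (split_ordP a) => b -> /=; rewrite !mxE ?(unsplitK (inl b : 'I_k + 'I_k)%type)
  ?(unsplitK (inr b : 'I_k + 'I_k)%type) !mxE ?ReZ ?ImZ.
Qed.

Lemma realv0 k : realv (0 : 'cV[R[i]]_k) = 0.
Proof. by rewrite -(scale0r 0) (_ : 0 = 0%:C%C)// realvZ scale0r. Qed.

Lemma realv_sum k (I : Type) (r : seq I) (P : pred I) (F : I -> 'cV[R[i]]_k) :
  realv (\sum_(i <- r | P i) F i) = \sum_(i <- r | P i) realv (F i).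
Proof. by elim/big_rec2: _ => [|i x y _ <-]; [exact: realv0|rewrite realvD]. Qed.

Definition realmx k (A : 'M[R[i]]_k) : 'M[R]_(k + k) :=
  block_mx (map_mx (@complex.Re R) A) (- map_mx (@complex.Im R) A)
           (map_mx (@complex.Im R) A) (map_mx (@complex.Re R) A).

Lemma realv_mul k (A : 'M[R[i]]_k) v : realv (A *m v) = realmx A *m realv v.
Proof.
rewrite /realmx /realv mul_block_col; congr col_mx; apply/colP => a; rewrite !mxE.
  rewrite Re_sum -big_split/=; apply: eq_bigr => b _.
  by rewrite !mxE ReM mulNr.
rewrite Im_sum -big_split/=; apply: eq_bigr => b _.
by rewrite !mxE ImM addrC.
Qed.

End realification.

Section manifold_smoothness.
Context {R : realType} {M : ptopologicalType} {n : nat} (A : smooth_atlas R M n).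
Implicit Types (c d : chart R M n) (W O : set M) (f g : M -> R).

Lemma chart_imgP c W x :
  (cmap c @` (W `&` cdom c)) x <-> cimg c x /\ W (cinv c x).
Proof.
split=> [[p [Wp cp] <-]|[cx Wx]]; first by rewrite cmapK//; split=> //; exact: cmap_img.
by exists (cinv c x); [split=> //; exact: cinv_dom|exact: cinvK].
Qed.

Lemma chart_img_sub c W : cmap c @` (W `&` cdom c) `<=` cimg c.
Proof. by move=> x /chart_imgP[]. Qed.

Lemma chart_img_open c W : open W -> open (cmap c @` (W `&` cdom c)).
Proof.
move=> oW; rewrite openE => x /chart_imgP[cx Wx].
have h1 := open_nbhs_nbhs (conj (@cimg_open R M n c) cx).
have h2 := cinv_continuous cx (open_nbhs_nbhs (conj oW Wx)).
by apply: filterS2 h1 h2 => y cy Wy; apply/chart_imgP.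
Qed.

Lemma chart_imgT c : cmap c @` (setT `&` cdom c) = cimg c.
Proof.
by apply/seteqP; split=> x; [exact: chart_img_sub|move=> cx; apply/chart_imgP].
Qed.

Lemma is_chart_atlas c : charts A c -> is_chart A c.
Proof. by move=> cA d dA; exact: (charts_compatible cA dA). Qed.

Lemma atlas_chart p : exists2 c, charts A c & cdom c p.
Proof. exact: charts_cover. Qed.

Lemma smooth_on_sub W O f : O `<=` W -> smooth_on A W f -> smooth_on A O f.
Proof.
move=> OW sf c hc; apply: smooth_sub (sf c hc) => x /chart_imgP[cx Ox].
by apply/chart_imgP; split=> //; exact: OW.
Qed.

Lemma smooth_on_ext W f g : open W -> (forall p, W p -> f p = g p) ->
  smooth_on A W f -> smooth_on A W g.
Proof.
move=> oW fg sf c hc; apply: (smooth_ext _ _ (sf c hc)); first exact: chart_img_open.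
by move=> x /chart_imgP[_ /fg].
Qed.

(* Smoothness in one chart of the maximal atlas around each point suffices:
   transition maps between such charts factor locally through the atlas [A]. *)
Lemma smooth_on_local_chart W f :
  (forall p, W p -> exists c O, [/\ is_chart A c, cdom c p, open O, O p &
     smooth (cmap c @` (O `&` cdom c)) (f \o cinv c)]) -> smooth_on A W f.
Proof.
move=> H d hd; apply: smooth_local => x /chart_imgP[dx Wx].
have [c [ O [hc cp oO Op sf]]] := H _ Wx.
have [e eA ep] := atlas_chart (cinv d x).
pose O' := O `&` cdom c `&` cdom e.
have oO' : open O'.
  by apply: openI; [apply: openI => //; exact: cdom_open|exact: cdom_open].
exists (cmap d @` (O' `&` cdom d)); first by apply/chart_imgP; do 2!split=> //.
have oD := chart_img_open (c:=d) oO'.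
have oE := chart_img_open (c:=e) oO'.
have s1 : smooth (cmap e @` (O' `&` cdom e)) (f \o cinv e).
  apply: (@smooth_ext _ _ _ ((f \o cinv c) \o (cmap c \o cinv e))) => //.
    by move=> y /chart_imgP[ey [[_ cy] _]] /=; rewrite cmapK.
  move=> k; apply: (@Ck_comp R n n k (cmap c @` (O `&` cdom c)) _ (f \o cinv c) (cmap c \o cinv e)) => //.
  - exact: chart_img_open.
  - move=> y /chart_imgP[ey [[Oy cy] _]] /=; apply/chart_imgP.
    by rewrite cmapK//; split=> //; exact: cmap_img.
  - move=> i; have [_ h] := hc e eA i; apply: Ck_sub (h k) => y /chart_imgP[ey [[_ cy] _]].
    by exists (cinv e y); [split=> //; exact: cinv_dom|exact: cinvK].
apply: (@smooth_ext _ _ _ ((f \o cinv e) \o (cmap e \o cinv d))) => //.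
  by move=> y /chart_imgP[dy [_ ey]] /=; rewrite cmapK.
move=> k; apply: (@Ck_comp R n n k (cmap e @` (O' `&` cdom e)) _ (f \o cinv e) (cmap e \o cinv d)) => //.
- move=> y /chart_imgP[dy Oy] /=; apply/chart_imgP; have [_ ey] := Oy.
  by rewrite cmapK//; split=> //; exact: cmap_img.
- move=> i; have [h _] := hd e eA i; apply: Ck_sub (h k) => y /chart_imgP[dy [_ ey]].
  by exists (cinv d y); [split=> //; exact: cinv_dom|exact: cinvK].
Qed.

Lemma smooth_on_local W f :
  (forall p, W p -> exists O, [/\ open O, O p & smooth_on A O f]) -> smooth_on A W f.
Proof.
move=> H; apply: smooth_on_local_chart => p /H[ O [oO Op sf]].
have [c cA cp] := atlas_chart p; exists c, O; split=> //; first exact: is_chart_atlas.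
exact/sf/is_chart_atlas.
Qed.

Lemma smooth_on_continuous W f p : open W -> smooth_on A W f -> W p ->
  {for p, continuous f}.
Proof.
move=> oW sf Wp; have [c cA cp] := atlas_chart p.
have cx : (cmap c @` (W `&` cdom c)) (cmap c p) by exists p.
have h := smooth_continuous (sf c (is_chart_atlas cA)) cx.
have h2 := cmap_continuous cp.
have : (f \o cinv c \o cmap c) @ p --> f p.
  have := cvg_comp _ _ h2 h; rewrite /= cmapK//; exact.
apply: cvg_trans => P /= HP.
apply: filterS2 (open_nbhs_nbhs (conj (@cdom_open R M n c) cp)) HP => q cq /=.
by rewrite cmapK.
Qed.

Lemma smooth_on_cst W (r : R) : smooth_on A W (fun=> r).
Proof. by move=> c _; exact: smooth_cst. Qed.

Lemma smooth_onD W f g : open W -> smooth_on A W f -> smooth_on A W g ->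
  smooth_on A W (fun p => f p + g p).
Proof. by move=> oW sf sg c hc; apply: smoothD (sf c hc) (sg c hc); exact: chart_img_open. Qed.

Lemma smooth_onM W f g : open W -> smooth_on A W f -> smooth_on A W g ->
  smooth_on A W (fun p => f p * g p).
Proof. by move=> oW sf sg c hc; apply: smoothM (sf c hc) (sg c hc); exact: chart_img_open. Qed.

Lemma smooth_onN W f : open W -> smooth_on A W f -> smooth_on A W (fun p => - f p).
Proof. by move=> oW sf c hc; apply: smoothN (sf c hc); exact: chart_img_open. Qed.

Lemma smooth_onB W f g : open W -> smooth_on A W f -> smooth_on A W g ->
  smooth_on A W (fun p => f p - g p).
Proof. by move=> oW sf sg; apply: smooth_onD => //; exact: smooth_onN. Qed.

Lemma smooth_on_chart c (y : 'rV[R]_n -> R) : is_chart A c -> smooth (cimg c) y ->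
  smooth_on A (cdom c) (y \o cmap c).
Proof.
move=> hc sy; apply: smooth_on_local_chart => p cp; exists c, (cdom c).
split=> //; first exact: cdom_open.
apply: smooth_ext (smooth_sub (@chart_img_sub c _) sy); first exact/chart_img_open/cdom_open.
by move=> x /chart_imgP[cx _] /=; rewrite cinvK.
Qed.

Lemma csmooth_on_sub W O (f : M -> R[i]) : O `<=` W -> csmooth_on A W f -> csmooth_on A O f.
Proof. by move=> OW [h1 h2]; split; apply: smooth_on_sub OW _. Qed.

Lemma csmooth_on_ext W (f g : M -> R[i]) : open W -> (forall p, W p -> f p = g p) ->
  csmooth_on A W f -> csmooth_on A W g.
Proof.
by move=> oW fg [h1 h2]; split; [apply: smooth_on_ext h1|apply: smooth_on_ext h2] => // p /fg->.
Qed.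

Lemma csmooth_on_cst W (z : R[i]) : csmooth_on A W (fun=> z).
Proof. by split; exact: smooth_on_cst. Qed.

Lemma csmooth_onD W (f g : M -> R[i]) : open W -> csmooth_on A W f -> csmooth_on A W g ->
  csmooth_on A W (fun p => f p + g p).
Proof.
move=> oW [f1 f2] [g1 g2]; split.
  by apply: smooth_on_ext (smooth_onD oW f1 g1) => // p _; rewrite ReD.
by apply: smooth_on_ext (smooth_onD oW f2 g2) => // p _; rewrite ImD.
Qed.

Lemma csmooth_onM W (f g : M -> R[i]) : open W -> csmooth_on A W f -> csmooth_on A W g ->
  csmooth_on A W (fun p => f p * g p).
Proof.
move=> oW [f1 f2] [g1 g2]; split.
  apply: smooth_on_ext (smooth_onB oW (smooth_onM oW f1 g1) (smooth_onM oW f2 g2)) => // p _.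
  by rewrite ReM.
apply: smooth_on_ext (smooth_onD oW (smooth_onM oW f1 g2) (smooth_onM oW f2 g1)) => // p _.
by rewrite ImM.
Qed.

Lemma csmooth_on_sum W (I : Type) (r : seq I) (F : I -> M -> R[i]) :
  open W -> (forall i, csmooth_on A W (F i)) ->
  csmooth_on A W (fun p => \sum_(i <- r) F i p).
Proof.
move=> oW sF; elim: r => [|i r IH].
  by apply: csmooth_on_ext (csmooth_on_cst W 0) => // p _; rewrite big_nil.
by apply: csmooth_on_ext (csmooth_onD oW (sF i) IH) => // p _; rewrite big_cons.
Qed.

Lemma csmooth_on_local W (f : M -> R[i]) :
  (forall p, W p -> exists O, [/\ open O, O p & csmooth_on A O f]) -> csmooth_on A W f.
Proof.
by move=> H; split; apply: smooth_on_local => p /H[ O [oO Op [h1 h2]]]; exists O.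
Qed.

Lemma csmooth_on_mulmx W k (G : M -> 'M[R[i]]_k) (v : M -> 'cV[R[i]]_k) a : open W ->
  mxsmooth_on A W G -> (forall b, csmooth_on A W (fun p => v p b ord0)) ->
  csmooth_on A W (fun p => (G p *m v p) a ord0).
Proof.
move=> oW sG sv; apply: (csmooth_on_ext (f := fun p => \sum_b G p a b * v p b ord0)) => //.
  by move=> p _; rewrite mxE.
by apply: csmooth_on_sum => // b; apply: csmooth_onM => //; exact: sG.
Qed.

Lemma chart_restrict c O : open O -> exists d : chart R M n,
  [/\ cdom d = cdom c `&` O, cmap d = cmap c, cinv d = cinv c & cimg d `<=` cimg c].
Proof.
move=> oO.
have oD : open (cdom c `&` O) by apply: openI => //; exact: cdom_open.
have oI := chart_img_open (c:=c) oO.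
have H1 p : (cdom c `&` O) p -> (cmap c @` (O `&` cdom c)) (cmap c p).
  by move=> [cp Op]; exists p.
have H2 x : (cmap c @` (O `&` cdom c)) x -> (cdom c `&` O) (cinv c x).
  by move=> /chart_imgP[cx Ox]; split=> //; exact: cinv_dom.
have H3 p : (cdom c `&` O) p -> cinv c (cmap c p) = p by move=> [cp _]; exact: cmapK.
have H4 x : (cmap c @` (O `&` cdom c)) x -> cmap c (cinv c x) = x.
  by move=> /chart_imgP[cx _]; exact: cinvK.
have H5 p : (cdom c `&` O) p -> {for p, continuous (cmap c)}.
  by move=> [cp _]; exact: cmap_continuous.
have H6 x : (cmap c @` (O `&` cdom c)) x -> {for x, continuous (cinv c)}.
  by move=> /chart_imgP[cx _]; exact: cinv_continuous.
exists (Chart oD oI H1 H2 H3 H4 H5 H6); split=> //=; exact: chart_img_sub.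
Qed.

Lemma is_chart_restrict c d O : is_chart A c -> cdom d = cdom c `&` O ->
  cmap d = cmap c -> cinv d = cinv c -> is_chart A d.
Proof.
move=> hc dE mE iE e eA j; rewrite dE mE iE; have [h1 h2] := hc e eA j; split.
  by apply: smooth_sub h1 => x [p [[cp _] ep] <-]; exists p.
by apply: smooth_sub h2 => x [p [[cp _] ep] <-]; exists p.
Qed.

End manifold_smoothness.

(** * The real part of the Hermitian structure *)

Section real_inner_product.
Context {R : realType} {M : ptopologicalType} {E : M -> lmodType R[i]}.
Variable h : hermitian_structure E.

(* The real part suffices, since [Im (h u v) = Re (h (- i u) v)]. *)
Definition rh p (u v : E p) : R := complex.Re (h p u v).

Lemma Re_conj (z : R[i]) : complex.Re (Num.conj z) = complex.Re z.
Proof. by case: z. Qed.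

Lemma rhC p (u v : E p) : rh u v = rh v u.
Proof. by rewrite /rh (hermC (h p) u v) expr0 mul1r Re_conj. Qed.

Lemma rhDl p (u v w : E p) : rh (u + v) w = rh u w + rh v w.
Proof. by rewrite /rh linearDl ReD. Qed.

Lemma rhDr p (u v w : E p) : rh w (u + v) = rh w u + rh w v.
Proof. by rewrite ![rh w _]rhC rhDl. Qed.

Lemma rhZl p (r : R) (u v : E p) : rh (r%:C%C *: u) v = r * rh u v.
Proof. by rewrite /rh linearZl_LR ReZ. Qed.

Lemma rhZr p (r : R) (u v : E p) : rh u (r%:C%C *: v) = r * rh u v.
Proof. by rewrite rhC rhZl rhC. Qed.

Lemma rhNl p (u v : E p) : rh (- u) v = - rh u v.
Proof. by rewrite -[u in - u]scale1r -scaleNr (_ : -1 = (-1)%:C%C)// ?rhZl ?mulN1r// rmorphN. Qed.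

Lemma rhNr p (u v : E p) : rh u (- v) = - rh u v.
Proof. by rewrite rhC rhNl rhC. Qed.

Lemma rh0l p (v : E p) : rh 0 v = 0.
Proof. by rewrite /rh linear0l. Qed.

Lemma rh_suml p (I : Type) (r : seq I) (P : pred I) (F : I -> E p) v :
  rh (\sum_(i <- r | P i) F i) v = \sum_(i <- r | P i) rh (F i) v.
Proof. by elim/big_rec2: _ => [|i x y _ <-]; [exact: rh0l|rewrite rhDl]. Qed.

Lemma rh_sumr p (I : Type) (r : seq I) (P : pred I) (F : I -> E p) v :
  rh v (\sum_(i <- r | P i) F i) = \sum_(i <- r | P i) rh v (F i).
Proof. by rewrite rhC rh_suml; apply: eq_bigr => i _; rewrite rhC. Qed.

Lemma rh_ge0 p (u : E p) : 0 <= rh u u.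
Proof. by have := dnorm_ge0 (h p) u; rewrite lecE /= => /andP[]. Qed.

Lemma rh_eq0 p (u : E p) : rh u u = 0 -> u = 0.
Proof.
move=> H; apply/eqP; rewrite -(dnorm_eq0 (h p)).
have := dnorm_ge0 (h p) u; rewrite lecE /= => /andP[/eqP i0 _].
by rewrite eq_complex /=; move: H; rewrite /rh => ->; rewrite i0 !eqxx.
Qed.

(** The square norm of [s u - v] is expanded and divided by [s]. The weight [s] is left free, to be
    tuned in each application. *)
Lemma rh_le p (u v : E p) (s : R) : 0 < s ->
  2 * rh u v <= s * rh u u + s^-1 * rh v v.
Proof.
move=> s0; have := rh_ge0 (s%:C%C *: u - v).
rewrite rhDl !rhDr !rhNl !rhNr !rhZl !rhZr (rhC v u) => H.
have : 0 <= s^-1 * (s * (s * rh u u) + - (s * rh u v) + (- (s * rh u v) - - rh v v)).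
  by rewrite mulr_ge0 ?invr_ge0 ?(ltW s0).
rewrite (_ : s^-1 * _ = s * rh u u - 2 * rh u v + s^-1 * rh v v); last first.
  by field; rewrite gt_eqF.
lra.
Qed.

Lemma rhD_le p (u v : E p) : rh (u + v) (u + v) <= 2 * rh u u + 2 * rh v v.
Proof.
have := rh_le u v ltr01; rewrite invr1 !mul1r rhDl !rhDr (rhC v u); lra.
Qed.

Lemma rh_norm_le p (u v : E p) : `|rh u v| <= rh u u + rh v v.
Proof.
have h1 := rh_le u v ltr01; have := rh_le u (- v) ltr01.
rewrite !rhNr rhNl opprK invr1 !mul1r in h1 * => h2.
have := rh_ge0 u; have := rh_ge0 v; rewrite ler_norml => a b; apply/andP; split; lra.
Qed.

End real_inner_product.

Section bundle_smoothness.
Context {R : realType} {M : ptopologicalType} {n k : nat} {A : smooth_atlas R M n}.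
Context {E : M -> lmodType R[i]} (S : vector_bundle A k E).
Implicit Types (t s : trivialization k E) (W O : set M) (u v : section E).

Lemma tmapD t p (v w : E p) : tdom t p -> tmap t (v + w) = tmap t v + tmap t w.
Proof. by move=> tp; have := tmap_linear tp 1 v w; rewrite !scale1r. Qed.

Lemma tmap0 t p : tdom t p -> tmap t (0 : E p) = 0.
Proof. by move=> tp; have := tmapD (0 : E p) 0 tp; rewrite addr0 => /esym/eqP; rewrite -subr_eq0 addrK => /eqP. Qed.

Lemma tmapZ t p (a : R[i]) (v : E p) : tdom t p -> tmap t (a *: v) = a *: tmap t v.
Proof. by move=> tp; have := tmap_linear tp a v 0; rewrite !addr0 tmap0// addr0. Qed.

Lemma tmap_sum t p (I : Type) (r : seq I) (P : pred I) (F : I -> E p) : tdom t p ->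
  tmap t (\sum_(i <- r | P i) F i) = \sum_(i <- r | P i) tmap t (F i).
Proof. by move=> tp; elim/big_rec2: _ => [|i x y _ <-]; [exact: tmap0|exact: tmapD]. Qed.

Lemma is_triv_bundle t : trivs S t -> is_trivialization S t.
Proof. by move=> St s Ss; exact: (trivs_compatible St Ss). Qed.

(** [is_trivialization] only compares with members of [trivs S], so the change from [t] to [t'] is
    factored near each point through such a member [s]. *)
Lemma smooth_section_local_triv W u :
  (forall p, W p -> exists t O, [/\ is_trivialization S t, tdom t p, open O, O p &
     forall a, csmooth_on A (O `&` tdom t) (fun p => tmap t (u p) a ord0)]) ->
  smooth_section_on S W u.
Proof.
move=> H t' ht' a; apply: csmooth_on_local => p [Wp t'p].
have [t [ O [ht tp oO Op su]]] := H p Wp.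
have [s Ss sp] := trivs_cover S p.
have [g1 [g1' [sg1 sg1' E1 E1']]] := ht' s Ss.
have [g2 [g2' [sg2 sg2' E2 E2']]] := ht s Ss.
pose Q := O `&` tdom t `&` tdom s `&` tdom t'.
have oQ : open Q.
  by do 3![apply: openI; last exact: tdom_open].
exists Q; split=> //.
apply: (csmooth_on_ext (f := fun p => (g1' p *m (g2 p *m tmap t (u p))) a ord0)) => //.
  move=> q [[[Oq tq] sq] t'q].
  by rewrite -E2// (tmapK tq) -E1'// (tmapK sq).
apply: csmooth_on_mulmx => //.
  by move=> x y; apply: csmooth_on_sub (sg1' x y) => q [[[]]].
move=> b; apply: csmooth_on_mulmx => //.
  by move=> x y; apply: csmooth_on_sub (sg2 x y) => q [[[]]].
by move=> b'; apply: csmooth_on_sub (su b') => q [[[]]].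
Qed.

Lemma smooth_section_local W u :
  (forall p, W p -> exists O, [/\ open O, O p & smooth_section_on S O u]) ->
  smooth_section_on S W u.
Proof.
move=> H; apply: smooth_section_local_triv => p /H[ O [oO Op su]].
have [s Ss sp] := trivs_cover S p; exists s, O; split=> //; first exact: is_triv_bundle.
by move=> a; apply: su; exact: is_triv_bundle.
Qed.

Lemma smooth_section_ext W u v : open W -> (forall p, W p -> u p = v p) ->
  smooth_section_on S W u -> smooth_section_on S W v.
Proof.
move=> oW uv su t ht a; apply: csmooth_on_ext (su t ht a).
  by apply: openI => //; exact: tdom_open.
by move=> p [Wp _]; rewrite uv.
Qed.

Lemma smooth_section0 W : smooth_section_on S W (fun=> 0).
Proof.
apply: smooth_section_local_triv => p Wp.
have [s Ss sp] := trivs_cover S p; exists s, setT; split=> //; [exact: is_triv_bundle|exact: openT|].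
move=> a; apply: (csmooth_on_ext (f := fun=> 0)); last exact: csmooth_on_cst.
  by apply: openI; [exact: openT|exact: tdom_open].
by move=> q [_ sq]; rewrite tmap0// mxE.
Qed.

Lemma smooth_sectionD W u v : open W -> smooth_section_on S W u -> smooth_section_on S W v ->
  smooth_section_on S W (fun p => u p + v p).
Proof.
move=> oW su sv t ht a.
have o : open (W `&` tdom t) by apply: openI => //; exact: tdom_open.
apply: csmooth_on_ext (csmooth_onD o (su t ht a) (sv t ht a)) => //.
by move=> p [_ tp]; rewrite tmapD// mxE.
Qed.

Lemma smooth_sectionM W (f : M -> R[i]) u : open W -> csmooth_on A W f ->
  smooth_section_on S W u -> smooth_section_on S W (fun p => f p *: u p).
Proof.
move=> oW sf su t ht a.
have o : open (W `&` tdom t) by apply: openI => //; exact: tdom_open.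
have sf' : csmooth_on A (W `&` tdom t) f by apply: csmooth_on_sub sf => p [].
apply: csmooth_on_ext (csmooth_onM o sf' (su t ht a)) => //.
by move=> p [_ tp]; rewrite tmapZ// mxE.
Qed.

Lemma triv_restrict t O : open O -> exists t',
  [/\ tdom t' = tdom t `&` O, @tmap _ _ _ _ t' = @tmap _ _ _ _ t &
      @tinv _ _ _ _ t' = @tinv _ _ _ _ t].
Proof.
move=> oO.
have oD : open (tdom t `&` O) by apply: openI => //; exact: tdom_open.
have H1 p : (tdom t `&` O) p -> forall (a : R[i]) (v w : E p),
    tmap t (a *: v + w) = a *: tmap t v + tmap t w.
  by move=> [tp _]; exact: tmap_linear.
have H2 p : (tdom t `&` O) p -> cancel (@tmap _ _ _ _ t p) (@tinv _ _ _ _ t p).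
  by move=> [tp _]; exact: tmapK.
have H3 p : (tdom t `&` O) p -> cancel (@tinv _ _ _ _ t p) (@tmap _ _ _ _ t p).
  by move=> [tp _]; exact: tinvK.
by exists (Trivialization oD H1 H2 H3).
Qed.

Lemma is_triv_restrict t t' O : is_trivialization S t -> tdom t' = tdom t `&` O ->
  @tmap _ _ _ _ t' = @tmap _ _ _ _ t -> @tinv _ _ _ _ t' = @tinv _ _ _ _ t ->
  is_trivialization S t'.
Proof.
move=> ht dE mE iE s Ss; have [g [g' [sg sg' E1 E2]]] := ht s Ss.
exists g, g'; split.
- by move=> a b; apply: csmooth_on_sub (sg a b) => p; rewrite dE => -[[]].
- by move=> a b; apply: csmooth_on_sub (sg' a b) => p; rewrite dE => -[[]].
- by move=> p v; rewrite dE iE => -[tp _]; exact: E1.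
- by move=> p v; rewrite dE mE => -[tp _]; exact: E2.
Qed.

(** The local form of a differential operator refers to a chart and a trivialization with the same
    domain; [frame_exists] restricts both to the intersection of their domains. *)
Record frame := Frame {
  fch : chart R M n;
  ftr : trivialization k E;
  fch_ok : is_chart A fch;
  ftr_ok : is_trivialization S ftr;
  fdomE : cdom fch = tdom ftr
}.

Lemma frame_exists p : exists F : frame, cdom (fch F) p.
Proof.
have [c cA cp] := charts_cover A p; have [s Ss sp] := trivs_cover S p.
have [d [d1 d2 d3 _]] := chart_restrict c (@tdom_open _ _ _ _ s).
have [s' [s1 s2 s3]] := triv_restrict s (@cdom_open _ _ _ c).
have hd : is_chart A d by apply: is_chart_restrict (is_chart_atlas cA) d1 d2 d3.
have hs : is_trivialization S s' by apply: is_triv_restrict (is_triv_bundle Ss) s1 s2 s3.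
have dE : cdom d = tdom s' by rewrite d1 s1 setIC.
by exists (Frame hd hs dE); rewrite /= d1.
Qed.

End bundle_smoothness.

Section smooth_matrices.
Context {R : realType} {n K : nat}.
Implicit Types (V : set 'rV[R]_n) (G : 'rV[R]_n -> 'M[R]_K).

Lemma smooth_det m V (G : 'rV[R]_n -> 'M[R]_m) : open V ->
  (forall a b, smooth V (fun x => G x a b)) -> smooth V (fun x => \det (G x)).
Proof.
move=> oV sG; apply: smooth_sum => // s; apply: smoothM => //; first exact: smooth_cst.
by move=> m0; apply: Ck_prod => // i; exact: sG.
Qed.

Lemma smooth_invmx V G : open V -> (forall a b, smooth V (fun x => G x a b)) ->
  (forall x, V x -> G x \in unitmx) -> forall a b, smooth V (fun x => invmx (G x) a b).
Proof.
move=> oV sG uG a b.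
apply: (@smooth_ext _ _ _ (fun x => (\det (G x))^-1 * cofactor (G x) b a)) => //.
  by move=> x Vx; rewrite /invmx uG// !mxE.
apply: smoothM => //.
  by apply: smoothV => //; [move=> x /uG; rewrite unitmxE unitfE|exact: smooth_det].
apply: smoothM => //; first exact: smooth_cst.
apply: smooth_det => // i j; apply: (@smooth_ext _ _ _ (fun x => G x (lift b i) (lift a j))) => //.
by move=> x _; rewrite !mxE.
Qed.

End smooth_matrices.

(** * Sections, Gram matrices and the operator in a frame *)

Section local_coordinates.
Context {R : realType} {M : ptopologicalType} {n k : nat} {A : smooth_atlas R M n}.
Context {E : M -> lmodType R[i]} {S : vector_bundle A k E} (F : frame S).
Local Notation c := (fch F).
Local Notation t := (ftr F).
Local Notation V := (cimg (fch F)).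
Local Notation K := (k + k)%N.
Implicit Types (u v : section E) (y : 'rV[R]_n -> 'cV[R]_K).

Lemma fdom_t p : cdom c p -> tdom t p. Proof. by rewrite fdomE. Qed.

(* Local coordinates, with [C^k] identified with [R^(k + k)] so that all of the local
   analysis is real. *)
Definition lc u (x : 'rV[R]_n) : 'cV[R]_K := realv (tmap t (u (cinv c x))).

(** Inverse of [lc] over the chart. The extension by 0 is smooth on [M] when [y] is smooth with
    support in a closed ball inside the chart image, see [pull_test]. *)
Definition pull y : section E :=
  fun p => if p \in cdom c then tinv t p (cplxv (y (cmap c p))) else 0.

Lemma pullE y p : cdom c p -> pull y p = tinv t p (cplxv (y (cmap c p))).
Proof. by move=> cp; rewrite /pull mem_set. Qed.

Lemma pull_out y p : ~ cdom c p -> pull y p = 0.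
Proof. by move=> cp; rewrite /pull memNset. Qed.

Lemma lc_pull y x : V x -> lc (pull y) x = y x.
Proof.
move=> Vx; rewrite /lc pullE; last exact: cinv_dom.
rewrite tinvK; last by apply: fdom_t; exact: cinv_dom.
by rewrite cplxvK cinvK.
Qed.

Lemma pull_lc u y p : cdom c p -> y (cmap c p) = lc u (cmap c p) -> pull y p = u p.
Proof.
move=> cp yu; rewrite pullE// yu /lc cmapK// realvK tmapK//; exact: fdom_t.
Qed.

Lemma lcD u v x : V x -> lc (fun p => u p + v p) x = lc u x + lc v x.
Proof. by move=> Vx; rewrite /lc tmapD ?realvD//; apply: fdom_t; exact: cinv_dom. Qed.

Lemma lcZ (r : M -> R) u x : V x ->
  lc (fun p => (r p)%:C%C *: u p) x = r (cinv c x) *: lc u x.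
Proof. by move=> Vx; rewrite /lc tmapZ ?realvZ//; apply: fdom_t; exact: cinv_dom. Qed.

Lemma lc0 u x : V x -> u (cinv c x) = 0 -> lc u x = 0.
Proof. by move=> Vx u0; rewrite /lc u0 tmap0 ?realv0//; apply: fdom_t; exact: cinv_dom. Qed.

Lemma lc_smooth u a : smooth_section S u -> smooth V (fun x => lc u x a ord0).
Proof.
move=> su; have V1 : cmap c @` ((setT `&` tdom t) `&` cdom c) = V.
  rewrite setTI -fdomE setIid; apply/seteqP; split=> x; first by move=> [p cp <-]; exact: cmap_img.
  by move=> Vx; exists (cinv c x); [exact: cinv_dom|exact: cinvK].
case: (split_ordP a) => b ->.
  have [h _] := su t (ftr_ok F) b; have := h c (fch_ok F); rewrite V1.
  by apply: smooth_ext => [|x _]; [exact: cimg_open|rewrite /lc realv_l].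
have [_ h] := su t (ftr_ok F) b; have := h c (fch_ok F); rewrite V1.
by apply: smooth_ext => [|x _]; [exact: cimg_open|rewrite /lc realv_r].
Qed.

Lemma pull_smooth_on y : (forall a, smooth V (fun x => y x a ord0)) ->
  smooth_section_on S (cdom c) (pull y).
Proof.
move=> sy; apply: smooth_section_local_triv => p cp; exists t, (cdom c).
split=> //; [exact: ftr_ok|exact: fdom_t|exact: cdom_open|move=> a].
rewrite -fdomE setIid; split.
  apply: smooth_on_ext (smooth_on_chart (fch_ok F) (sy (lshift k a))); first exact: cdom_open.
  by move=> q cq; rewrite pullE// tinvK ?mxE//; exact: fdom_t.
apply: smooth_on_ext (smooth_on_chart (fch_ok F) (sy (rshift k a))); first exact: cdom_open.
by move=> q cq; rewrite pullE// tinvK ?mxE//; exact: fdom_t.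
Qed.

(** In a Hausdorff space [Q] is closed, so its complement and the chart domain form an open cover of
    [M], and on the complement the section is 0. *)
Lemma smooth_section_off_compact (Q : set M) u : hausdorff_space M -> compact Q ->
  Q `<=` cdom c -> smooth_section_on S (cdom c) u -> (forall p, ~ Q p -> u p = 0) ->
  compactly_supported_smooth S u.
Proof.
move=> hM cQ QV su u0; have clQ : closed Q by exact: compact_closed.
split.
  apply: smooth_section_local => p _; have [cp|ncp] := pselect (cdom c p).
    by exists (cdom c); split=> //; exact: cdom_open.
  exists (~` Q); split; [exact: closed_openC|by move=> /QV|].
  have uQ q : (~` Q) q -> (fun=> 0 : E q) q = u q by move=> /u0.
  exact: (smooth_section_ext (closed_openC clQ) uQ (smooth_section0 (~` Q))).
apply: (subclosed_compact _ cQ); first exact: closed_closure.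
rewrite closureE; apply: smallest_sub => // p up; apply: contrapT => /u0; exact: up.
Qed.

Lemma compact_chart_image (x0 : 'rV[R]_n) (r : R) : [set x | `|x - x0| <= r] `<=` V ->
  compact (cinv c @` [set x | `|x - x0| <= r]).
Proof.
move=> rV; apply: continuous_compact; last exact: (@norm_le_compact R n x0 r).
by apply: continuous_in_subspaceT => x /set_mem /rV; exact: cinv_continuous.
Qed.

Lemma pull_test y (x0 : 'rV[R]_n) (r : R) : hausdorff_space M ->
  [set x | `|x - x0| <= r] `<=` V -> (forall a, smooth V (fun x => y x a ord0)) ->
  (forall x, r < `|x - x0| -> y x = 0) -> compactly_supported_smooth S (pull y).
Proof.
move=> hM rV sy y0; apply: (smooth_section_off_compact hM (compact_chart_image rV)).
- by move=> p [x /rV Vx <-]; exact: cinv_dom.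
- exact: pull_smooth_on.
- move=> p np; have [cp|ncp] := pselect (cdom c p); last exact: pull_out.
  rewrite pullE// y0; last first.
    rewrite ltNge; apply/negP => h; apply: np; exists (cmap c p) => //; exact: cmapK.
  by rewrite -realv0 realvK -(tmap0 (fdom_t cp)) tmapK//; exact: fdom_t.
Qed.

(** A frame over the reals: the first [k] sections correspond to the standard basis of [C^k], the
    last [k] are their multiples by the imaginary unit. *)
Definition fframe (a : 'I_K) : section E := pull (fun=> delta_mx a ord0).

Lemma fframe_expand u x : V x ->
  u (cinv c x) = \sum_a (lc u x a ord0)%:C%C *: fframe a (cinv c x).
Proof.
move=> Vx; have cp := cinv_dom Vx; have tp := fdom_t cp.
apply: (can_inj (tmapK tp)); rewrite tmap_sum//; apply: (can_inj (@realvK R k)).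
rewrite realv_sum -/(lc u x) [LHS](matrix_sum_delta (lc u x)); apply: eq_bigr => a _.
by rewrite big_ord1 tmapZ// realvZ /fframe pullE// tinvK// cplxvK.
Qed.

Variable h : hermitian_structure E.

Definition gram (x : 'rV[R]_n) : 'M[R]_K :=
  \matrix_(a, b) rh h (fframe a (cinv c x)) (fframe b (cinv c x)).

Lemma gram_smooth (hs : smooth_hermitian S h) a b : smooth V (fun x => gram x a b).
Proof.
have sf d : smooth_section_on S (cdom c) (fframe d).
  by apply: pull_smooth_on => e; exact: smooth_cst.
have [h1 _] := hs (cdom c) (fframe a) (fframe b) (@cdom_open _ _ _ c) (sf a) (sf b).
have := h1 c (fch_ok F); rewrite setIid.
have -> : cmap c @` cdom c = V by rewrite -{1}(setTI (cdom c)) chart_imgT.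
by apply: smooth_ext => [|x _]; [exact: cimg_open|rewrite mxE].
Qed.

Lemma rh_gram u v x : V x ->
  rh h (u (cinv c x)) (v (cinv c x)) =
  \sum_a \sum_b lc u x a ord0 * gram x a b * lc v x b ord0.
Proof.
move=> Vx; rewrite {1}(fframe_expand u Vx) {1}(fframe_expand v Vx) rh_suml.
apply: eq_bigr => a _; rewrite rhZl rh_sumr mulr_sumr; apply: eq_bigr => b _.
by rewrite rhZr [gram x a b]mxE -[RHS]mulrA; congr (_ * _); rewrite mulrC.
Qed.

(** A vector of the left kernel is the coordinate vector of a fibre element of norm 0, hence
    vanishes by definiteness. *)
Lemma gram_unit x : V x -> gram x \in unitmx.
Proof.
move=> Vx; rewrite -row_free_unit -kermx_eq0; apply/rowV0P => w /sub_kermxP wG.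
pose u := pull (fun=> w^T).
have u0 : u (cinv c x) = 0.
  apply: (rh_eq0 (h := h)); rewrite rh_gram// exchange_big/=.
  apply: big1 => b _; rewrite lc_pull// -mulr_suml.
  have := congr1 (fun m : 'rV_K => m ord0 b) wG; rewrite !mxE => e.
  by rewrite (eq_bigr (fun a => w ord0 a * gram x a b)) ?e ?mul0r// => a _; rewrite mxE.
by rewrite -[w]trmxK -[w^T](lc_pull (fun=> w^T) Vx) -/u lc0// trmx0.
Qed.

(* The a-th coordinate is the pairing with the a-th vector of the dual frame. *)
Lemma coord_le_rh u x a (B : R) : V x -> 1 <= B -> invmx (gram x) a a <= B ->
  lc u x a ord0 ^+ 2 <= B * rh h (u (cinv c x)) (u (cinv c x)).
Proof.
move=> Vx B1 iB; have B0 : 0 < B by exact: lt_le_trans B1.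
set q := cinv c x; set s := lc u x a ord0.
pose d := pull (fun=> (invmx (gram x))^T *m delta_mx a ord0).
have ld b : lc d x b ord0 = invmx (gram x) a b.
  rewrite lc_pull// mxE (bigD1 a)//= big1 ?addr0 => [|i /negbTE ia].
    by rewrite !mxE eqxx mulr1.
  by rewrite !mxE ia mulr0.
have du v : rh h (d q) (v q) = lc v x a ord0.
  rewrite rh_gram// exchange_big/=.
  under eq_bigr => b _ do rewrite -mulr_suml.
  under eq_bigr => b _ do under eq_bigr => i _ do rewrite ld.
  have e b : \sum_i invmx (gram x) a i * gram x i b = (a == b)%:R.
    by have := congr1 (fun m : 'M[R]_(k + k) => m a b) (mulVmx (gram_unit Vx)); rewrite !mxE.
  rewrite (bigD1 a)//= e eqxx mul1r big1 ?addr0// => b /negbTE ba.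
  by rewrite e eq_sym ba mul0r.
(* The square norm of [d q] is the diagonal entry of the inverse Gram matrix, at most [B]. With the
   multiple [s / B] the expansion therefore gives [s ^ 2 / B <= rh u u]. *)
have := rh_ge0 h ((s / B)%:C%C *: d q - u q).
rewrite rhDl !rhDr !rhNl !rhNr !rhZl !rhZr (rhC h (u q)) !du -/s ld opprK => H.
have : s ^+ 2 / B ^+ 2 * invmx (gram x) a a <= s ^+ 2 / B.
  have -> : s ^+ 2 / B = s ^+ 2 / B ^+ 2 * B by field; rewrite gt_eqF.
  by rewrite ler_wpM2l// divr_ge0 ?sqr_ge0.
have e1 : s / B * (s / B * invmx (gram x) a a) = s ^+ 2 / B ^+ 2 * invmx (gram x) a a.
  by field; rewrite gt_eqF.
have e2 : s / B * s = s ^+ 2 / B by rewrite expr2 mulrAC.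
rewrite e1 e2 in H => H2; rewrite -ler_pdivrMl// mulrC; lra.
Qed.

(** The derivatives in [partial] act on real and imaginary parts separately, so the complex
    coefficient matrices are simply replaced by their real forms [realmx]. *)
Lemma operator_coords (D : section E -> section E) : differential_operator S D ->
  exists (al : 'I_n -> 'rV[R]_n -> 'M[R]_K) (be : 'rV[R]_n -> 'M[R]_K),
    [/\ forall j a b, smooth V (fun x => al j x a b),
        forall a b, smooth V (fun x => be x a b) &
        forall u x, smooth_section S u -> V x -> forall a,
          lc (D u) x a ord0 =
          \sum_j \sum_b al j x a b * 'D_(delta_mx ord0 j) (fun x => lc u x b ord0) x +
          \sum_b be x a b * lc u x b ord0].
Proof.
move=> [_ _ _ Dloc].
have [a0 [b0 [sa sb ED]]] := Dloc c t (fch_ok F) (ftr_ok F) (fdomE F).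
have smx (G : M -> 'M[R[i]]_k) a b : mxsmooth_on A (cdom c) G ->
    smooth V (fun x => realmx (G (cinv c x)) a b).
  move=> sG; have VE : cmap c @` (cdom c `&` cdom c) = V by rewrite setIid -{1}(setTI (cdom c)) chart_imgT.
  have sRe a' b' : smooth V (fun x => complex.Re (G (cinv c x) a' b')).
    by have [h1 _] := sG a' b'; have := h1 c (fch_ok F); rewrite VE.
  have sIm a' b' : smooth V (fun x => complex.Im (G (cinv c x) a' b')).
    by have [_ h1] := sG a' b'; have := h1 c (fch_ok F); rewrite VE.
  have oV := @cimg_open _ _ _ c.
  case: (split_ordP a) => a' ->; case: (split_ordP b) => b' ->.
  - by apply: (smooth_ext oV _ (sRe a' b')) => x _; rewrite block_mxEul mxE.
  - by apply: (smooth_ext oV _ (smoothN oV (sIm a' b'))) => x _; rewrite block_mxEur !mxE.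
  - by apply: (smooth_ext oV _ (sIm a' b')) => x _; rewrite block_mxEdl mxE.
  - by apply: (smooth_ext oV _ (sRe a' b')) => x _; rewrite block_mxEdr mxE.
exists (fun j x => realmx (a0 j (cinv c x))), (fun x => realmx (b0 (cinv c x))).
split=> [j a b|a b|u x su Vx a]; [exact: smx|exact: smx|].
have cp := cinv_dom Vx; have tp := fdom_t cp.
rewrite {1}/lc (ED _ _ cp su) tmapD// tmap_sum// realvD realv_sum mxE summxE.
congr (_ + _).
  apply: eq_bigr => j _; rewrite tinvK// realv_mul mxE; apply: eq_bigr => b _.
  congr (_ * _); rewrite cinvK//.
  case: (split_ordP b) => b' ->; rewrite ?realv_l ?realv_r mxE /=; congr ('D_ _ _ _);
    by apply/funext => z; rewrite /lc ?realv_l ?realv_r.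
by rewrite tinvK// realv_mul mxE.
Qed.

End local_coordinates.

(** * Measurable and square-integrable sections *)

Section integral_density.
Context d1 d2 {X : measurableType d1} {Y : measurableType d2} {R : realType}.
Variables (mu : {measure set X -> \bar R}) (la : {measure set Y -> \bar R}).
Variables (D : set X) (V : set Y) (phi : X -> Y) (ka : Y -> R).
Hypotheses (mD : measurable D) (mV : measurable V).
Hypotheses (mphi : measurable_fun D phi) (mka : measurable_fun V ka).
Hypothesis ka0 : forall y, V y -> 0 <= ka y.
Hypothesis H : forall B, measurable B ->
  mu (D `&` phi @^-1` B) = (\int[la]_(y in V `&` B) (ka y)%:E)%E.

Import HBNNSimple.

(** The hypothesis [H] is the case of indicators; simple functions follow by linearity, and the
    general case by monotone convergence on both sides. *)
Lemma ge0_integral_density (g : Y -> \bar R) : measurable_fun setT g ->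
  (forall y, (0 <= g y)%E) ->
  (\int[mu]_(x in D) g (phi x) = \int[la]_(y in V) ((ka y)%:E * g y))%E.
Proof.
move=> mg g0; pose f_ := nnsfun_approx measurableT mg.
have cf y : (f_ n y)%:E @[n --> \oo] --> g y by exact: cvg_nnsfun_approx.
have nd m n y : (m <= n)%N -> ((f_ m y)%:E <= (f_ n y)%:E)%E.
  by move=> mn; rewrite lee_fin; exact/lefP/nd_nnsfun_approx.
have mfp n : measurable_fun D (fun x => (f_ n (phi x))%:E).
  by apply/measurable_EFinP; apply: measurableT_comp.
have mfk n : measurable_fun V (fun y => ((ka y)%:E * (f_ n y)%:E)%E).
  apply: emeasurable_funM; first exact/measurable_EFinP.
  by apply/measurable_EFinP; exact: measurable_funTS.
transitivity (limn (fun n => \int[mu]_(x in D) (f_ n (phi x))%:E)%E).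
  rewrite -monotone_convergence//.
  - by apply: eq_integral => x _; apply/esym/cvg_lim => //; exact: cf.
  - by move=> n x _; rewrite lee_fin.
  - by move=> x _ m n; exact: nd.
transitivity (limn (fun n => \int[la]_(y in V) ((ka y)%:E * (f_ n y)%:E))%E); last first.
  rewrite -monotone_convergence//.
  - apply: eq_integral => y _; apply/cvg_lim => //.
    by apply: cvgeZl => //; exact: cf.
  - by move=> n y Vy; rewrite mule_ge0 ?lee_fin ?ka0.
  - by move=> y Vy m n mn; rewrite lee_wpmul2l ?lee_fin ?ka0// -lee_fin; exact: nd.
congr (limn _); apply/funext => n.
have mi r : measurable_fun setT (\1_(f_ n @^-1` [set r]) : Y -> R) by exact: measurable_indic.
transitivity (\sum_(r \in range (f_ n))
    \int[mu]_(x in D) (r * \1_(f_ n @^-1` [set r]) (phi x))%:E)%E.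
  rewrite -ge0_integral_fsum//.
  - by apply: eq_integral => x _; rewrite fimfunE fsumEFin.
  - by move=> r; apply/measurable_EFinP; apply: measurable_funM => //; exact: measurableT_comp.
  - by move=> r x _; rewrite nnfun_muleindic_ge0.
transitivity (\sum_(r \in range (f_ n))
    \int[la]_(y in V) ((ka y)%:E * (r * \1_(f_ n @^-1` [set r]) y)%:E))%E; last first.
  rewrite -ge0_integral_fsum//.
  - apply: eq_integral => y /[!inE] Vy; rewrite [in RHS]fimfunE -fsumEFin//.
    rewrite ge0_mule_fsumr// => r; exact: nnfun_muleindic_ge0.
  - move=> r; apply: emeasurable_funM; first exact/measurable_EFinP.
    apply/measurable_EFinP; apply: measurable_funM => //; exact: measurable_funTS.
  - by move=> r y Vy; apply: mule_ge0; [rewrite lee_fin ka0|exact: nnfun_muleindic_ge0].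
apply: eq_fsbigr => r _.
have mr : measurable (f_ n @^-1` [set r]) by exact: measurable_sfunP.
have [r0|r0] := ltP r 0.
  rewrite preimage_nnfun0// indic0.
  by rewrite !integral0_eq// => x _; rewrite mulr0 ?mule0.
transitivity (r%:E * mu (D `&` phi @^-1` (f_ n @^-1` [set r])))%E.
  under eq_integral do rewrite EFinM.
  rewrite ge0_integralZl_EFin//; last by apply/measurable_EFinP; exact: measurableT_comp.
  congr (_ * _)%E.
  transitivity (\int[mu]_(x in D) (\1_(D `&` phi @^-1` (f_ n @^-1` [set r])) x)%:E)%E.
    apply: eq_integral => x /[!inE] Dx; rewrite !indicE; congr ((nat_of_bool _)%:R%:E).
    by apply/idP/idP => [/set_mem h|/set_mem[_ h]]; apply/mem_set.
  have m1 := mphi mD mr.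
  rewrite integral_indic; first by rewrite setIAC setIid.
    exact: mD.
  exact: m1.
rewrite H//; under [RHS]eq_integral do rewrite EFinM muleCA.
rewrite [RHS]ge0_integralZl_EFin//; last 2 first.
- by move=> y Vy; rewrite mule_ge0 ?lee_fin ?ka0.
- apply: emeasurable_funM; first exact/measurable_EFinP.
  by apply/measurable_EFinP; exact: measurable_funTS.
congr (_ * _)%E; rewrite integral_mkcondr; apply: eq_integral => y _.
by rewrite /patch indicE; case: ifP => _; rewrite ?mule1 ?mule0.
Qed.

Lemma Rintegral_density (g : Y -> R) : measurable_fun setT g ->
  Rintegral mu D (fun x => g (phi x)) = Rintegral la V (fun y => ka y * g y).
Proof.
move=> mg; rewrite /Rintegral; congr fine; rewrite [LHS]integralE [RHS]integralE.
have mE : measurable_fun setT (EFin \o g) by exact/measurable_EFinP.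
congr (_ - _)%E.
  transitivity (\int[mu]_(x in D) ((EFin \o g)^\+ (phi x)))%E.
    by apply: eq_integral => x _; rewrite !funeposE.
  rewrite ge0_integral_density//; last exact: measurable_funepos.
  apply: eq_integral => y /[!inE] Vy; rewrite !funeposE /= -EFin_max -EFinM.
  by rewrite -EFin_max; congr EFin; rewrite maxr_pMr ?ka0// mulr0.
transitivity (\int[mu]_(x in D) ((EFin \o g)^\- (phi x)))%E.
  by apply: eq_integral => x _; rewrite !funenegE.
rewrite ge0_integral_density//; last exact: measurable_funeneg.
apply: eq_integral => y /[!inE] Vy; rewrite !funenegE /= -EFin_max -EFinM.
by rewrite -EFin_max; congr EFin; rewrite maxr_pMr ?ka0// mulr0 mulrN.
Qed.

End integral_density.

Section chart_integral.
Context {R : realType} {M : ptopologicalType} {n : nat} {A : smooth_atlas R M n}.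
Variable mu : {measure set (borel M) -> \bar R}.
Variables (c : chart R M n) (ka : 'rV[R]_n -> R).
Hypothesis hka : is_density mu c ka.

Lemma open_measurable_borel (T : ptopologicalType) (W : set T) : open W ->
  measurable (W : set (borel T)).
Proof. by move=> oW; exact: sub_sigma_algebra. Qed.

Lemma measurable_fun_continuous_on (T U : ptopologicalType) (W : set T) (f : T -> U) :
  open W -> (forall x, W x -> {for x, continuous f}) ->
  measurable_fun (W : set (borel T)) (f : borel T -> borel U).
Proof.
move=> oW cf; have HU : @measurable _ (borel U) = <<s @open U >> by [].
apply: (measurability _ HU) => _ [B oB <-]; apply: open_measurable_borel.
rewrite openE => x [Wx Bx].
exact: filterI (open_nbhs_nbhs (conj oW Wx)) (cf x Wx _ (open_nbhs_nbhs (conj oB Bx))).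
Qed.

Lemma measurable_fun_continuous_onR (T : ptopologicalType) (W : set T) (f : T -> R) :
  open W -> (forall x, W x -> {for x, continuous f}) ->
  measurable_fun (W : set (borel T)) (f : borel T -> R).
Proof.
move=> oW cf; apply: (measurability _ (RGenOpens.measurableE R)).
move=> _ [_ [a [b ->] <-]]; apply: open_measurable_borel.
rewrite openE => x [Wx Bx].
apply: filterI (open_nbhs_nbhs (conj oW Wx)) (cf x Wx _ _).
by apply: open_nbhs_nbhs; split=> //; exact: interval_open.
Qed.

(** Both integrands are extended by 0, so that an integral over a chart becomes one over the whole
    Euclidean space, in the form used by [Int]. *)
Lemma chart_Rintegral (G : 'rV[R]_n -> R) : continuous G ->
  Rintegral mu setT (fun p : borel M => if p \in cdom c then G (cmap c p) else 0) =
  Int (zero_extend (cimg c) (fun x => ka x * G x)).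
Proof.
move=> cG; have [ska ka0 Hka] := hka.
have oD := @cdom_open _ _ _ c; have oV := @cimg_open _ _ _ c.
have mD := open_measurable_borel oD; have mV := open_measurable_borel oV.
have mph : measurable_fun (cdom c : set (borel M)) (cmap c : borel M -> borel 'rV[R]_n).
  by apply: measurable_fun_continuous_on => // p; exact: cmap_continuous.
have mka : measurable_fun (cimg c : set (borel 'rV[R]_n)) (ka : borel 'rV[R]_n -> R).
  by apply: measurable_fun_continuous_onR => // x; exact: smooth_continuous ska.
have mG : measurable_fun setT (G : borel 'rV[R]_n -> R) by exact: ccont_measurable.
have := @Rintegral_density _ _ (borel M) (borel 'rV[R]_n) R mu (lebesgue_rV R n)
  (cdom c) (cimg c) (cmap c) ka mD mV mph mka (fun x Vx => ltW (ka0 x Vx)) Hka G mG.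
rewrite /Int /Rintegral => E; transitivity (fine (\int[mu]_(p in cdom c) (G (cmap c p))%:E)%E).
  congr fine; rewrite [RHS]integral_mkcond; apply: eq_integral => p _.
  by rewrite /patch; case: ifP.
rewrite E; congr fine; rewrite [LHS]integral_mkcond; apply: eq_integral => p _.
by rewrite /patch /zero_extend; case: ifP.
Qed.

End chart_integral.

Section topology_facts.
Context {R : realType} {M : ptopologicalType}.

Lemma compact_finite_cover (Q : set M) (P : M -> set M) : compact Q ->
  (forall p, Q p -> open (P p) /\ P p p) ->
  exists s : seq M, (forall p, p \in s -> Q p) /\
    forall q, Q q -> exists2 p, p \in s & P p q.
Proof.
rewrite compact_cover => cQ HP.
have [p Qp|q Qq|s sQ cs] := cQ M Q P; first exact: (HP p Qp).1.
  by exists q => //; exact: (HP q Qq).2.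
exists (finmap.enum_fset s); split=> [p ps|q /cs[p /= ps Ppq]]; last by exists p.
by have := sQ p ps; rewrite in_setE.
Qed.

Lemma measurable_fun_locally (f : borel M -> R) : @second_countable M ->
  (forall p : M, exists O : set M, [/\ open O, O p & measurable_fun (O : set (borel M)) f]) ->
  measurable_fun setT f.
Proof.
move=> [B /countable_injP[g ginj] [Bo Bb]] H.
(* The countable base is enumerated through its injection [g]: [G i] is the base set of index [i] if
   [f] is measurable on it, and empty otherwise. These sets cover [M]. *)
pose P (i : nat) (U : set M) := [/\ B U, g U = i & measurable_fun (U : set (borel M)) f].
pose G (i : nat) : set (borel M) := \bigcup_(U in P i) U.
have GE i U : P i U -> G i = U.
  move=> PU; apply/seteqP; split=> [p [U' [BU' gU' _] U'p]|p Up]; last by exists U.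
  have [BU gU _] := PU; suff -> : U = U' by [].
  by apply: ginj; rewrite ?inE// gU gU'.
have -> : setT = \bigcup_i G i.
  apply/seteqP; split=> // p _; have [ O [oO Op mO]] := H p.
  have [U [BU Up] UO] := Bb p _ (open_nbhs_nbhs (conj oO Op)).
  exists (g U) => //; exists U => //; split=> //.
  by apply: measurable_funS mO => //; exact: open_measurable_borel.
have Gm i : measurable (G i) /\ measurable_fun (G i) f.
  have [[U PU]|nP] := pselect (exists U, P i U).
    rewrite (GE _ _ PU); have [BU _ mU] := PU; split=> //.
    by apply: open_measurable_borel; exact: Bo.
  have -> : G i = set0 by apply/seteqP; split=> // p [U PU]; case: nP; exists U.
  by split=> //; exact: measurable_fun_set0.
by apply/measurable_fun_bigcup => i; exact: (Gm i).1 || exact: (Gm i).2.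
Qed.

Lemma section_ext {E : M -> lmodType R[i]} (u v : section E) : (forall p, u p = v p) -> u = v.
Proof. exact: functional_extensionality_dep. Qed.

End topology_facts.

Section L2_sections.
Context {R : realType} {M : ptopologicalType} {n k : nat} {A : smooth_atlas R M n}.
Context {E : M -> lmodType R[i]} {S : vector_bundle A k E}.
Variables (h : hermitian_structure E) (mu : {measure set (borel M) -> \bar R}).
Hypotheses (M_hausdorff : hausdorff_space M) (M_countable : @second_countable M).
Hypothesis mu_smooth : nowhere_vanishing_smooth A mu.
Hypothesis h_smooth : smooth_hermitian S h.
Implicit Types (u v w : section E) (r : M -> R).

Local Notation ms := (measurable_section S).
Local Notation test := (compactly_supported_smooth S).

Definition rin u v : R := Rintegral mu setT (fun p : borel M => rh h (u p) (v p)).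
Definition nsq u : R := rin u u.
(** Square integrability without the approximation clause of [in_L2]: this suffices for bilinear
    estimates and is stable under bounded measurable multipliers. *)
Definition L2f u : Prop := ms u /\ (normsq h mu u < +oo)%E.

Lemma ms_coord u (F : frame S) a : ms u ->
  measurable_fun (cdom (fch F) : set (borel M))
    ((fun p => realv (tmap (ftr F) (u p)) a ord0) : borel M -> R).
Proof.
move=> mu_; rewrite (fdomE F); case: (split_ordP a) => b ->.
  by under eq_fun do rewrite realv_l; exact: (mu_ _ (ftr_ok F) b).1.
by under eq_fun do rewrite realv_r; exact: (mu_ _ (ftr_ok F) b).2.
Qed.

(** In a frame the pairing is a finite sum of products of measurable coordinates and continuous Gram
    coefficients; countably many frames suffice. *)
Lemma measurable_rh u v : ms u -> ms v ->
  measurable_fun setT ((fun p => rh h (u p) (v p)) : borel M -> R).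
Proof.
move=> mu_ mv; apply: measurable_fun_locally => // p.
have [F Fp] := frame_exists S p; exists (cdom (fch F)); split=> //; first exact: cdom_open.
apply: (@eq_measurable_fun _ _ _ _ _ (fun p : borel M => \sum_a \sum_b
   realv (tmap (ftr F) (u p)) a ord0 * gram F h (cmap (fch F) p) a b *
   realv (tmap (ftr F) (v p)) b ord0)).
  move=> q /set_mem cq.
  have := @rh_gram _ _ _ _ _ _ _ F h u v _ (cmap_img cq).
  by rewrite /lc cmapK// => ->.
have mg a b : measurable_fun (cdom (fch F) : set (borel M))
    ((fun p => gram F h (cmap (fch F) p) a b) : borel M -> R).
  apply: measurable_fun_continuous_onR; first exact: cdom_open.
  move=> q cq; apply: (@continuous_comp _ _ _ (cmap (fch F)) (fun x => gram F h x a b)).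
    exact: cmap_continuous.
  apply: (@smooth_continuous R n (cimg (fch F)) _ _ _ (cmap_img cq)).
  exact: gram_smooth.
apply: measurable_sum => a; apply: measurable_sum => b.
by apply: measurable_funM; [apply: measurable_funM => //|]; exact: ms_coord.
Qed.

Lemma emeasurable_rh u v : ms u -> ms v ->
  measurable_fun setT (EFin \o (fun p : borel M => rh h (u p) (v p))).
Proof. by move=> mu_ mv; apply/measurable_EFinP; exact: measurable_rh. Qed.

Lemma msD u v : ms u -> ms v -> ms (fun p => u p + v p).
Proof.
move=> mu_ mv t ht a; have [u1 u2] := mu_ t ht a; have [v1 v2] := mv t ht a; split.
  apply: eq_measurable_fun (measurable_funD u1 v1) => p /set_mem tp.
  by rewrite tmapD// mxE ReD.
apply: eq_measurable_fun (measurable_funD u2 v2) => p /set_mem tp.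
by rewrite tmapD// mxE ImD.
Qed.

Lemma msM r u : measurable_fun setT (r : borel M -> R) -> ms u ->
  ms (fun p => (r p)%:C%C *: u p).
Proof.
move=> mr mu_ t ht a; have [u1 u2] := mu_ t ht a.
have mr' := measurable_funTS mr (D := (tdom t : set (borel M))); split.
  apply: eq_measurable_fun (measurable_funM mr' u1) => p /set_mem tp.
  by rewrite tmapZ// mxE ReZ.
apply: eq_measurable_fun (measurable_funM mr' u2) => p /set_mem tp.
by rewrite tmapZ// mxE ImZ.
Qed.

Lemma smooth_ms u : smooth_section S u -> ms u.
Proof.
move=> su t ht a; have [h1 h2] := su t ht a; rewrite setTI in h1 h2.
have oT := @tdom_open _ _ _ _ t.
by split; apply: measurable_fun_continuous_onR => // p tp;
  [exact: smooth_on_continuous h1 tp|exact: smooth_on_continuous h2 tp].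
Qed.

Lemma normsqE u : ms u -> (normsq h mu u < +oo)%E -> normsq h mu u = (nsq u)%:E.
Proof.
move=> _ uoo; rewrite /nsq /rin /Rintegral /normsq fineK// ge0_fin_numE//.
by apply: integral_ge0 => p _; rewrite lee_fin; exact: rh_ge0.
Qed.

Lemma normsq_le u (g : borel M -> \bar R) : ms u -> measurable_fun setT g ->
  (forall p, ((rh h (u p) (u p))%:E <= g p)%E) -> (normsq h mu u <= \int[mu]_p g p)%E.
Proof.
move=> mu_ mg ug; apply: (@ge0_le_integral _ _ _ mu setT measurableT
  (fun p : borel M => (rh h (u p) (u p))%:E) g).
all: try by [].
all: try exact: emeasurable_rh.
all: by move=> p _; rewrite lee_fin; exact: rh_ge0.
Qed.

Lemma integrable_rh_sqr u : L2f u ->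
  mu.-integrable setT (EFin \o (fun p : borel M => rh h (u p) (u p))).
Proof.
move=> [mu_ uoo]; apply/integrableP; split; first exact: emeasurable_rh.
under eq_integral do rewrite gee0_abs ?lee_fin ?rh_ge0//.
exact: uoo.
Qed.

Lemma integrable_rh u v : L2f u -> L2f v ->
  mu.-integrable setT (EFin \o (fun p : borel M => rh h (u p) (v p))).
Proof.
move=> Lu Lv; apply: (le_integrable measurableT _ _
  (integrableD measurableT (integrable_rh_sqr Lu) (integrable_rh_sqr Lv))).
  by apply: emeasurable_rh; [exact: Lu.1|exact: Lv.1].
move=> p _ /=; rewrite lee_fin [leRHS]ger0_norm ?addr_ge0 ?rh_ge0//.
exact: rh_norm_le.
Qed.

Lemma L2fD u v : L2f u -> L2f v -> L2f (fun p => u p + v p).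
Proof.
move=> Lu Lv; split; first exact: msD Lu.1 Lv.1.
have := integrableD measurableT (integrable_rh_sqr Lu) (integrable_rh_sqr Lv).
move=> /(integrableZl measurableT 2)/integrableP[mg]; apply: le_lt_trans.
apply: normsq_le; first exact: msD Lu.1 Lv.1.
  exact: measurableT_comp.
move=> p /=; rewrite lee_fin [leRHS]ger0_norm.
  by rewrite mulrDr; exact: rhD_le.
by rewrite mulr_ge0// addr_ge0 ?rh_ge0.
Qed.

Lemma L2fM r u (B : R) : measurable_fun setT (r : borel M -> R) -> (forall p, `|r p| <= B) ->
  L2f u -> L2f (fun p => (r p)%:C%C *: u p).
Proof.
move=> mr rB Lu; split; first exact: msM Lu.1.
have := integrableZl measurableT (B ^+ 2) (integrable_rh_sqr Lu).
move=> /integrableP[mg]; apply: le_lt_trans.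
apply: normsq_le; [exact: msM Lu.1|exact: measurableT_comp|].
move=> p /=; rewrite lee_fin [leRHS]ger0_norm; last first.
  by apply: mulr_ge0; [exact: sqr_ge0|exact: rh_ge0].
rewrite rhZl rhZr mulrA -expr2 ler_wpM2r ?rh_ge0//.
exact: norm_le_sqr.
Qed.

Lemma L2fZ (c : R) u : L2f u -> L2f (fun p => c%:C%C *: u p).
Proof. by apply: (@L2fM (fun=> c) u `|c|). Qed.

Lemma L2fN u : L2f u -> L2f (fun p => - u p).
Proof.
move=> /(L2fZ (-1)); congr L2f; apply: section_ext => p.
by rewrite rmorphN scaleN1r.
Qed.

Lemma L2fB u v : L2f u -> L2f v -> L2f (fun p => u p - v p).
Proof. by move=> Lu Lv; apply: L2fD => //; exact: L2fN. Qed.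

Lemma rinC u v : rin u v = rin v u.
Proof. by rewrite /rin; congr Rintegral; apply/funext => p; rewrite rhC. Qed.

Lemma rinDl u v w : L2f u -> L2f v -> L2f w ->
  rin (fun p => u p + v p) w = rin u w + rin v w.
Proof.
move=> Lu Lv Lw; rewrite /rin -RintegralD//; [|exact: integrable_rh|exact: integrable_rh].
by congr Rintegral; apply/funext => p; rewrite rhDl.
Qed.

Lemma rinZl (c : R) u v : L2f u -> L2f v -> rin (fun p => c%:C%C *: u p) v = c * rin u v.
Proof.
move=> Lu Lv; rewrite /rin -RintegralZl//; last exact: integrable_rh.
by congr Rintegral; apply/funext => p; rewrite rhZl.
Qed.

Lemma rinNl u v : L2f u -> L2f v -> rin (fun p => - u p) v = - rin u v.
Proof.
move=> Lu Lv; rewrite -mulN1r -rinZl//; congr rin; apply: section_ext => p.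
by rewrite rmorphN scaleN1r.
Qed.

Lemma rinBl u v w : L2f u -> L2f v -> L2f w ->
  rin (fun p => u p - v p) w = rin u w - rin v w.
Proof. by move=> Lu Lv Lw; rewrite rinDl ?rinNl//; exact: L2fN. Qed.

Lemma rinBr u v w : L2f u -> L2f v -> L2f w ->
  rin w (fun p => u p - v p) = rin w u - rin w v.
Proof. by move=> Lu Lv Lw; rewrite rinC rinBl// ![rin w _]rinC. Qed.

Lemma nsq_ge0 u : 0 <= nsq u.
Proof. by apply: Rintegral_ge0 => p _; exact: rh_ge0. Qed.

Lemma rin_pointwise_le u v u' v' (c d : R) : L2f u -> L2f v -> L2f u' -> L2f v' ->
  forall w w', L2f w -> L2f w' ->
  (forall p, rh h (w p) (w' p) <= c * rh h (u p) (u' p) + d * rh h (v p) (v' p)) ->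
  rin w w' <= c * rin u u' + d * rin v v'.
Proof.
move=> Lu Lv Lu' Lv' w w' Lw Lw' H.
have i1 := integrable_rh Lu Lu'; have i2 := integrable_rh Lv Lv'.
have j1 := integrableZl measurableT c i1; have j2 := integrableZl measurableT d i2.
rewrite /rin -!RintegralZl// -RintegralD//.
apply: le_Rintegral => //; first exact: integrable_rh.
exact: (integrableD measurableT j1 j2).
Qed.

Lemma nsqD_le u v : L2f u -> L2f v -> nsq (fun p => u p + v p) <= 2 * nsq u + 2 * nsq v.
Proof.
move=> Lu Lv; apply: rin_pointwise_le => //; try exact: L2fD.
by move=> p; exact: rhD_le.
Qed.

Lemma nsqN u : nsq (fun p => - u p) = nsq u.
Proof. by congr Rintegral; apply/funext => p; rewrite rhNl rhNr opprK. Qed.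

Lemma nsqM_le r u (B : R) : measurable_fun setT (r : borel M -> R) -> (forall p, `|r p| <= B) ->
  L2f u -> nsq (fun p => (r p)%:C%C *: u p) <= B ^+ 2 * nsq u.
Proof.
move=> mr rB Lu; have L := L2fM mr rB Lu.
rewrite -[leRHS]addr0 -(mul0r (nsq u)); apply: rin_pointwise_le => // p.
rewrite mul0r addr0 rhZl rhZr mulrA -expr2 ler_wpM2r ?rh_ge0//.
exact: norm_le_sqr.
Qed.

Lemma rin_le u v (s : R) : 0 < s -> L2f u -> L2f v -> rin u v <= s * nsq u + s^-1 * nsq v.
Proof.
move=> s0 Lu Lv; apply: rin_pointwise_le => // p.
have := rh_le h (u p) (v p) s0; have := rh_ge0 h (s%:C%C *: u p).
rewrite rhZl rhZr => h1 h2.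
have p1 : 0 <= s * rh h (u p) (u p) by rewrite mulr_ge0 ?rh_ge0// ltW.
have p2 : 0 <= s^-1 * rh h (v p) (v p) by rewrite mulr_ge0 ?rh_ge0// invr_ge0 ltW.
lra.
Qed.

Lemma rin_ae u v w : ms u -> ms v -> ms w ->
  {ae mu, forall p : borel M, u p = v p} -> rin u w = rin v w.
Proof.
move=> mu_ mv mw uv; rewrite /rin /Rintegral; congr fine.
apply: ae_eq_integral => //; [exact: emeasurable_rh|exact: emeasurable_rh|].
by apply: filterS uv => p /= -> _.
Qed.

Lemma chart_ball (c : chart R M n) (p : M) : cdom c p ->
  exists2 d : R, 0 < d & [set x | `|x - cmap c p| <= d] `<=` cimg c.
Proof.
move=> cp; have /nbhs_ballP[d /= d0 dV] :=
  open_nbhs_nbhs (conj (@cimg_open _ _ _ c) (cmap_img cp)).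
exists (d / 2); first by rewrite divr_gt0.
move=> x /= xd; apply: dV; rewrite -ball_normE /ball_ /= distrC; apply: le_lt_trans xd _.
by rewrite ltr_pdivrMr// ltr_pMr// ltr1n.
Qed.

(** On a closed ball inside a chart image the density is bounded, by continuity, and the ball has
    finite Lebesgue measure. *)
Lemma locally_finite_measure (p : M) : exists P : set M, [/\ open P, P p & (mu P < +oo)%E].
Proof.
have [c cA cp] := charts_cover A p.
have [d d0 dV] := chart_ball cp.
have [ka [ska ka0 Hka]] := mu_smooth (is_chart_atlas cA).
set x0 := cmap c p in dV *.
pose U : set 'rV[R]_n := [set x | `|x - x0| < d].
have oU : open U.
  have -> : U = ball x0 d by apply/seteqP; split=> x; rewrite /U -ball_normE /ball_ /= distrC.
  exact: ball_open.
have UV : U `<=` cimg c by move=> x /= xd; apply: dV => /=; exact: ltW.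
exists (cdom c `&` cmap c @^-1` U); split.
- rewrite openE => q [cq Uq]; apply: filterI (open_nbhs_nbhs (conj (@cdom_open _ _ _ c) cq)) _.
  exact: cmap_continuous cq _ (open_nbhs_nbhs (conj oU Uq)).
- by split=> //; rewrite /preimage /U /= -/x0 subrr normr0.
have mU := open_measurable_borel oU.
rewrite Hka//; have [x /dV|B B0 HB] := bounded_on_compact (@norm_le_compact R n x0 d) (f := ka).
  exact: smooth_continuous ska.
rewrite (setIidr UV).
apply: (@le_lt_trans _ _ (\int[lebesgue_rV R n]_(x in U) (cst B%:E) x)%E).
  apply: ge0_le_integral => //.
  - by move=> x /UV/ka0/ltW; rewrite lee_fin.
  - apply/measurable_EFinP; apply: measurable_fun_continuous_onR => // x /UV Vx.
    exact: smooth_continuous ska Vx.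
  - by move=> x /= Ux; rewrite lee_fin (le_trans (ler_norm _))// HB//= ltW.
rewrite integral_cst// lte_mul_pinfty// ?lee_fin ?(ltW B0)//.
apply: le_lt_trans (@lebesgue_rV_ball_lty R n (d + `|x0|)).
apply: le_measure; rewrite ?inE//; first exact: measurable_norm_le.
move=> x /= xd; rewrite -[x in `|x|](subrK x0); apply: le_trans (ler_normD _ _) _.
by rewrite lerD2r ltW.
Qed.

Lemma compact_finite_measure (Q : set M) : compact Q -> (mu Q < +oo)%E.
Proof.
move=> cQ; have clQ : closed Q by exact: compact_closed.
have /choice[P HP] := locally_finite_measure.
have [p _|s [_ Qs]] := compact_finite_cover (P := P) cQ; first by have [] := HP p.
pose W (l : seq M) : set M := [set q | exists2 p, p \in l & P p q].
have fin l : measurable (W l : set (borel M)) /\ (mu (W l) < +oo)%E.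
  elim: l => [|p l [mW IH]].
    have -> : W [::] = set0 by apply/seteqP; split=> // q [].
    by rewrite measure0.
  have -> : W (p :: l) = P p `|` W l.
    apply/seteqP; split=> q.
      by move=> [p']; rewrite inE => /predU1P[->|p'l] Pq; [left|right; exists p'].
    by move=> [Pq|[p' p'l Pq]]; [exists p; rewrite ?mem_head|exists p'; rewrite ?inE ?p'l ?orbT].
  have [oP _ Poo] := HP p; have mP := open_measurable_borel oP.
  split; first exact: measurableU.
  by apply: le_lt_trans (measureU2 _ mP mW) _; rewrite lte_add_pinfty.
apply: le_lt_trans (fin s).2; apply: le_measure; rewrite ?inE//; last exact: (fin s).1.
by rewrite -[X in measurable X]setCK; apply: measurableC; apply: open_measurable_borel; exact: closed_openC.
Qed.

Lemma test_L2f u : test u -> L2f u.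
Proof.
move=> [su cQ]; have mu_ := smooth_ms su; split=> //.
set Q := closure _ in cQ.
have clQ : closed Q by exact: closed_closure.
have oT : open (setT : set M) by exact: openT.
have [s1 _] := h_smooth oT su su.
have cr (p : M) : {for p, continuous (fun p => rh h (u p) (u p))}.
  by apply: (smooth_on_continuous (A := A) oT s1).
have : compact ((fun p => rh h (u p) (u p)) @` Q).
  apply: continuous_compact => //; apply: continuous_in_subspaceT => p _; exact: cr.
move=> /compact_bounded[B0 [_ HB]].
pose B := `|B0| + 1.
have rB p : rh h (u p) (u p) <= B * (\1_Q p).
  have [Qp|nQ] := pselect (Q p).
    rewrite indicE mem_set// mulr1; apply: le_trans (ler_norm _) _.
    apply: (HB B); last by exists p.
    by rewrite (le_lt_trans (ler_norm B0))// ltrDl.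
  have -> : u p = 0 by apply: contrapT => up; apply: nQ; exact: subset_closure.
  by rewrite rh0l indicE memNset// mulr0.
have mQ : measurable (Q : set (borel M)).
  by rewrite -[X in measurable X]setCK; apply: measurableC; apply: open_measurable_borel; exact: closed_openC.
apply: (@le_lt_trans _ _ (\int[mu]_p (B%:E * (\1_(Q : set (borel M)) p)%:E))%E).
  apply: normsq_le; first by [].
    by apply: measurable_funeM; apply/measurable_EFinP; exact: measurable_indic.
  by move=> p; rewrite lee_fin; exact: rB.
have B1 : 0 <= B by rewrite addr_ge0.
rewrite ge0_integralZl_EFin//; last by apply/measurable_EFinP; exact: measurable_indic.
rewrite integral_indic// setIT lte_mul_pinfty ?lee_fin//; exact: compact_finite_measure.
Qed.

End L2_sections.

(** * Local regularization *)

Section supported_functions.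
Context {R : realType} {n : nat}.
Variable x0 : 'rV[R]_n.
Local Notation e j := (delta_mx ord0 j : 'rV[R]_n).
Implicit Types (f g c : 'rV[R]_n -> R) (rho : R).

(** The radius is a parameter because each average enlarges the support by [|eps|]. *)
Definition cs rho f : Prop := smooth setT f /\ forall x, rho < `|x - x0| -> f x = 0.

Lemma cs_cont rho f : cs rho f -> continuous f.
Proof. by move=> [sf _] x; exact: smooth_continuous sf I. Qed.

Lemma cs_ccont rho f : cs rho f -> ccont f.
Proof.
move=> cf; split; first exact: cs_cont cf.
exists (rho + `|x0|) => x xr; apply: cf.2; rewrite -(ltrD2r `|x0|); apply: lt_le_trans xr _.
by rewrite -[x in leLHS](subrK x0); exact: ler_normD.
Qed.

Lemma cs_le rho rho' f : rho <= rho' -> cs rho f -> cs rho' f.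
Proof. by move=> rr [sf f0]; split=> // x xr; apply: f0; exact: le_lt_trans xr. Qed.

Lemma cs_ext rho f g : (forall x, f x = g x) -> cs rho f -> cs rho g.
Proof. by move=> fg; rewrite (_ : f = g)//; exact/funext. Qed.

Lemma csD rho f g : cs rho f -> cs rho g -> cs rho (fun x => f x + g x).
Proof.
move=> [sf f0] [sg g0]; split; first by apply: smoothD => //; exact: openT.
by move=> x xr; rewrite f0// g0// addr0.
Qed.

Lemma csMl rho c f : smooth setT c -> cs rho f -> cs rho (fun x => c x * f x).
Proof.
move=> sc [sf f0]; split; first by apply: smoothM => //; exact: openT.
by move=> x xr; rewrite f0// mulr0.
Qed.

Lemma csZ rho (r : R) f : cs rho f -> cs rho (fun x => r * f x).
Proof. by apply: csMl; exact: smooth_cst. Qed.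

Lemma csB rho f g : cs rho f -> cs rho g -> cs rho (fun x => f x - g x).
Proof.
move=> cf cg; apply: cs_ext (csD cf (csZ (-1) cg)) => x; by rewrite mulN1r.
Qed.

Lemma cs0 rho : cs rho (fun=> 0).
Proof. by split=> //; exact: smooth_cst. Qed.

Lemma cs_sum rho (I : Type) (r : seq I) (P : pred I) (F : I -> 'rV[R]_n -> R) :
  (forall i, cs rho (F i)) -> cs rho (fun x => \sum_(i <- r | P i) F i x).
Proof.
move=> cF; elim: r => [|i r IH].
  by apply: cs_ext (cs0 rho) => x; rewrite big_nil.
case Pi : (P i).
  by apply: cs_ext (csD (cF i) IH) => x; rewrite big_cons Pi.
by apply: cs_ext IH => x; rewrite big_cons Pi.
Qed.

Lemma cs_derive rho f j : cs rho f -> cs rho ('D_(e j) f).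
Proof. by move=> [sf f0]; split; [exact: smooth_derive|exact: derive_csupp]. Qed.

Lemma cs_avg rho eps N f : cs rho f -> cs (rho + `|eps|) (avg eps N f).
Proof. by move=> [sf f0]; split; [exact: avg_smooth|exact: avg_supp]. Qed.

Lemma cs_bounded rho f : cs rho f -> exists2 B, 0 < B & forall x, `|f x| <= B.
Proof. by move=> [sf f0]; exact: bounded_csupp sf f0. Qed.

Lemma cs_lipschitz rho f : cs rho f ->
  exists2 L, 0 < L & forall x h, `|f (x + h) - f x| <= L * `|h|.
Proof. by move=> [sf f0]; exact: lipschitz_csupp sf f0. Qed.

Lemma cs_derivable rho f x j : cs rho f -> derivable f x (e j).
Proof. by move=> [sf _]; exact: smooth_derivable sf I. Qed.

(** The values of [f] outside [V] are arbitrary; there [c] vanishes, its support ball being inside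
    [V]. *)
Lemma cs_cutoff rho (V : set 'rV[R]_n) c f : open V ->
  [set x | `|x - x0| <= rho] `<=` V -> cs rho c -> smooth V f ->
  cs rho (fun x => c x * f x).
Proof.
move=> oV rV [sc c0] sf; split; last by move=> x xr; rewrite c0// mul0r.
apply: (@smooth_ext _ _ _ (zero_extend V (fun x => c x * f x))); first exact: openT.
  move=> x _; rewrite /zero_extend; case: ifPn => // /negP nVx.
  rewrite c0 ?mul0r// ltNge; apply/negP => xr; apply: nVx; apply/mem_set; exact: rV.
apply: (@smooth_zero_extend _ _ V [set x | `|x - x0| <= rho]) => //.
- exact: norm_le_closed.
- by move=> x _ /negP; rewrite -ltNge => xr; rewrite c0// mul0r.
- by apply: smoothM => //; apply: smooth_sub sc.
Qed.

Lemma cs_bump rho : 0 < rho -> exists b, [/\ cs (2 * rho) b, forall x, 0 <= b x <= 1 &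
  forall x, `|x - x0| <= rho -> b x = 1].
Proof.
move=> r0; have [b [sb b01 b1 b0]] := bump_exists x0 r0.
by exists b; split=> //; split=> // x /ltW; exact: b0.
Qed.

Lemma csM_derive rho c f x j : cs rho f -> smooth setT c ->
  'D_(e j) (fun x => c x * f x) x = c x * 'D_(e j) f x + f x * 'D_(e j) c x.
Proof.
move=> cf sc; have := @deriveM R _ c f x (e j) (smooth_derivable sc I) (cs_derivable cf).
by [].
Qed.

Lemma cs_derive_sum rho (I : finType) (F : I -> 'rV[R]_n -> R) x j :
  (forall i, cs rho (F i)) ->
  'D_(e j) (fun x => \sum_i F i x) x = \sum_i 'D_(e j) (F i) x.
Proof.
move=> cF; have [|_ ->//] := @is_derive_bigsum R n I (index_enum I) xpredT F x (e j)
  (fun i => 'D_(e j) (F i) x) _.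
by move=> i _; apply: DeriveDef => //; exact: cs_derivable (cF i).
Qed.

Lemma csB_derive rho f g x j : cs rho f -> cs rho g ->
  'D_(e j) (fun x => f x - g x) x = 'D_(e j) f x - 'D_(e j) g x.
Proof.
move=> cf cg; have := @deriveB R _ _ f g x (e j) (cs_derivable cf) (cs_derivable cg).
by [].
Qed.

Definition isq f : R := Int (fun x => f x ^+ 2).

Lemma isq_ge0 f : 0 <= isq f.
Proof. by apply: Int_ge0 => x; exact: sqr_ge0. Qed.

Lemma isq_ext f g : (forall x, f x = g x) -> isq f = isq g.
Proof. by move=> fg; rewrite /isq; congr Int; apply/funext => x; rewrite fg. Qed.

Lemma isq_sum (I : finType) (F : I -> 'rV[R]_n -> R) : (forall i, ccont (F i)) ->
  isq (fun x => \sum_i F i x) <= #|I|%:R * \sum_i isq (F i).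
Proof.
move=> cF; have cF2 i : ccont (fun x => F i x ^+ 2) by exact: ccont_sqr.
rewrite /isq -Int_sum// -IntZ; last exact: ccont_sum.
apply: Int_le; first by apply: ccont_sqr; exact: ccont_sum.
  by apply: ccontZ; exact: ccont_sum.
by move=> x; have := sqr_sum_le xpredT (fun i => F i x).
Qed.

Lemma isqD f g : ccont f -> ccont g -> isq (fun x => f x + g x) <= 2 * isq f + 2 * isq g.
Proof.
move=> cf cg; have c1 := ccont_sqr cf; have c2 := ccont_sqr cg.
rewrite /isq -!IntZ// -IntD; [|exact: ccontZ|exact: ccontZ].
apply: Int_le; [by apply: ccont_sqr; exact: ccontD|by apply: ccontD; exact: ccontZ|].
by move=> x; exact: sqrD_le.
Qed.

Lemma isqN f : isq (fun x => - f x) = isq f.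
Proof. by rewrite /isq; congr Int; apply/funext => x; rewrite sqrrN. Qed.

Lemma isqM c f B : continuous c -> ccont f -> (forall x, `|c x| <= B) ->
  isq (fun x => c x * f x) <= B ^+ 2 * isq f.
Proof.
move=> cc cf cB; have c1 := ccont_sqr cf.
rewrite /isq -IntZ//; apply: Int_le; [by apply: ccont_sqr; exact: ccontM|exact: ccontZ|].
by move=> x; rewrite exprMn ler_wpM2r ?sqr_ge0//; exact: norm_le_sqr.
Qed.

Lemma isq_avg eps N f : ccont f -> isq (avg eps N f) <= isq f.
Proof. exact: Int_avg_sqr. Qed.

Lemma isq_small f theta B : ccont f -> ccont theta -> (forall x, 0 <= theta x) ->
  (forall x, f x != 0 -> 1 <= theta x) -> (forall x, `|f x| <= B) ->
  isq f <= B ^+ 2 * Int theta.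
Proof.
move=> cf ct t0 ft fB; rewrite /isq -IntZ//; apply: Int_le; [exact: ccont_sqr|exact: ccontZ|].
move=> x; have [->|/ft tx] := eqVneq (f x) 0.
  by rewrite expr0n /= mulr_ge0 ?sqr_ge0.
apply: (@le_trans _ _ (B ^+ 2)); first exact: norm_le_sqr.
by rewrite ler_peMr ?sqr_ge0.
Qed.

End supported_functions.

(** * Equivalence of the norm of sections with the norm of their coordinates *)

Section frame_analysis.
Context {R : realType} {M : ptopologicalType} {n k : nat} {A : smooth_atlas R M n}.
Context {E : M -> lmodType R[i]} {S : vector_bundle A k E}.
Variables (h : hermitian_structure E) (mu : {measure set (borel M) -> \bar R}).
Hypothesis M_hausdorff : hausdorff_space M.
Hypothesis h_smooth : smooth_hermitian S h.
Variables (F : frame S) (x0 : 'rV[R]_n) (r : R).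
(** Room for the supports: cutoffs live in radius [r], one average reaches [2 * r], a second one
    [3 * r], and the coefficients of [D] are cut off between [2 * r] and [4 * r]. *)
Hypothesis ball_sub : [set x | `|x - x0| <= 4 * r] `<=` cimg (fch F).
Local Notation c := (fch F).
Local Notation V := (cimg (fch F)).
Local Notation K := (k + k)%N.
Local Notation test := (compactly_supported_smooth S).
Implicit Types (y z : 'I_K -> 'rV[R]_n -> R) (u v : section E).

Definition pl y : section E := pull F (fun x => \col_a y a x).

Lemma ball_sub_le rho : rho <= 4 * r -> [set x | `|x - x0| <= rho] `<=` V.
Proof. by move=> rr x /= xr; apply: ball_sub; exact: le_trans rr. Qed.

Lemma openV : open V. Proof. exact: cimg_open. Qed.

Lemma smooth_onV (f : 'rV[R]_n -> R) : smooth setT f -> smooth V f.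
Proof. exact: smooth_sub. Qed.

Lemma pl_test rho y : rho <= 4 * r -> (forall a, cs x0 rho (y a)) -> test (pl y).
Proof.
move=> rr cy; apply: (pull_test M_hausdorff (ball_sub_le rr)).
  move=> a; apply: smooth_onV; have [sy _] := cy a.
  by apply: smooth_ext sy => [|x _]; [exact: openT|rewrite mxE].
by move=> x xr; apply/colP => a; rewrite !mxE (cy a).2.
Qed.

Lemma lc_pl y x a : V x -> lc F (pl y) x a ord0 = y a x.
Proof. by move=> Vx; rewrite lc_pull// mxE. Qed.

Lemma pl_out y p : ~ cdom c p -> pl y p = 0.
Proof. exact: pull_out. Qed.

Lemma frame_section_eq u v : (forall x, V x -> lc F u x = lc F v x) ->
  (forall p, ~ cdom c p -> u p = v p) -> u = v.
Proof.
move=> H1 H2; apply: section_ext => p; have [cp|/H2//] := pselect (cdom c p).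
rewrite -(pull_lc (y := lc F u) (F := F) (u := u) cp)//.
by apply: pull_lc => //; apply: H1; exact: cmap_img.
Qed.

Lemma pl_ext y z : (forall a x, V x -> y a x = z a x) -> pl y = pl z.
Proof.
move=> yz; apply: frame_section_eq => [x Vx|p np]; last by rewrite !pl_out.
by apply/colP => a; rewrite !lc_pl// yz.
Qed.

Lemma plB y z : (fun p => pl y p - pl z p) = pl (fun a x => y a x - z a x).
Proof.
apply: frame_section_eq => [x Vx|p np]; last by rewrite !pl_out// subr0.
have -> : (fun p => pl y p - pl z p) = (fun p => pl y p + (-1)%:C%C *: pl z p).
  by apply: section_ext => p; rewrite rmorphN scaleN1r.
rewrite lcD// (@lcZ _ _ _ _ _ _ _ F (fun=> -1) (pl z) x Vx); apply/colP => a.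
by rewrite mxE [X in _ + X = _]mxE !lc_pl// mulN1r.
Qed.

Definition pullR (f : 'rV[R]_n -> R) (p : M) : R := if p \in cdom c then f (cmap c p) else 0.

Lemma pullR_smooth rho f : rho <= 4 * r -> cs x0 rho f -> smooth_on A setT (pullR f).
Proof.
move=> rr [sf f0]; apply: smooth_on_local => p _; have [cp|ncp] := pselect (cdom c p).
  exists (cdom c); split=> //; first exact: cdom_open.
  apply: smooth_on_ext (smooth_on_chart (fch_ok F) (smooth_onV sf)); first exact: cdom_open.
  by move=> q cq; rewrite /pullR mem_set.
pose Q := cinv c @` [set x | `|x - x0| <= rho].
have cQ : compact Q by exact: (compact_chart_image (ball_sub_le rr)).
have clQ : closed Q by exact: compact_closed.
exists (~` Q); split; first exact: closed_openC.
  by move=> [x /(ball_sub_le rr) Vx xp]; apply: ncp; rewrite -xp; exact: cinv_dom.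
apply: smooth_on_ext (@smooth_on_cst R M n A (~` Q) 0); first exact: closed_openC.
move=> q nQ; rewrite /pullR; case: ifPn => // /set_mem cq; rewrite f0//.
rewrite ltNge; apply/negP => h1; apply: nQ; exists (cmap c q) => //; exact: cmapK.
Qed.

Lemma smooth_on_measurable (f : M -> R) : smooth_on A setT f ->
  measurable_fun setT (f : borel M -> R).
Proof.
move=> sf; apply: measurable_fun_continuous_onR; first exact: openT.
by move=> p _; apply: (smooth_on_continuous _ sf) => //; exact: openT.
Qed.

Lemma pl_cutoff f u : (forall x, ~ V x -> f x = 0) ->
  pl (fun a x => f x * lc F u x a ord0) = (fun p => (pullR f p)%:C%C *: u p).
Proof.
move=> f0; apply: frame_section_eq => [x Vx|p np]; last first.
  by rewrite pl_out// /pullR memNset// scale0r.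
rewrite lcZ//; apply/colP => a; rewrite lc_pl// [RHS]mxE /pullR mem_set; last exact: cinv_dom.
by rewrite cinvK.
Qed.

Variable ka : 'rV[R]_n -> R.
Hypothesis hka : is_density mu c ka.

Definition pairing y u (x : 'rV[R]_n) : R :=
  ka x * \sum_a \sum_b y a x * (gram F h x a b * lc F u x b ord0).

Lemma pairing_cs rho y u : rho <= 4 * r -> (forall a, cs x0 rho (y a)) ->
  smooth_section S u -> cs x0 rho (pairing y u).
Proof.
move=> rr cy su; have [ska _ _] := hka.
have : cs x0 rho (fun x => (\sum_a \sum_b y a x * (gram F h x a b * lc F u x b ord0)) * ka x).
  apply: (cs_cutoff openV (ball_sub_le rr) _ ska).
  apply: cs_sum => a; apply: cs_sum => b; apply: (cs_cutoff openV (ball_sub_le rr) (cy a)).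
  by apply: smoothM; [exact: openV|exact: gram_smooth|exact: lc_smooth].
by apply: cs_ext => x; rewrite mulrC.
Qed.

Lemma rin_pl rho y u : rho <= 4 * r -> (forall a, cs x0 rho (y a)) ->
  smooth_section S u -> rin h mu (pl y) u = Int (pairing y u).
Proof.
move=> rr cy su.
pose G x := \sum_a \sum_b y a x * (gram F h x a b * lc F u x b ord0).
have cG : cs x0 rho G.
  apply: cs_sum => a; apply: cs_sum => b; apply: (cs_cutoff openV (ball_sub_le rr) (cy a)).
  by apply: smoothM; [exact: openV|exact: gram_smooth|exact: lc_smooth].
have := chart_Rintegral hka (cs_cont cG); rewrite /rin => E0.
transitivity (Rintegral mu setT (fun p : borel M => if p \in cdom c then G (cmap c p) else 0)).
  congr Rintegral; apply/funext => p; case: ifPn => [/set_mem cp|/negP np].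
    have Vx := cmap_img cp; have := @rh_gram _ _ _ _ _ _ _ F h (pl y) u _ Vx.
    rewrite cmapK// => ->; apply: eq_bigr => a _; apply: eq_bigr => b _.
    by rewrite !lc_pl// mulrA.
  by rewrite pl_out ?rh0l// => cp; apply: np; exact: mem_set.
rewrite E0; congr Int; apply/funext => x; rewrite /zero_extend /pairing -/(G x).
case: ifPn => // /negP nVx; rewrite cG.2 ?mulr0// ltNge; apply/negP => xr.
by apply: nVx; apply/mem_set; exact: (ball_sub_le rr).
Qed.

Lemma smooth_bounded_ball (f : 'rV[R]_n -> R) : smooth V f ->
  exists2 B, 0 < B & forall x, `|x - x0| <= 4 * r -> `|f x| <= B.
Proof.
move=> sf; apply: (bounded_on_compact (@norm_le_compact R n x0 (4 * r))).
by move=> x /ball_sub Vx; exact: smooth_continuous sf Vx.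
Qed.

(** The density times the Gram coefficients is bounded on the compact ball that contains all
    supports. In the constant, [2 * K] comes from summing [y a ^ 2 + y b ^ 2], which dominates
    [|y a * y b|], over all pairs. *)
Lemma nsq_pl_le : exists2 C, 0 <= C & forall y, (forall a, cs x0 (4 * r) (y a)) ->
  nsq h mu (pl y) <= C * \sum_a isq (y a).
Proof.
have [ska ka0 _] := hka.
have /choice[B HB] : forall ab : 'I_K * 'I_K, exists B : R,
    0 < B /\ forall x, `|x - x0| <= 4 * r -> `|ka x * gram F h x ab.1 ab.2| <= B.
  move=> [a b]; have [|B B0 HB] := @smooth_bounded_ball (fun x => ka x * gram F h x a b).
    by apply: smoothM; [exact: openV| |exact: gram_smooth].
  by exists B.
pose B1 := \sum_ab B ab.
have B10 : 0 <= B1 by apply: sumr_ge0 => ab _; rewrite ltW// (HB ab).1.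
exists (B1 * (2 * K%:R)); first by rewrite !mulr_ge0.
move=> y cy; have cc a := cs_ccont (cy a); have cc2 a := ccont_sqr (cc a).
have sy := (pl_test (lexx _) cy).1.
rewrite /nsq (rin_pl (lexx _) cy sy).
have -> : B1 * (2 * K%:R) * (\sum_a isq (y a)) =
    Int (fun x => (B1 * (2 * K%:R)) * \sum_a y a x ^+ 2).
  by rewrite IntZ ?Int_sum//; exact: ccont_sum.
apply: Int_le.
- exact: (cs_ccont (pairing_cs (lexx _) cy sy)).
- by apply: ccontZ; exact: ccont_sum.
move=> x; rewrite /pairing.
have [xr|xr] := leP `|x - x0| (4 * r); last first.
  rewrite big1 => [|a _]; last by rewrite big1// => b _; rewrite (cy a).2// mul0r.
  rewrite mulr0; apply: mulr_ge0; first by rewrite !mulr_ge0.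
  by apply: sumr_ge0 => a _; exact: sqr_ge0.
have Vx := ball_sub xr.
rewrite [leLHS]mulr_sumr; apply: (@le_trans _ _ (\sum_a \sum_b B1 * (y a x ^+ 2 + y b x ^+ 2))).
  apply: ler_sum => a _; rewrite [leLHS]mulr_sumr; apply: ler_sum => b _.
  rewrite lc_pl//; set g := gram _ _ _ _ _.
  have -> : ka x * (y a x * (g * y b x)) = (ka x * g) * (y a x * y b x) by ring.
  apply: le_trans (ler_norm _) _; rewrite normrM ler_pM//.
    apply: le_trans ((HB (a, b)).2 x xr) _; rewrite /B1 (bigD1 (a, b))//= lerDl.
    by apply: sumr_ge0 => ab _; rewrite ltW// (HB ab).1.
  rewrite ler_norml; have := sqr_ge0 (y a x + y b x); have := sqr_ge0 (y a x - y b x).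
  have := sqr_ge0 (y a x); have := sqr_ge0 (y b x).
  rewrite !expr2 => h1 h2 h3 h4; apply/andP; split; nra.
rewrite le_eqVlt; apply/orP; left; apply/eqP.
under eq_bigr => a _ do rewrite -mulr_sumr big_split/= sumr_const card_ord -mulr_natl.
rewrite -mulr_sumr -mulrA; congr (_ * _); rewrite big_split/= sumr_const card_ord -mulr_natl.
rewrite -mulr_sumr; ring.
Qed.

(** The converse of [nsq_pl_le]: [coord_le_rh] applies pointwise, and on the ball both [1 / ka] and
    the diagonal of the inverse Gram matrix are bounded. *)
Lemma isq_le_nsq_pl : exists2 C, 0 <= C & forall y, (forall a, cs x0 (4 * r) (y a)) ->
  forall a, isq (y a) <= C * nsq h mu (pl y).
Proof.
have [ska ka0 _] := hka.
have /choice[B HB] : forall a : 'I_K, exists B : R,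
    0 < B /\ forall x, `|x - x0| <= 4 * r -> `|invmx (gram F h x) a a| <= B.
  move=> a; have [|B B0 HB] := @smooth_bounded_ball (fun x => invmx (gram F h x) a a).
    apply: smooth_invmx; first exact: openV.
      by move=> a' b'; exact: gram_smooth.
    by move=> x Vx; exact: gram_unit.
  by exists B.
have [|Bk Bk0 HBk] := @smooth_bounded_ball (fun x => (ka x)^-1).
  by apply: smoothV; [exact: openV|move=> x /ka0/gt_eqF/negbT|].
pose B1 := \sum_a B a + 1.
have B11 : 1 <= B1 by rewrite lerDr; apply: sumr_ge0 => a _; rewrite ltW// (HB a).1.
have B10 : 0 <= B1 by exact: le_trans B11.
exists (Bk * B1); first by rewrite mulr_ge0// ltW.
move=> y cy a; have sy := (pl_test (lexx _) cy).1.
rewrite /nsq (rin_pl (lexx _) cy sy) /isq.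
have cp := cs_ccont (pairing_cs (lexx _) cy sy).
rewrite -IntZ//; apply: Int_le; [by apply: ccont_sqr; exact: cs_ccont (cy a)|exact: ccontZ|].
move=> x; have [xr|xr] := leP `|x - x0| (4 * r); last first.
  rewrite (cy a).2// expr0n /= /pairing big1 ?mulr0// => a' _.
  by rewrite big1// => b' _; rewrite (cy a').2// mul0r.
have Vx := ball_sub xr; have kx := ka0 x Vx.
have H := @coord_le_rh _ _ _ _ _ _ _ F h (pl y) x a B1 Vx B11 _.
have iB : invmx (gram F h x) a a <= B1.
  apply: le_trans (ler_norm _) _; apply: le_trans ((HB a).2 x xr) _.
  rewrite /B1 (bigD1 a)//= -addrA lerDl addr_ge0//.
  by apply: sumr_ge0 => a' _; rewrite ltW// (HB a').1.
move: (H iB); rewrite lc_pl// rh_gram// => H2.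
set Q := \sum_a0 _ in H2; have -> : pairing y (pl y) x = ka x * Q.
  rewrite /pairing /Q; congr (_ * _); apply: eq_bigr => a' _; apply: eq_bigr => b' _.
  by rewrite !lc_pl// mulrA.
have Q0 : 0 <= Q.
  have := rh_ge0 h (pl y (cinv c x)); rewrite rh_gram//.
apply: le_trans H2 _; rewrite [leRHS](_ : _ = (Bk * ka x) * (B1 * Q)); last by ring.
rewrite ler_peMl ?mulr_ge0//; rewrite -ler_pdivrMr// mul1r.
exact: le_trans (ler_norm _) (HBk x xr).
Qed.

End frame_analysis.

Section uniform_constants.
Context {R : realType}.

(** The sum of the individual constants, increased by 1, dominates each of them. *)
Lemma uniform_constant (I : finType) (P : I -> R -> Prop) :
  (forall i B B', P i B -> B <= B' -> P i B') -> (forall i, exists2 B : R, 0 < B & P i B) ->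
  exists2 B : R, 0 < B & forall i, P i B.
Proof.
move=> mono ex.
have /choice[B HB] : forall i, exists B, 0 < B /\ P i B.
  by move=> i; have [B B0 PB] := ex i; exists B.
exists (1 + \sum_i B i); first by rewrite ltr_pwDl// sumr_ge0// => i _; exact/ltW/(HB i).1.
move=> i; apply: mono (HB i).2 _; rewrite (bigD1 i)//= addrCA lerDl addr_ge0//.
by apply: sumr_ge0 => j _; exact/ltW/(HB j).1.
Qed.

Lemma mesh_small (eps c eta : R) : 0 <= c -> 0 < eta ->
  exists N0, forall N, (N0 <= N)%N -> c * `|mesh eps N| ^+ 2 <= eta.
Proof.
move=> c0 eta0; exists (Num.truncn (c * eps ^+ 2 / eta)) => N NN.
have N1 : 0 < N.+1%:R :> R by [].
have hN : c * eps ^+ 2 <= eta * N.+1%:R.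
  rewrite [leRHS]mulrC -ler_pdivrMr//; apply/ltW; apply: (lt_le_trans (truncnS_gt (c * eps ^+ 2 / eta))).
  by rewrite ler_nat ltnS.
rewrite /mesh real_normK ?num_real// expr_div_n mulrA ler_pdivrMr ?exprn_gt0//.
apply: le_trans hN _; rewrite ler_pM2l// expr2 ler_peMr//.
by rewrite ler1n.
Qed.

End uniform_constants.

(** * Averages and first-order operators in coordinates *)

Section coordinate_operator.
Context {R : realType} {n K : nat}.
Variable (x0 : 'rV[R]_n) (r : R).
Hypothesis r0 : 0 < r.
Local Notation e j := (delta_mx ord0 j : 'rV[R]_n).
Local Notation fn := ('rV[R]_n -> R).
Implicit Types (y w : 'I_K -> fn) (f : fn).

Lemma isq_lincomb (I : finType) (c f : I -> fn) (B : R) :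
  (forall i, continuous (c i)) -> (forall i x, `|c i x| <= B) -> (forall i, ccont (f i)) ->
  isq (fun x => \sum_i c i x * f i x) <= #|I|%:R * (B ^+ 2 * \sum_i isq (f i)).
Proof.
move=> cc cB cf; apply: le_trans (isq_sum _) _ => [i|]; first exact: ccontM.
rewrite ler_wpM2l// mulr_sumr; apply: ler_sum => i _; exact: isqM.
Qed.

Lemma cs_bounded_fin rho (I : finType) (f : I -> fn) : (forall i, cs x0 rho (f i)) ->
  exists2 B : R, 0 < B & forall i x, `|f i x| <= B.
Proof.
move=> cf; apply: uniform_constant => [i B B' h BB x|i]; first exact: le_trans (h x) BB.
exact: cs_bounded (cf i).
Qed.

Lemma cs_lipschitz_fin rho (I : finType) (f : I -> fn) : (forall i, cs x0 rho (f i)) ->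
  exists2 B : R, 0 < B & forall i x h, `|f i (x + h) - f i x| <= B * `|h|.
Proof.
move=> cf; apply: uniform_constant => [i B B' h BB x z|i].
  by apply: le_trans (h x z) _; rewrite ler_wpM2r.
exact: cs_lipschitz (cf i).
Qed.

Lemma cs_difference_quotient_fin rho (I : finType) (f : I -> fn) (j : I -> 'I_n) :
  (forall i, cs x0 rho (f i)) ->
  exists2 L : R, 0 < L &
    forall i x t, `|f i (x + t *: e (j i)) - f i x - t * 'D_(e (j i)) (f i) x| <= L * t ^+ 2.
Proof.
move=> cf; apply: uniform_constant => [i B B' h BB x t|i].
  by apply: le_trans (h x t) _; rewrite ler_wpM2r// sqr_ge0.
exact: difference_quotient (cf i).1 (cf i).2.
Qed.

Variables (al : 'I_n -> 'I_K -> 'I_K -> fn) (be : 'I_K -> 'I_K -> fn).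
Hypothesis cs_al : forall j a b, cs x0 (4 * r) (al j a b).
Hypothesis cs_be : forall a b, cs x0 (4 * r) (be a b).

Definition opc y (a : 'I_K) : fn := fun x =>
  \sum_(p : 'I_n * 'I_K) al p.1 a p.2 x * 'D_(e p.1) (y p.2) x + \sum_b be a b x * y b x.

Lemma opc_cs rho y a : (forall b, cs x0 rho (y b)) -> cs x0 rho (opc y a).
Proof.
move=> cy; apply: csD; apply: cs_sum => p; apply: csMl => //.
- by have [] := cs_al p.1 a p.2.
- exact: cs_derive.
- by have [] := cs_be a p.
Qed.

Lemma opcB rho y w a x : (forall b, cs x0 rho (y b)) -> (forall b, cs x0 rho (w b)) ->
  opc (fun b x => y b x - w b x) a x = opc y a x - opc w a x.
Proof.
move=> cy cw; rewrite /opc opprD addrACA -!sumrB; congr (_ + _); apply: eq_bigr => p _.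
  by rewrite -mulrBr (csB_derive _ _ (cy _) (cw _)).
by rewrite mulrBr.
Qed.

Lemma coefficients_bounded : exists2 B : R, 0 < B &
  (forall j a b x, `|al j a b x| <= B) /\ (forall a b x, `|be a b x| <= B).
Proof.
have [B B0 HB] := cs_bounded_fin (fun p : 'I_n * 'I_K * 'I_K => cs_al p.1.1 p.1.2 p.2).
have [B' B'0 HB'] := cs_bounded_fin (fun p : 'I_K * 'I_K => cs_be p.1 p.2).
exists (B + B'); first exact: addr_gt0.
split=> [j a b x|a b x].
  by apply: le_trans (HB (j, a, b) x) _; rewrite lerDl ltW.
by apply: le_trans (HB' (a, b) x) _; rewrite lerDr ltW.
Qed.

Lemma isq_opc_le : exists2 C : R, 0 <= C & forall rho y a, (forall b, cs x0 rho (y b)) ->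
  isq (opc y a) <=
  C * (\sum_(p : 'I_n * 'I_K) isq ('D_(e p.1) (y p.2)) + \sum_b isq (y b)).
Proof.
have [B B0 [alB beB]] := coefficients_bounded.
pose m1 : R := #|{: 'I_n * 'I_K}|%:R; pose m2 : R := #|'I_K|%:R.
have m10 : 0 <= m1 by exact: ler0n.
have m20 : 0 <= m2 by exact: ler0n.
have B2 : 0 <= B ^+ 2 by exact: sqr_ge0.
exists (2 * B ^+ 2 * (m1 + m2)); first by apply: mulr_ge0; [exact: mulr_ge0|exact: addr_ge0].
move=> rho y a cy.
have cDy (p : 'I_n * 'I_K) : cs x0 rho ('D_(e p.1) (y p.2)) by exact: cs_derive.
have cy' b := cs_ccont (cy b).
apply: le_trans (isqD _ _) _.
- apply: ccont_sum => p; apply: ccontM; [exact: cs_cont (cs_al _ _ _)|exact: cs_ccont (cDy p)].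
- by apply: ccont_sum => p; apply: ccontM => //; exact: cs_cont (cs_be _ _).
have S1 : 0 <= \sum_(p : 'I_n * 'I_K) isq ('D_(e p.1) (y p.2)).
  by apply: sumr_ge0 => p _; exact: isq_ge0.
have S2 : 0 <= \sum_b isq (y b) by apply: sumr_ge0 => p _; exact: isq_ge0.
have h1 := @isq_lincomb _ (fun p : 'I_n * 'I_K => al p.1 a p.2)
  (fun p => 'D_(e p.1) (y p.2)) B (fun p => cs_cont (cs_al _ _ _)) (fun p => alB _ _ _)
  (fun p => cs_ccont (cDy p)).
have h2 := @isq_lincomb _ (be a) y B (fun p => cs_cont (cs_be _ _)) (beB a) cy'.
apply: le_trans (lerD (ler_wpM2l _ h1) (ler_wpM2l _ h2)) _ => //.
rewrite -/m1 -/m2; set s1 := \sum_p _ in S1 *; set s2 := \sum_b _ in S2 *.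
have P1 : 0 <= B ^+ 2 * m2 * s1 by apply: mulr_ge0 => //; exact: mulr_ge0.
have P2 : 0 <= B ^+ 2 * m1 * s2 by apply: mulr_ge0 => //; exact: mulr_ge0.
rewrite -subr_ge0 [leRHS](_ : _ = 2 * (B ^+ 2 * m2 * s1) + 2 * (B ^+ 2 * m1 * s2)); last by ring.
by rewrite addr_ge0// mulr_ge0.
Qed.

(** The difference is of order [eps] pointwise, by a Lipschitz bound, and vanishes outside a ball
    independent of [eps]. *)
Lemma small_difference rho (f : fn) : cs x0 rho f -> 0 < rho -> forall eta : R, 0 < eta ->
  exists2 delta : R, 0 < delta & forall eps N, `|eps| <= delta -> `|eps| <= rho ->
    isq (fun x => avg eps N f x - f x) <= eta.
Proof.
move=> cf rho0 eta eta0; have [L L0 HL] := cs_lipschitz cf.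
have [|th [cth th01 th1]] := @cs_bump R n x0 (2 * rho); first by rewrite mulr_gt0.
have I0 : 0 <= Int th by apply: Int_ge0 => x; have /andP[] := th01 x.
(* The minimum with 1 allows [eps ^ 2] to be bounded by [|eps|]. *)
exists (Num.min 1 (eta / (L ^+ 2 * (Int th + 1)))).
  by rewrite lt_min ltr01/= divr_gt0// mulr_gt0// ?exprn_gt0// ltr_wpDl.
move=> eps N; rewrite le_min => /andP[e1 e2] er.
have cA : cs x0 (2 * rho) (fun x => avg eps N f x - f x).
  apply: csB; last by apply: cs_le cf; rewrite ler_peMl ?ler1n ?ltW.
  by apply: cs_le (cs_avg eps N cf); rewrite mulr_natl mulr2n lerD2l.
apply: le_trans (isq_small (theta := th) (B := L * `|eps|) _ _ _ _ _) _.
- exact: cs_ccont cA.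
- exact: cs_ccont cth.
- by move=> x; have /andP[] := th01 x.
- move=> x fx; rewrite th1// leNgt; apply/negP => xr; move/negP: fx; apply.
  by apply/eqP; exact: cA.2.
- by move=> x; apply: avg_near => //; exact: ltW.
rewrite exprMn mulrAC; apply: (@le_trans _ _ (L ^+ 2 * (Int th + 1) * `|eps|)).
  apply: ler_pM; [by apply: mulr_ge0 => //; exact: sqr_ge0|exact: sqr_ge0| |].
    by apply: ler_wpM2l; [exact: sqr_ge0|rewrite lerDl].
  by rewrite expr2 ler_piMl.
have D0 : 0 < L ^+ 2 * (Int th + 1) by rewrite mulr_gt0 ?exprn_gt0// ltr_wpDl.
by rewrite mulrC -ler_pdivlMr.
Qed.

(** Averages commute with partial derivatives, so the second claim reduces, through [isq_opc_le], to
    [small_difference] for [w] and its first derivatives. *)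
Lemma opc_approx rho w (eta : R) : 0 < rho -> (forall b, cs x0 rho (w b)) -> 0 < eta ->
  exists2 delta : R, 0 < delta & forall eps N, `|eps| <= delta -> `|eps| <= rho ->
    (forall a, isq (fun x => avg eps N (w a) x - w a x) <= eta) /\
    (forall a, isq (fun x => opc (fun b => avg eps N (w b)) a x - opc w a x) <= eta).
Proof.
move=> rho0 cw eta0; have [C C0 HC] := isq_opc_le.
pose m1 : R := #|{: 'I_n * 'I_K}|%:R; pose m2 : R := #|'I_K|%:R.
have m10 : 0 <= m1 by exact: ler0n.
have m20 : 0 <= m2 by exact: ler0n.
have Cm0 : 0 <= C * (m1 + m2) by apply: mulr_ge0 => //; exact: addr_ge0.
pose eta' := eta / (C * (m1 + m2) + 1).
have eta'0 : 0 < eta' by rewrite divr_gt0// ltr_wpDl.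
have eta'1 : eta' <= eta by rewrite ler_pdivrMr ?ltr_wpDl// ler_peMr ?(ltW eta0)// lerDr.
(* The threshold is written [B^-1] to make the property monotone in [B], as [uniform_constant]
   requires. *)
pose P (f : fn) (B : R) := forall eps N, `|eps| <= B^-1 -> `|eps| <= rho ->
  isq (fun x => avg eps N f x - f x) <= eta'.
have Pm f B B' : P f B /\ 0 < B -> B <= B' -> P f B' /\ 0 < B'.
  move=> [PB B0] BB; have B'0 := lt_le_trans B0 BB; split=> // eps N h1 h2; apply: PB => //.
  by apply: le_trans h1 _; rewrite lef_pV2.
have Pe f : cs x0 rho f -> exists2 B, 0 < B & P f B /\ 0 < B.
  move=> cf; have [d d0 Hd] := small_difference cf rho0 eta'0.
  exists d^-1; rewrite invr_gt0//; split=> // eps N; rewrite invrK; exact: Hd.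
have [B B0 HB] := uniform_constant (fun b => @Pm (w b)) (fun b => Pe _ (cw b)).
have [B' B'0 HB'] := uniform_constant (fun p : 'I_n * 'I_K => @Pm ('D_(e p.1) (w p.2)))
  (fun p => Pe _ (cs_derive p.1 (cw p.2))).
exists (B + B')^-1; first by rewrite invr_gt0 addr_gt0.
move=> eps N ed er.
have h1 b : isq (fun x => avg eps N (w b) x - w b x) <= eta'.
  apply: (HB b).1 => //; apply: le_trans ed _.
  by rewrite lef_pV2 ?posrE ?addr_gt0// lerDl ltW.
have h2 (p : 'I_n * 'I_K) :
    isq (fun x => avg eps N ('D_(e p.1) (w p.2)) x - 'D_(e p.1) (w p.2) x) <= eta'.
  apply: (HB' p).1 => //; apply: le_trans ed _.
  by rewrite lef_pV2 ?posrE ?addr_gt0// lerDr ltW.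
split=> a; first exact: le_trans (h1 a) eta'1.
have cA b : cs x0 (rho + rho) (avg eps N (w b)).
  by apply: cs_le (cs_avg eps N (cw b)); rewrite lerD2l.
have cw2 b : cs x0 (rho + rho) (w b) by apply: cs_le (cw b); rewrite lerDl ltW.
have -> : isq (fun x => opc (fun b => avg eps N (w b)) a x - opc w a x) =
    isq (opc (fun b x => avg eps N (w b) x - w b x) a).
  by apply: isq_ext => x; rewrite (opcB _ _ cA cw2).
apply: le_trans (HC (rho + rho) _ _ _) _; first by move=> b; exact: csB.
apply: (@le_trans _ _ (C * ((m1 + m2) * eta'))); last first.
  by rewrite mulrA /eta' mulrA ler_pdivrMr ?ltr_wpDl// mulrC ler_pM2l// lerDl.
rewrite ler_wpM2l// mulrDl; apply: lerD.
  apply: (@le_trans _ _ (\sum_(p : 'I_n * 'I_K) eta')).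
    apply: ler_sum => p _; rewrite (_ : isq _ = isq (fun x =>
      avg eps N ('D_(e p.1) (w p.2)) x - 'D_(e p.1) (w p.2) x))//.
    apply: isq_ext => x; rewrite (csB_derive _ _ (cA _) (cw2 _)) avg_derive//.
    by have [] := cw p.2.
  by rewrite sumr_const -mulr_natl.
apply: (@le_trans _ _ (\sum_(b : 'I_K) eta')); first by apply: ler_sum => b _; exact: h1.
by rewrite sumr_const -mulr_natl.
Qed.

(** The first-order terms are covered by Friedrichs' lemma [Int_avg_commutator]; for those of order
    zero each half of the commutator is bounded. [C] involves only the coefficients: what depends on
    [w] enters through [L], multiplied by the mesh, and is disposed of by the choice of [N0]. *)
Lemma opc_commutator : exists2 C : R, 0 <= C &
  forall w eps (eta : R), (forall b, cs x0 r (w b)) -> eps != 0 -> `|eps| <= r -> 0 < eta ->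
  exists N0, forall N, (N0 <= N)%N -> forall a,
    isq (fun x => opc (fun b => avg eps N (w b)) a x - avg eps N (opc w a) x) <=
    C * (\sum_b isq (w b)) + eta.
Proof.
have [B B0 [alB beB]] := coefficients_bounded.
have [LA LA0 HLA] := cs_lipschitz_fin (fun p : 'I_n * 'I_K * 'I_K => cs_al p.1.1 p.1.2 p.2).
have [th [cth th01 th1]] : exists b, [/\ cs x0 (2 * (2 * r)) b, forall x, 0 <= b x <= 1 &
    forall x, `|x - x0| <= 2 * r -> b x = 1] by apply: cs_bump; rewrite mulr_gt0.
have th0 x : 0 <= th x by have /andP[] := th01 x.
have Ith : 0 <= Int th by exact: Int_ge0.
pose m1 : R := #|{: 'I_n * 'I_K}|%:R; pose m2 : R := #|'I_K|%:R.
have m10 : 0 <= m1 by exact: ler0n.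
have m20 : 0 <= m2 by exact: ler0n.
have B2 : 0 <= B ^+ 2 by exact: sqr_ge0.
have LA2 : 0 <= LA ^+ 2 by exact: sqr_ge0.
have C1 : 0 <= 2 * m1 * m1 * (15 * LA ^+ 2).
  by apply: mulr_ge0; [apply: mulr_ge0 => //; exact: mulr_ge0|exact: mulr_ge0].
have C2 : 0 <= 2 * m2 * (4 * B ^+ 2) by apply: mulr_ge0; [exact: mulr_ge0|exact: mulr_ge0].
exists (2 * m1 * m1 * (15 * LA ^+ 2) + 2 * m2 * (4 * B ^+ 2)); first exact: addr_ge0.
move=> w eps eta cw eps0 er eta0.
have cw2 b : cs x0 (2 * r) (w b) by apply: cs_le (cw b); rewrite ler_peMl ?ler1n// ltW.
have [L L0 HL] := cs_difference_quotient_fin (fun p : 'I_n * 'I_K => p.1)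
  (fun p : 'I_n * 'I_K => cw p.2).
have csA (f : fn) N : cs x0 r f -> cs x0 (2 * r) (avg eps N f).
  by move=> cf; apply: cs_le (cs_avg eps N cf); rewrite mulr_natl mulr2n lerD2l.
pose c := 2 * m1 * m1 * (3 * (LA * `|eps| * L) ^+ 2 * Int th).
have c0 : 0 <= c.
  apply: mulr_ge0; first by apply: mulr_ge0 => //; exact: mulr_ge0.
  by apply: mulr_ge0 => //; apply: mulr_ge0 => //; exact: sqr_ge0.
have [N0 HN0] := mesh_small eps c0 eta0; exists N0 => N /HN0 HN a.
have h1 (p : 'I_n * 'I_K) : isq (fun x => al p.1 a p.2 x * 'D_(e p.1) (avg eps N (w p.2)) x -
      avg eps N (fun z => al p.1 a p.2 z * 'D_(e p.1) (w p.2) z) x) <=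
    3 * (LA * `|eps| * L) ^+ 2 * Int th * `|mesh eps N| ^+ 2 + 15 * LA ^+ 2 * isq (w p.2).
  have sw : smooth setT (w p.2) by have [] := cw p.2.
  have cD := cs_derive p.1 (cw p.2).
  rewrite -isqN.
  have := @Int_avg_commutator R n eps N (al p.1 a p.2) (w p.2) p.1 L LA th eps0 (ltW L0)
    (ltW LA0) (cs_cont (cs_al _ _ _)) sw (cs_ccont (cw _)) (cs_ccont cth) th0 (cs_ccont cD)
    _ (HL p) (HLA (p.1, a, p.2)).
  rewrite -/(isq (w p.2)) => H.
  have -> : 3 * (LA * `|eps| * L) ^+ 2 * Int th * `|mesh eps N| ^+ 2 =
    3 * (LA * `|eps| * L * `|mesh eps N|) ^+ 2 * Int th by ring.
  apply: le_trans (H _) => [|x]; last first.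
    move=> hx; rewrite th1// leNgt; apply/negP => xr.
    have cal : cs x0 r (fun z => al p.1 a p.2 z * 'D_(e p.1) (w p.2) z).
      by apply: csMl => //; have [] := cs_al p.1 a p.2.
    by case: hx => /eqP; apply; apply: (csA _ _ _).2.
  rewrite le_eqVlt; apply/orP; left; apply/eqP; congr Int; apply/funext => x.
  by rewrite opprB avg_derive.
have h2 b : isq (fun x => be a b x * avg eps N (w b) x -
    avg eps N (fun z => be a b z * w b z) x) <= 4 * B ^+ 2 * isq (w b).
  have cb := cs_cont (cs_be a b); have cwb := cs_ccont (cw b).
  have cA := avg_ccont eps N cwb; have cbw : ccont (fun z => be a b z * w b z) by exact: ccontM.
  apply: le_trans (isqD (f := fun x => be a b x * avg eps N (w b) x)
    (g := fun x => - avg eps N (fun z => be a b z * w b z) x) _ _) _.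
  - exact: ccontM.
  - have := ccontZ (-1) (avg_ccont eps N cbw).
    by rewrite (_ : (fun x => _) = (fun x => - avg eps N (fun z => be a b z * w b z) x))//; apply/funext => x; rewrite mulN1r.
  rewrite isqN.
  have k1 : isq (fun x => be a b x * avg eps N (w b) x) <= B ^+ 2 * isq (w b).
    apply: le_trans (isqM cb cA (beB a b)) _; rewrite ler_wpM2l//; exact: isq_avg.
  have k2 : isq (avg eps N (fun z => be a b z * w b z)) <= B ^+ 2 * isq (w b).
    by apply: le_trans (isq_avg _ _ cbw) _; exact: isqM.
  lra.
pose F1 x := \sum_(p : 'I_n * 'I_K) (al p.1 a p.2 x * 'D_(e p.1) (avg eps N (w p.2)) x -
      avg eps N (fun z => al p.1 a p.2 z * 'D_(e p.1) (w p.2) z) x).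
pose F2 x := \sum_b (be a b x * avg eps N (w b) x - avg eps N (fun z => be a b z * w b z) x).
have -> : isq (fun x => opc (fun b => avg eps N (w b)) a x - avg eps N (opc w a) x) =
    isq (fun x => F1 x + F2 x).
  apply: isq_ext => x; rewrite /F1 /F2 !sumrB addrACA -opprD; congr (_ - _).
  by rewrite /opc avgD !avg_sum.
have cF1 p : ccont (fun x => al p.1 a p.2 x * 'D_(e p.1) (avg eps N (w p.2)) x -
      avg eps N (fun z => al p.1 a p.2 z * 'D_(e p.1) (w p.2) z) x).
  have sal : smooth setT (al p.1 a p.2) by have [] := cs_al p.1 a p.2.
  apply: (@cs_ccont _ _ x0 (2 * r)); apply: csB.
    by apply: csMl => //; apply: cs_derive; exact: csA.
  by apply: csA; apply: csMl => //; exact: cs_derive.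
have cF2 b : ccont (fun x => be a b x * avg eps N (w b) x -
    avg eps N (fun z => be a b z * w b z) x).
  have sbe : smooth setT (be a b) by have [] := cs_be a b.
  apply: (@cs_ccont _ _ x0 (2 * r)); apply: csB.
    by apply: csMl => //; exact: csA.
  by apply: csA; exact: csMl.
apply: le_trans (isqD (ccont_sum _ _ cF1) (ccont_sum _ _ cF2)) _.
pose s := \sum_b isq (w b).
have k1 : isq F1 <= m1 * (m1 * (3 * (LA * `|eps| * L) ^+ 2 * Int th * `|mesh eps N| ^+ 2
    + 15 * LA ^+ 2 * s)).
  apply: le_trans (isq_sum cF1) _; rewrite ler_wpM2l//.
  apply: (@le_trans _ _ (\sum_(p : 'I_n * 'I_K) (3 * (LA * `|eps| * L) ^+ 2 * Int th *
    `|mesh eps N| ^+ 2 + 15 * LA ^+ 2 * s))); last by rewrite sumr_const /m1 [leRHS]mulr_natl.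
  apply: ler_sum => p _; apply: le_trans (h1 p) _; rewrite lerD2l; apply: ler_wpM2l; first exact: mulr_ge0.
  by rewrite /s (bigD1 p.2)//= lerDl; apply: sumr_ge0 => b _; exact: isq_ge0.
have k2 : isq F2 <= m2 * (4 * B ^+ 2 * s).
  apply: le_trans (isq_sum cF2) _; rewrite ler_wpM2l// mulr_sumr.
  by apply: ler_sum => b _; exact: h2.
rewrite -/s; move: HN; rewrite /c => HN.
apply: le_trans (lerD (ler_wpM2l _ k1) (ler_wpM2l _ k2)) _ => //.
apply: le_trans (lerD (lexx _) HN); rewrite le_eqVlt; apply/orP; left; apply/eqP.
ring.
Qed.

(** The constant of [f] serves for all its averages. It is thus independent of [N], as it must be
    when the grid is chosen after it. *)
Lemma avg_difference_quotient eps N f j (L : R) : smooth setT f ->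
  (forall x t, `|f (x + t *: e j) - f x - t * 'D_(e j) f x| <= L * t ^+ 2) ->
  forall x t, `|avg eps N f (x + t *: e j) - avg eps N f x - t * 'D_(e j) (avg eps N f) x|
    <= L * t ^+ 2.
Proof.
move=> sf HL x t; rewrite avg_derive// -avgZ.
have -> : avg eps N f (x + t *: e j) = avg eps N (fun z => f (z + t *: e j)) x.
  by rewrite /avg; congr (_ * _); apply: eq_bigr => b _; rewrite addrAC.
by rewrite -!avgB; apply: avg_norm_le => b; exact: HL.
Qed.

(** The outer average takes the derivative, at the cost [E = 12 / eps ^ 2], so that the inner
    averages appear without derivatives on the right. [C] depends on [eps], but neither on [w] nor
    on [N]. *)
Lemma opc_smoothing (m : 'I_K -> 'I_K -> fn) eps : (forall a c, cs x0 r (m a c)) ->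
  eps != 0 -> `|eps| <= r -> exists2 C : R, 0 <= C & forall w (eta : R),
  (forall c, cs x0 r (w c)) -> 0 < eta -> exists N0, forall N, (N0 <= N)%N ->
    let v a x := \sum_c m a c x * avg (- eps) N (avg eps N (w c)) x in
    \sum_a isq (v a) <= C * \sum_c isq (avg eps N (w c)) /\
    \sum_a isq (opc v a) <= C * (\sum_c isq (avg eps N (w c))) + eta.
Proof.
move=> cm eps0 er; have [C C0 HC] := isq_opc_le.
have [B B0 mB] := cs_bounded_fin (fun p : 'I_K * 'I_K => cm p.1 p.2).
have [B' B'0 DmB] := cs_bounded_fin
  (fun p : 'I_n * ('I_K * 'I_K) => cs_derive p.1 (cm p.2.1 p.2.2)).
have [th [cth th01 th1]] : exists b, [/\ cs x0 (2 * (3 * r)) b, forall x, 0 <= b x <= 1 &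
    forall x, `|x - x0| <= 3 * r -> b x = 1] by apply: cs_bump; rewrite mulr_gt0.
have th0 x : 0 <= th x by have /andP[] := th01 x.
have Ith : 0 <= Int th by exact: Int_ge0.
pose m1 : R := #|{: 'I_n * 'I_K}|%:R; pose m2 : R := #|'I_K|%:R.
have m10 : 0 <= m1 by exact: ler0n.
have m20 : 0 <= m2 by exact: ler0n.
have B2 : 0 <= B ^+ 2 by exact: sqr_ge0.
have B'2 : 0 <= B' ^+ 2 by exact: sqr_ge0.
pose E := 12 / eps ^+ 2.
have E0 : 0 <= E by apply: divr_ge0 => //; exact: sqr_ge0.
pose Cv := m2 * (m2 * B ^+ 2).
have Cv0 : 0 <= Cv by apply: mulr_ge0 => //; exact: mulr_ge0.
pose Cd := 2 * (m2 * (B ^+ 2 * E)) + 2 * (m2 * B' ^+ 2).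
have Cd0 : 0 <= Cd.
  by apply: addr_ge0; apply: mulr_ge0 => //; apply: mulr_ge0 => //; exact: mulr_ge0.
have Cf0 : 0 <= m2 * C * (m1 * Cd + Cv).
  by apply: mulr_ge0; [exact: mulr_ge0|apply: addr_ge0 => //; exact: mulr_ge0].
exists (Cv + m2 * C * (m1 * Cd + Cv)); first exact: addr_ge0.
move=> w eta cw eta0.
have [L L0 HL] := cs_difference_quotient_fin (fun p : 'I_n * 'I_K => p.1)
  (fun p : 'I_n * 'I_K => cw p.2).
pose c := m2 * C * m1 * (2 * (m2 * (B ^+ 2 * (m2 * (3 * L ^+ 2 * Int th))))).
have c0 : 0 <= c.
  apply: mulr_ge0; first by apply: mulr_ge0 => //; exact: mulr_ge0.
  apply: mulr_ge0 => //; apply: mulr_ge0 => //; apply: mulr_ge0 => //.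
  by apply: mulr_ge0 => //; apply: mulr_ge0 => //; apply: mulr_ge0 => //; exact: sqr_ge0.
have [N0 HN0] := mesh_small eps c0 eta0; exists N0 => N /HN0 HN v.
pose Y := \sum_c isq (avg eps N (w c)); rewrite -/Y.
have Y0 : 0 <= Y by apply: sumr_ge0 => b _; exact: isq_ge0.
have cy b : cs x0 (2 * r) (avg eps N (w b)).
  by apply: cs_le (cs_avg eps N (cw b)); rewrite mulr_natl mulr2n lerD2l.
have cz b : cs x0 (3 * r) (avg (- eps) N (avg eps N (w b))).
  apply: cs_le (cs_avg (- eps) N (cy b)); rewrite normrN; lra.
have sz b : smooth setT (avg (- eps) N (avg eps N (w b))) by have [] := cz b.
have sm a b : smooth setT (m a b) by have [] := cm a b.
have cv a : cs x0 r (v a).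
  by apply: cs_sum => b; apply: cs_ext (csMl (sz b) (cm a b)) => x; rewrite mulrC.
have hv a : isq (v a) <= m2 * B ^+ 2 * Y.
  apply: le_trans (isq_lincomb (fun b => cs_cont (cm a b)) (fun b => mB (a, b))
    (fun b => cs_ccont (cz b))) _.
  rewrite -/m2 mulrA; apply: ler_wpM2l; first exact: mulr_ge0.
  by apply: ler_sum => b _; apply: isq_avg; exact: cs_ccont (cy b).
have hDz j b : isq ('D_(e j) (avg (- eps) N (avg eps N (w b)))) <=
    3 * L ^+ 2 * Int th * `|mesh eps N| ^+ 2 + E * isq (avg eps N (w b)).
  have sw : smooth setT (w b) by have [] := cw b.
  have sy : smooth setT (avg eps N (w b)) by have [] := cy b.
  have cDy := cs_derive j (cy b); rewrite -oppr_eq0 in eps0.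
  have := @Int_avg_derive R n (- eps) N (avg eps N (w b)) j L th eps0 (ltW L0) sy
    (cs_ccont (cy b)) (cs_ccont cth) th0 (cs_ccont cDy) _
    (avg_difference_quotient eps N sw (HL (j, b))).
  rewrite sqrrN -/E /mesh mulNr normrN -/(mesh eps N) => H.
  have -> : 3 * L ^+ 2 * Int th * `|mesh eps N| ^+ 2 = 3 * (L * `|mesh eps N|) ^+ 2 * Int th.
    by ring.
  apply: le_trans (H _) => [|x].
    by rewrite le_eqVlt; apply/orP; left; apply/eqP/isq_ext => x; rewrite avg_derive.
  rewrite -avg_derive// => hx; rewrite th1// leNgt; apply/negP => xr; move/eqP: hx; apply.
  by apply: (cs_derive j (cz b)).2.
have hDv j a : isq ('D_(e j) (v a)) <=
    2 * (m2 * (B ^+ 2 * (m2 * (3 * L ^+ 2 * Int th * `|mesh eps N| ^+ 2)))) + Cd * Y.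
  pose G1 x := \sum_b m a b x * 'D_(e j) (avg (- eps) N (avg eps N (w b))) x.
  pose G2 x := \sum_b 'D_(e j) (m a b) x * avg (- eps) N (avg eps N (w b)) x.
  have cDz b := cs_derive j (cz b).
  have -> : isq ('D_(e j) (v a)) = isq (fun x => G1 x + G2 x).
    apply: isq_ext => x; rewrite /v (@cs_derive_sum _ _ x0 r) => [|b]; last first.
      by apply: cs_ext (csMl (sz b) (cm a b)) => x'; rewrite mulrC.
    rewrite /G1 /G2 -big_split; apply: eq_bigr => b _ /=.
    by rewrite (csM_derive _ _ (cz b))// [_ * 'D_(e j) (m a b) x]mulrC.
  apply: le_trans (isqD _ _) _.
  - by apply: ccont_sum => b; apply: ccontM; [exact: cs_cont (cm a b)|exact: cs_ccont (cDz b)].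
  - apply: ccont_sum => b; apply: ccontM; last exact: cs_ccont (cz b).
    exact: cs_cont (cs_derive j (cm a b)).
  have k1 := isq_lincomb (fun b => cs_cont (cm a b)) (fun b => mB (a, b))
    (fun b => cs_ccont (cDz b)).
  have k2 := isq_lincomb (fun b => cs_cont (cs_derive j (cm a b))) (fun b => DmB (j, (a, b)))
    (fun b => cs_ccont (cz b)).
  have k3 : \sum_b isq ('D_(e j) (avg (- eps) N (avg eps N (w b)))) <=
      m2 * (3 * L ^+ 2 * Int th * `|mesh eps N| ^+ 2) + E * Y.
    apply: le_trans (ler_sum _ (fun b _ => hDz j b)) _.
    by rewrite big_split/= sumr_const -mulr_sumr /m2 [in leRHS]mulr_natl.
  have k4 : \sum_b isq (avg (- eps) N (avg eps N (w b))) <= Y.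
    by apply: ler_sum => b _; apply: isq_avg; exact: cs_ccont (cy b).
  have {}k1 := le_trans k1 (ler_wpM2l m20 (ler_wpM2l B2 k3)).
  have {}k2 := le_trans k2 (ler_wpM2l m20 (ler_wpM2l B'2 k4)).
  apply: le_trans (lerD (ler_wpM2l _ k1) (ler_wpM2l _ k2)) _ => //.
  by rewrite le_eqVlt; apply/orP; left; apply/eqP; rewrite /Cd; ring.
have hsv : \sum_a isq (v a) <= Cv * Y.
  apply: le_trans (ler_sum _ (fun a _ => hv a)) _.
  by rewrite sumr_const -[leLHS]mulr_natl -/m2 /Cv !mulrA.
split; first by apply: le_trans hsv _; rewrite mulrDl lerDl mulr_ge0.
apply: (@le_trans _ _ (\sum_(a : 'I_K) C * (m1 * (2 * (m2 * (B ^+ 2 * (m2 *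
    (3 * L ^+ 2 * Int th * `|mesh eps N| ^+ 2)))) + Cd * Y) + Cv * Y))).
  apply: ler_sum => a _; apply: le_trans (HC r v a cv) _.
  apply: ler_wpM2l => //; apply: lerD => //.
  apply: le_trans (ler_sum _ (fun p _ => hDv p.1 p.2)) _.
  by rewrite sumr_const -[leLHS]mulr_natl.
rewrite sumr_const -[leLHS]mulr_natl -/m2.
apply: (@le_trans _ _ (m2 * C * (m1 * Cd + Cv) * Y + c * `|mesh eps N| ^+ 2)).
  by rewrite le_eqVlt; apply/orP; left; apply/eqP; rewrite /c; ring.
by apply: lerD => //; apply: ler_wpM2r => //; rewrite lerDr.
Qed.

End coordinate_operator.

Section operator_facts.
Context {R : realType} {M : ptopologicalType} {n k : nat} {A : smooth_atlas R M n}.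
Context {E : M -> lmodType R[i]} {S : vector_bundle A k E}.
Variable D : section E -> section E.
Hypothesis D_diff : differential_operator S D.
Implicit Types u v : section E.

Lemma smooth_section_D u : smooth_section S u -> smooth_section S (D u).
Proof. by have [H _ _ _] := D_diff; exact: H. Qed.

Lemma D_local (U : set M) u v : open U -> smooth_section S u -> smooth_section S v ->
  (forall p, U p -> u p = v p) -> forall p, U p -> D u p = D v p.
Proof. by have [_ _ H _] := D_diff; exact: H. Qed.

Lemma D_zero : D (fun=> 0) = (fun=> 0).
Proof.
have [_ H _ _] := D_diff; have s0 : smooth_section S (fun=> 0) by exact: smooth_section0.
have := H (-1) (fun=> 0) (fun=> 0) s0 s0.
have -> : (fun p => -1 *: (0 : E p) + 0) = (fun=> 0).
  by apply: section_ext => p; rewrite scaler0 addr0.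
move=> ->; apply: section_ext => p /=; by rewrite scaleN1r addNr.
Qed.

Lemma D_sub u v : smooth_section S u -> smooth_section S v ->
  D (fun p => u p - v p) = (fun p => D u p - D v p).
Proof.
move=> su sv; have [_ H _ _] := D_diff; have := H (-1) v u sv su.
have -> : (fun p => -1 *: v p + u p) = (fun p => u p - v p).
  by apply: section_ext => p; rewrite scaleN1r addrC.
by move=> ->; apply: section_ext => p; rewrite scaleN1r addrC.
Qed.

Lemma smooth_sectionB u v : smooth_section S u -> smooth_section S v ->
  smooth_section S (fun p => u p - v p).
Proof.
move=> su sv; have -> : (fun p => u p - v p) = (fun p => u p + (-1) *: v p).
  by apply: section_ext => p; rewrite scaleN1r.
apply: smooth_sectionD => //; first exact: openT.
by apply: smooth_sectionM => //; [exact: openT|exact: csmooth_on_cst].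
Qed.

Lemma test_of_compact (Q : set M) u : smooth_section S u -> compact Q -> closed Q ->
  (forall p, ~ Q p -> u p = 0) -> compactly_supported_smooth S u.
Proof.
move=> su cQ clQ u0; split=> //; apply: subclosed_compact cQ _; first exact: closed_closure.
rewrite [X in _ `<=` X](closure_id Q).1//; apply: closure_subset => p up; apply: contrapT => /u0; exact: up.
Qed.

Lemma test_off u p : compactly_supported_smooth S u ->
  ~ closure [set q | u q <> 0] p -> u p = 0.
Proof. by move=> _ np; apply: contrapT => up; apply: np; exact: subset_closure. Qed.

Lemma test_D u : compactly_supported_smooth S u -> compactly_supported_smooth S (D u).
Proof.
move=> tu; have [su cu] := tu.
apply: test_of_compact cu _ _; [exact: smooth_section_D|exact: closed_closure|move=> p np].
rewrite (D_local (U := ~` closure [set q | u q <> 0]) (v := fun=> 0))//.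
- by rewrite D_zero.
- by apply: closed_openC; exact: closed_closure.
- exact: smooth_section0.
- by move=> q; exact: test_off.
Qed.

Lemma testB u v : compactly_supported_smooth S u -> compactly_supported_smooth S v ->
  compactly_supported_smooth S (fun p => u p - v p).
Proof.
move=> tu tv; have [[su cu] [sv cv]] := (tu, tv).
apply: test_of_compact (compactU cu cv) _ _.
- exact: smooth_sectionB.
- by apply: closedU; exact: closed_closure.
- by move=> p np; rewrite (test_off (p := p) tu) ?(test_off (p := p) tv) ?subr0// => h;
     apply: np; [right|left].
Qed.

Lemma testM (f : M -> R) u : smooth_on A setT f -> compactly_supported_smooth S u ->
  compactly_supported_smooth S (fun p => (f p)%:C%C *: u p).
Proof.
move=> sf tu; have [su cu] := tu.
apply: test_of_compact cu _ _; [|exact: closed_closure|].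
  apply: smooth_sectionM => //; first exact: openT.
  by split => //; exact: smooth_on_cst.
by move=> p np; rewrite (test_off (p := p) tu)// scaler0.
Qed.

Lemma test0 : compactly_supported_smooth S (fun=> 0).
Proof.
apply: (@test_of_compact set0); [exact: smooth_section0|exact: compact0|exact: closed0|by []].
Qed.

Lemma testD u v : compactly_supported_smooth S u -> compactly_supported_smooth S v ->
  compactly_supported_smooth S (fun p => u p + v p).
Proof.
move=> tu tv.
have -> : (fun p => u p + v p) = (fun p => u p - (0 - v p)).
  by apply: section_ext => p; rewrite sub0r opprK.
by apply: testB => //; apply: testB => //; exact: test0.
Qed.

End operator_facts.

Section local_operator.
Context {R : realType} {M : ptopologicalType} {n k : nat} {A : smooth_atlas R M n}.
Context {E : M -> lmodType R[i]} {S : vector_bundle A k E}.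
Hypotheses (M_hausdorff : hausdorff_space M).
Variable D : section E -> section E.
Hypothesis D_diff : differential_operator S D.
Variables (F : frame S) (x0 : 'rV[R]_n) (r : R).
Hypothesis r0 : 0 < r.
Hypothesis ball_sub : [set x | `|x - x0| <= 4 * r] `<=` cimg (fch F).
Local Notation c := (fch F).
Local Notation V := (cimg (fch F)).
Local Notation K := (k + k)%N.
Local Notation e j := (delta_mx ord0 j : 'rV[R]_n).
Implicit Types (y : 'I_K -> 'rV[R]_n -> R) (u v : section E).

Lemma lcB u v x : V x -> lc F (fun p => u p - v p) x = lc F u x - lc F v x.
Proof.
move=> Vx; have -> : (fun p => u p - v p) = (fun p => u p + (-1)%:C%C *: v p).
  by apply: section_ext => p; rewrite rmorphN scaleN1r.
by rewrite lcD// (@lcZ _ _ _ _ _ _ _ F (fun=> -1) v x Vx) scaleN1r.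
Qed.

(** The section vanishes off the image of a closed ball, which is compact and hence closed in [M];
    locality of [D] does the rest. *)
Lemma D_pl_off y : (forall a, cs x0 (2 * r) (y a)) -> forall p, ~ cdom c p ->
  D (pl F y) p = 0.
Proof.
move=> cy p np.
have r24 : 2 * r <= 4 * r by rewrite ler_pM2r// ler_nat.
have sub2 := ball_sub_le ball_sub r24.
pose Q := cinv c @` [set x | `|x - x0| <= 2 * r].
have clQ : closed Q by apply: compact_closed => //; exact: (compact_chart_image sub2).
have sp := (pl_test M_hausdorff ball_sub r24 cy).1.
rewrite (D_local D_diff (U := ~` Q) (v := fun=> 0))//.
- by rewrite (D_zero D_diff).
- exact: closed_openC.
- exact: smooth_section0.
- move=> q nQ; have [cq|/pl_out//] := pselect (cdom c q).
  rewrite -(@pull_lc _ _ _ _ _ _ _ F (fun=> 0) (fun=> 0) q cq); last first.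
    by rewrite lc0//; exact: cmap_img.
  apply: pull_lc => //; rewrite lc_pull; last exact: cmap_img.
  apply/colP => a; rewrite !mxE (cy a).2// ltNge; apply/negP => h; apply: nQ.
  by exists (cmap c q) => //; exact: cmapK.
- by move=> [x /sub2 Vx xp]; apply: np; rewrite -xp; exact: cinv_dom.
Qed.

(** The coefficients are multiplied by a bump equal to 1 up to radius [2 * r]. They become globally
    smooth and bounded, while the formula stays exact on averages of sections cut off at radius
    [r]. *)
Lemma frame_operator : exists (al : 'I_n -> 'I_K -> 'I_K -> 'rV[R]_n -> R)
    (be : 'I_K -> 'I_K -> 'rV[R]_n -> R),
  [/\ forall j a b, cs x0 (4 * r) (al j a b), forall a b, cs x0 (4 * r) (be a b),
      forall y, (forall a, cs x0 (2 * r) (y a)) -> D (pl F y) = pl F (opc al be y) &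
      forall u x a, smooth_section S u -> `|x - x0| <= 2 * r ->
        lc F (D u) x a ord0 = opc al be (fun b x' => lc F u x' b ord0) a x].
Proof.
have [al [be [sal sbe Hop]]] := operator_coords F D_diff.
have [th [cth _ th1]] : exists b, [/\ cs x0 (2 * (2 * r)) b, forall x, 0 <= b x <= 1 &
    forall x, `|x - x0| <= 2 * r -> b x = 1] by apply: cs_bump; rewrite mulr_gt0.
have {}cth : cs x0 (4 * r) th by apply: cs_le cth; rewrite mulrA -natrM.
pose al' j a b x := th x * al j x a b; pose be' a b x := th x * be x a b.
have oV : open V by exact: cimg_open.
have lcop u x a : smooth_section S u -> V x -> `|x - x0| <= 2 * r ->
    lc F (D u) x a ord0 = opc al' be' (fun b x' => lc F u x' b ord0) a x.
  move=> su Vx xr; rewrite Hop// /opc /al' /be' th1//; congr (_ + _).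
    by rewrite pair_big; apply: eq_bigr => p _; rewrite mul1r.
  by apply: eq_bigr => b _; rewrite mul1r.
exists al', be'; split=> [j a b|a b|y cy|u x a su xr].
- by apply: (cs_cutoff oV ball_sub cth); exact: sal.
- by apply: (cs_cutoff oV ball_sub cth); exact: sbe.
- have sy : smooth_section S (pl F y).
    have r24 : 2 * r <= 4 * r by rewrite ler_pM2r// ler_nat.
    by have [] := pl_test M_hausdorff ball_sub r24 cy.
  apply: (frame_section_eq (F := F)) => [x Vx|p np]; last by rewrite pl_out ?D_pl_off.
  apply/colP => a; rewrite lc_pl//.
  have eqd b j : 'D_(e j) (fun x' => lc F (pl F y) x' b ord0) x = 'D_(e j) (y b) x.
    by apply: near_eq_derive; apply: (near_open_eq oV Vx) => x' Vx'; exact: lc_pl.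
  have [xr|xr] := leP `|x - x0| (2 * r).
    rewrite lcop// /opc; congr (_ + _); apply: eq_bigr => p _; first by rewrite eqd.
    by rewrite lc_pl.
  rewrite Hop// /opc !big1 => [|b _|p _|b _|j _].
  + by [].
  + by rewrite (cy b).2// mulr0.
  + by rewrite (derive_csupp p.1 (cy p.2).2)// mulr0.
  + by rewrite lc_pl// (cy b).2// mulr0.
  + by rewrite big1// => b _; rewrite eqd (derive_csupp j (cy b).2)// mulr0.
- apply: lcop => //; apply: (ball_sub_le ball_sub) xr.
  by rewrite ler_pM2r// ler_nat.
Qed.

End local_operator.

Section mollifiers.
Context {R : realType} {M : ptopologicalType} {n k : nat} {A : smooth_atlas R M n}.
Context {E : M -> lmodType R[i]} (S : vector_bundle A k E).
Variables (h : hermitian_structure E) (mu : {measure set (borel M) -> \bar R}).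
Variable D : section E -> section E.
Local Notation test := (compactly_supported_smooth S).
Local Notation nsq := (nsq h mu).
Local Notation rin := (rin h mu).
Implicit Types (f g : section E) (T : nat -> nat -> section E -> section E).

(* [T i N] regularizes at scale of order [1 / (i + 1)], with grids of [N + 1]
   points per direction, and converges to the multiplication by [phi].  In the
   last clause the hypothesis says that [g] is small in the dual of the graph
   norm of [D]: it holds when [g] is [D] applied, in the weak sense, to a small
   section. *)
Record mollifier T (phi : M -> R) : Prop := Mollifier {
  moll_smooth : smooth_on A setT phi;
  moll_test : forall i N f, test f -> test (T i N f);
  moll_sub : forall i N f g, test f -> test g ->
    T i N (fun p => f p - g p) = (fun p => T i N f p - T i N g p);
  moll_bounded : exists2 C : R, 0 <= C &
    forall i N f, test f -> nsq (T i N f) <= C * nsq f;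
  moll_cvg : forall f (eta : R), test f -> 0 < eta ->
    exists i0, forall i N, (i0 <= i)%N ->
      nsq (fun p => T i N f p - (phi p)%:C%C *: f p) <= eta /\
      nsq (fun p => D (T i N f) p - D (fun q => (phi q)%:C%C *: f q) p) <= eta;
  moll_commutator : exists2 C : R, 0 <= C &
    forall i f (eta : R), test f -> 0 < eta ->
    exists N0, forall N, (N0 <= N)%N ->
      nsq (fun p => D (T i N f) p - T i N (D f) p) <= C * nsq f + eta;
  moll_weak : forall i, exists2 C : R, 0 <= C &
    forall g (d eta : R), test g -> 0 <= d -> 0 < eta ->
    (forall psi (s : R), test psi -> 0 < s -> rin psi g <= s * (nsq psi + nsq (D psi)) + d / s) ->
    exists N0, forall N, (N0 <= N)%N -> nsq (T i N g) <= C * d + eta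
}.

End mollifiers.

(** * The mollifier of one frame *)

Section local_mollifier.
Context {R : realType} {M : ptopologicalType} {n k : nat} {A : smooth_atlas R M n}.
Context {E : M -> lmodType R[i]} {S : vector_bundle A k E}.
Variables (h : hermitian_structure E) (mu : {measure set (borel M) -> \bar R}).
Hypotheses (M_hausdorff : hausdorff_space M) (M_countable : @second_countable M).
Hypothesis mu_smooth : nowhere_vanishing_smooth A mu.
Hypothesis h_smooth : smooth_hermitian S h.
Variable D : section E -> section E.
Hypothesis D_diff : differential_operator S D.
Variables (F : frame S) (x0 : 'rV[R]_n) (r : R).
Hypothesis r0 : 0 < r.
Hypothesis ball_sub : [set x | `|x - x0| <= 4 * r] `<=` cimg (fch F).
Local Notation c := (fch F).
Local Notation V := (cimg (fch F)).
Local Notation K := (k + k)%N.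
Local Notation test := (compactly_supported_smooth S).
Local Notation nsq := (nsq h mu).
Local Notation rin := (rin h mu).
Local Notation e j := (delta_mx ord0 j : 'rV[R]_n).
Implicit Types (y z : 'I_K -> 'rV[R]_n -> R) (u v f g : section E).

Lemma le24 (m : nat) : (m <= 4)%N -> m%:R * r <= 4 * r.
Proof. by move=> m4; rewrite ler_pM2r// ler_nat. Qed.

Lemma le14 : r <= 4 * r.
Proof. by have := @le24 1 isT; rewrite mul1r. Qed.

Let sub1 := ball_sub_le ball_sub le14.
Let oV : open V. Proof. exact: cimg_open. Qed.

Lemma cut_lc_cs theta f a : cs x0 r theta -> smooth_section S f ->
  cs x0 r (fun x => theta x * lc F f x a ord0).
Proof. by move=> ct sf; apply: (cs_cutoff oV sub1 ct); exact: lc_smooth. Qed.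

Lemma cs_off_chart theta x : cs x0 r theta -> ~ V x -> theta x = 0.
Proof. by move=> [_ H] nV; apply: H; rewrite ltNge; apply/negP => /sub1. Qed.

(** Reassembled by [pl], the cut-off coordinates form a bounded multiple of [f], to which
    [isq_le_nsq_pl] applies. *)
Lemma isq_cut_lc theta : cs x0 r theta -> exists2 C : R, 0 <= C &
  forall f a, test f -> isq (fun x => theta x * lc F f x a ord0) <= C * nsq f.
Proof.
move=> ct; have [ka hka] := mu_smooth (fch_ok F).
have [C C0 HC] := isq_le_nsq_pl M_hausdorff h_smooth ball_sub hka.
have [B B0 HB] := cs_bounded ct.
exists (C * B ^+ 2); first by apply: mulr_ge0 => //; exact: sqr_ge0.
move=> f a tf; have [sf _] := tf.
apply: le_trans (HC (fun b x => theta x * lc F f x b ord0) _ a) _ => [b|].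
  exact: cs_le le14 (cut_lc_cs b ct sf).
rewrite -mulrA; apply: ler_wpM2l => //.
rewrite (pl_cutoff f (fun x => @cs_off_chart theta x ct)).
apply: (nsqM_le M_countable h_smooth).
- by apply: smooth_on_measurable; exact: (pullR_smooth M_hausdorff ball_sub le14).
- by move=> p; rewrite /pullR; case: ifPn => // _; rewrite normr0 ltW.
- exact: test_L2f tf.
Qed.

Variable phih : 'rV[R]_n -> R.
Hypothesis cs_phih : cs x0 r phih.
Definition phi_lc f a x := phih x * lc F f x a ord0.
Definition local_scale (i : nat) : R := r / i.+1%:R.
Definition local_moll (i N : nat) f : section E :=
  pl F (fun a => avg (local_scale i) N (phi_lc f a)).

Lemma local_scale_gt0 i : 0 < local_scale i. Proof. by rewrite divr_gt0. Qed.

Lemma local_scale_le i : `|local_scale i| <= r.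
Proof.
by rewrite gtr0_norm ?local_scale_gt0// ler_pdivrMr// ler_peMr ?ler1n// ltW.
Qed.

Lemma phi_lc_cs f a : smooth_section S f -> cs x0 r (phi_lc f a).
Proof. exact: cut_lc_cs. Qed.

Lemma avg_phi_lc_cs i N f a : smooth_section S f ->
  cs x0 (2 * r) (avg (local_scale i) N (phi_lc f a)).
Proof.
move=> sf; apply: cs_le (cs_avg _ N (phi_lc_cs a sf)).
by rewrite mulr_natl mulr2n lerD2l local_scale_le.
Qed.

Lemma pl_phi_lc f : pl F (phi_lc f) = (fun p => (pullR F phih p)%:C%C *: f p).
Proof. by apply: pl_cutoff => x; exact: cs_off_chart. Qed.

Lemma cs24 (y : 'rV[R]_n -> R) : cs x0 (2 * r) y -> cs x0 (4 * r) y.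
Proof. by apply: cs_le; exact: (@le24 2). Qed.

Lemma cs12 (y : 'rV[R]_n -> R) : cs x0 r y -> cs x0 (2 * r) y.
Proof. by apply: cs_le; rewrite ler_peMl ?ler1n// ltW. Qed.

Lemma local_moll_test i N f : smooth_section S f -> test (local_moll i N f).
Proof.
move=> sf; apply: (pl_test M_hausdorff ball_sub (@le24 2 isT)) => a.
exact: avg_phi_lc_cs.
Qed.

Lemma phi_lcB f g a x : phi_lc (fun p => f p - g p) a x = phi_lc f a x - phi_lc g a x.
Proof.
rewrite /phi_lc; have [Vx|nV] := pselect (V x).
  by rewrite lcB// !mxE mulrBr.
by rewrite (cs_off_chart cs_phih nV) !mul0r subr0.
Qed.

Lemma local_mollB i N f g :
  local_moll i N (fun p => f p - g p) = (fun p => local_moll i N f p - local_moll i N g p).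
Proof.
rewrite /local_moll plB; apply: pl_ext => a x _; rewrite -avgB.
by apply: avg_ext => z; exact: phi_lcB.
Qed.

Lemma isq_phi_lc : exists2 C : R, 0 <= C &
  forall f, test f -> \sum_a isq (phi_lc f a) <= C * nsq f.
Proof.
have [C C0 HC] := isq_cut_lc cs_phih.
exists (K%:R * C); first by rewrite mulr_ge0.
move=> f tf; apply: le_trans (ler_sum _ (fun a _ => HC f a tf)) _.
by rewrite sumr_const card_ord -[leLHS]mulr_natl mulrA.
Qed.

Lemma local_moll_bounded : exists2 C : R, 0 <= C &
  forall i N f, test f -> nsq (local_moll i N f) <= C * nsq f.
Proof.
have [ka hka] := mu_smooth (fch_ok F).
have [C C0 HC] := nsq_pl_le M_hausdorff h_smooth ball_sub hka.
have [C' C'0 HC'] := isq_phi_lc.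
exists (C * C'); first exact: mulr_ge0.
move=> i N f tf; have [sf _] := tf.
apply: le_trans (HC _ _) _ => [a|]; first by apply: cs24; exact: avg_phi_lc_cs.
rewrite -mulrA; apply: ler_wpM2l => //; apply: le_trans (HC' f tf).
by apply: ler_sum => a _; apply: isq_avg; exact: cs_ccont (phi_lc_cs a sf).
Qed.

Section with_coefficients.
Variables (al : 'I_n -> 'I_K -> 'I_K -> 'rV[R]_n -> R) (be : 'I_K -> 'I_K -> 'rV[R]_n -> R).
Hypotheses (cs_al : forall j a b, cs x0 (4 * r) (al j a b))
  (cs_be : forall a b, cs x0 (4 * r) (be a b)).
Hypothesis D_pl : forall y, (forall a, cs x0 (2 * r) (y a)) -> D (pl F y) = pl F (opc al be y).
Hypothesis lc_D : forall u x a, smooth_section S u -> `|x - x0| <= 2 * r ->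
  lc F (D u) x a ord0 = opc al be (fun b x' => lc F u x' b ord0) a x.

(** The commutator of [D] with the multiplication by [phih]. It has order zero, the derivatives
    falling on the cutoff, as [phi_lc_D] shows by the product rule. *)
Definition phi_defect f a x :=
  \sum_(p : 'I_n * 'I_K) al p.1 a p.2 x * 'D_(e p.1) phih x * lc F f x p.2 ord0.

Lemma phi_lc_D f a x : smooth_section S f ->
  phi_lc (D f) a x = opc al be (phi_lc f) a x - phi_defect f a x.
Proof.
move=> sf; have [xr|xr] := leP `|x - x0| r; last first.
  rewrite /phi_lc /opc /phi_defect cs_phih.2// mul0r.
  rewrite !big1 ?addr0 ?subr0// => [p _|b _|p _].
  - by rewrite (derive_csupp p.1 cs_phih.2)// mulr0 mul0r.
  - by rewrite mul0r mulr0.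
  - by rewrite (derive_csupp p.1 (phi_lc_cs p.2 sf).2)// mulr0.
have Vx := sub1 xr.
rewrite {1}/phi_lc lc_D//; last by rewrite (le_trans xr)// ler_peMl ?ler1n// ltW.
rewrite /opc mulrDr [RHS]addrAC; congr (_ + _); last first.
  by rewrite mulr_sumr; apply: eq_bigr => b _; rewrite /phi_lc mulrCA.
rewrite /phi_defect mulr_sumr -sumrB; apply: eq_bigr => p _.
have d1 := cs_derivable (x := x) (j := p.1) cs_phih.
have d2 := smooth_derivable (j := p.1) (lc_smooth F p.2 sf) Vx.
rewrite (_ : phi_lc f p.2 = phih * (fun x' => lc F f x' p.2 ord0)); last by apply/funext.
rewrite (deriveM d1 d2) /GRing.scale /=; ring.
Qed.

Lemma isq_phi_defect : exists2 C : R, 0 <= C &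
  forall f a, test f -> isq (phi_defect f a) <= C * nsq f.
Proof.
have cz a (p : 'I_n * 'I_K) : cs x0 r (fun x => al p.1 a p.2 x * 'D_(e p.1) phih x).
  by apply: csMl; [have [] := cs_al p.1 a p.2|exact: cs_derive].
have [C C0 HC] : exists2 C : R, 0 < C & forall (ap : 'I_K * ('I_n * 'I_K)) f a, test f ->
    isq (fun x => al ap.2.1 ap.1 ap.2.2 x * 'D_(e ap.2.1) phih x * lc F f x a ord0) <= C * nsq f.
  apply: uniform_constant => [ap B B' h1 BB f a tf|ap].
    by apply: le_trans (h1 f a tf) _; apply: ler_wpM2r => //; exact: nsq_ge0.
  have [C C0 HC] := isq_cut_lc (cz ap.1 ap.2); exists (C + 1); first by rewrite ltr_wpDl.
  move=> f a tf; apply: le_trans (HC f a tf) _; apply: ler_wpM2r; first exact: nsq_ge0.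
  by rewrite lerDl.
exists (#|{: 'I_n * 'I_K}|%:R * (#|{: 'I_n * 'I_K}|%:R * C)).
  by rewrite mulr_ge0// mulr_ge0// ltW.
move=> f a tf; have [sf _] := tf.
apply: le_trans (isq_sum _) _ => [p|]; first exact: cs_ccont (cut_lc_cs _ (cz _ _) sf).
rewrite -mulrA; apply: ler_wpM2l => //.
apply: le_trans (ler_sum _ (fun p _ => HC (a, p) f p.2 tf)) _.
by rewrite sumr_const -[leLHS]mulr_natl mulrA.
Qed.

Lemma phi_defect_cs f a : smooth_section S f -> cs x0 r (phi_defect f a).
Proof.
move=> sf; apply: cs_sum => p; apply: cut_lc_cs => //.
by apply: csMl; [have [] := cs_al p.1 a p.2|exact: cs_derive].
Qed.

Lemma local_moll_cvg f (eta : R) : test f -> 0 < eta ->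
  exists i0, forall i N, (i0 <= i)%N ->
    nsq (fun p => local_moll i N f p - (pullR F phih p)%:C%C *: f p) <= eta /\
    nsq (fun p => D (local_moll i N f) p - D (fun q => (pullR F phih q)%:C%C *: f q) p) <= eta.
Proof.
move=> [sf _] eta0; have [ka hka] := mu_smooth (fch_ok F).
have [C C0 HC] := nsq_pl_le M_hausdorff h_smooth ball_sub hka.
have CK : 0 < C * K%:R + 1 by rewrite ltr_wpDl// mulr_ge0.
have [|d d0 Hd] := opc_approx cs_al cs_be r0 (fun b => phi_lc_cs b sf) (eta := eta / (C * K%:R + 1)).
  by rewrite divr_gt0.
exists (Num.truncn (r / d)) => i N ii.
have [] := Hd (local_scale i) N _ (local_scale_le i).
  rewrite gtr0_norm ?local_scale_gt0// /local_scale ler_pdivrMr// mulrC -ler_pdivrMr//.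
  by apply/ltW; apply: (lt_le_trans (truncnS_gt (r / d))); rewrite ler_nat ltnS.
move=> h1 h2; have fin (y : 'I_K -> 'rV[R]_n -> R) : (forall a, cs x0 (2 * r) (y a)) ->
    (forall a, isq (y a) <= eta / (C * K%:R + 1)) -> nsq (pl F y) <= eta.
  move=> cy hy; apply: le_trans (HC _ (fun a => cs24 (cy a))) _.
  apply: le_trans (ler_wpM2l C0 (ler_sum _ (fun a _ => hy a))) _.
  rewrite sumr_const card_ord -mulrnAl mulrA ler_pdivrMr// mulrnAr -mulrnAl -[C *+ K]mulr_natr.
  by rewrite [leRHS]mulrC ler_wpM2r ?(ltW eta0)// lerDl.
have cA a := avg_phi_lc_cs i N a sf; have cP a := cs12 (phi_lc_cs a sf).
have -> : (fun p => local_moll i N f p - (pullR F phih p)%:C%C *: f p) =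
    pl F (fun a x => avg (local_scale i) N (phi_lc f a) x - phi_lc f a x).
  by rewrite -plB pl_phi_lc.
rewrite -pl_phi_lc /local_moll D_pl// D_pl// plB.
by split; apply: fin => // a; apply: csB => //; exact: opc_cs.
Qed.

(** The commutator of [D] with the mollifier is the commutator of [opc] with the average, on the
    cut-off coordinates, plus the average of [phi_defect f]. Both are bounded uniformly in the
    scale. *)
Lemma local_moll_commutator : exists2 C : R, 0 <= C &
  forall i f (eta : R), test f -> 0 < eta ->
  exists N0, forall N, (N0 <= N)%N ->
    nsq (fun p => D (local_moll i N f) p - local_moll i N (D f) p) <= C * nsq f + eta.
Proof.
have [ka hka] := mu_smooth (fch_ok F).
have [C C0 HC] := nsq_pl_le M_hausdorff h_smooth ball_sub hka.
have [C1 C10 HC1] := opc_commutator r0 cs_al cs_be.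
have [C2 C20 HC2] := isq_phi_lc.
have [C3 C30 HC3] := isq_phi_defect.
have CK : 0 < 2 * C * K%:R + 1 by rewrite ltr_wpDl// mulr_ge0// mulr_ge0.
exists (C * (K%:R * (2 * (C1 * C2) + 2 * C3))).
  by rewrite !(mulr_ge0, addr_ge0).
move=> i f eta tf eta0; have [sf _] := tf.
have e0 : local_scale i != 0 by rewrite gt_eqF// local_scale_gt0.
have [|N0 HN0] := HC1 _ _ (eta / (2 * C * K%:R + 1)) (fun b => phi_lc_cs b sf) e0 (local_scale_le i).
  by rewrite divr_gt0.
exists N0 => N /HN0 HN; set q := eta / _ in HN.
have cA a := avg_phi_lc_cs i N a sf.
have sDf := smooth_section_D D_diff sf.
have cO a : cs x0 r (opc al be (phi_lc f) a) by apply: opc_cs => // b; exact: phi_lc_cs.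
have cAO a : cs x0 (2 * r) (avg (local_scale i) N (opc al be (phi_lc f) a)).
  apply: cs_le (cs_avg _ N (cO a)); by rewrite mulr_natl mulr2n lerD2l local_scale_le.
have cAZ a : cs x0 (2 * r) (avg (local_scale i) N (phi_defect f a)).
  apply: cs_le (cs_avg _ N (phi_defect_cs a sf)).
  by rewrite mulr_natl mulr2n lerD2l local_scale_le.
rewrite /local_moll D_pl// plB.
have -> : pl F (fun a x => opc al be (fun a0 => avg (local_scale i) N (phi_lc f a0)) a x -
      avg (local_scale i) N (phi_lc (D f) a) x) =
    pl F (fun a x => (opc al be (fun a0 => avg (local_scale i) N (phi_lc f a0)) a x -
      avg (local_scale i) N (opc al be (phi_lc f) a) x) + avg (local_scale i) N (phi_defect f a) x).
  apply: pl_ext => a x _; rewrite (_ : avg _ _ (phi_lc (D f) a) x = avg (local_scale i) N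
    (fun x' => opc al be (phi_lc f) a x' - phi_defect f a x') x); last first.
    by apply: avg_ext => x'; exact: phi_lc_D.
  by rewrite avgB opprB addrA addrAC.
have cX a : cs x0 (2 * r) (fun x => opc al be (fun a0 => avg (local_scale i) N (phi_lc f a0)) a x -
      avg (local_scale i) N (opc al be (phi_lc f) a) x).
  by apply: csB => //; exact: opc_cs.
apply: le_trans (HC _ _) _ => [a|]; first by apply: cs24; exact: csD.
have bnd a : isq (fun x => (opc al be (fun a0 => avg (local_scale i) N (phi_lc f a0)) a x -
      avg (local_scale i) N (opc al be (phi_lc f) a) x) + avg (local_scale i) N (phi_defect f a) x)
    <= 2 * (C1 * (C2 * nsq f) + q) + 2 * (C3 * nsq f).
  apply: le_trans (isqD (cs_ccont (cX a)) (cs_ccont (cAZ a))) _.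
  apply: lerD; apply: ler_wpM2l => //.
    apply: le_trans (HN a) _; rewrite lerD2r; apply: ler_wpM2l => //; exact: HC2.
  apply: le_trans (HC3 f a tf); apply: isq_avg; exact: cs_ccont (phi_defect_cs a sf).
apply: le_trans (ler_wpM2l C0 (ler_sum _ (fun a _ => bnd a))) _.
rewrite sumr_const card_ord -[X in C * X <= _]mulr_natl.
have -> : C * (K%:R * (2 * (C1 * (C2 * nsq f) + q) + 2 * (C3 * nsq f))) =
    C * (K%:R * (2 * (C1 * C2) + 2 * C3)) * nsq f + (2 * C * K%:R) * q by ring.
rewrite lerD2l /q mulrA ler_pdivrMr// mulrC ler_pM2l// lerDl//.
Qed.

(** The weak bound is tested on [psi = pl F v], built so that its pairing with [g] is [Y], the
    square norm of the averaged coordinates. By [opc_smoothing] the graph norm of [psi] is bounded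
    by [Y] at this scale, so for small [s] its contribution is absorbed and [Y] is bounded by a
    multiple of [d]. *)
Lemma local_moll_weak i : exists2 C : R, 0 <= C &
  forall g (d eta : R), test g -> 0 <= d -> 0 < eta ->
  (forall psi (s : R), test psi -> 0 < s -> rin psi g <= s * (nsq psi + nsq (D psi)) + d / s) ->
  exists N0, forall N, (N0 <= N)%N -> nsq (local_moll i N g) <= C * d + eta.
Proof.
have [ka hka] := mu_smooth (fch_ok F); have [ska ka0 _] := hka.
have [C C0 HC] := nsq_pl_le M_hausdorff h_smooth ball_sub hka.
pose eps := local_scale i.
have e0 : eps != 0 by rewrite gt_eqF// local_scale_gt0.
(* The inverses of the density and of the Gram matrix cancel these two factors of the intrinsic
   pairing; [phih] restores the cutoff in [phi_lc g]. *)
pose m a b x := phih x * ((ka x)^-1 * invmx (gram F h x) b a).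
have cm a b : cs x0 r (m a b).
  apply: (cs_cutoff oV sub1 cs_phih); apply: smoothM => //.
    by apply: smoothV => // x /ka0/gt_eqF/negbT.
  apply: smooth_invmx => //; first by move=> a' b'; exact: gram_smooth.
  by move=> x Vx; exact: gram_unit.
have [C1 C10 HC1] := opc_smoothing r0 cs_al cs_be cm e0 (local_scale_le i).
(* With this weight the terms in [Y] on the right have coefficient at most one half. *)
pose s : R := (4 * (C * C1 + 1))^-1.
have CC : 0 < C * C1 + 1 by rewrite ltr_wpDl// mulr_ge0.
have s0 : 0 < s by rewrite invr_gt0 mulr_gt0.
have sC : s * (2 * (C * C1)) <= 2^-1.
  rewrite /s mulrC ler_pdivrMr ?mulr_gt0//; lra.
have C2 : 0 < C * (2 * (s * C)) + 1 by rewrite ltr_wpDl// !mulr_ge0// ltW.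
exists (C * (2 / s)); first by rewrite !mulr_ge0// invr_ge0 ltW.
move=> g d eta tg d0 eta0 weak; have [sg _] := tg.
pose eta1 := eta / (C * (2 * (s * C)) + 1).
have eta10 : 0 < eta1 by rewrite divr_gt0.
have [N0 HN0] := HC1 (phi_lc g) eta1 (fun a => phi_lc_cs a sg) eta10.
exists N0 => N NN.
pose v a x := \sum_b m a b x * avg (- eps) N (avg eps N (phi_lc g b)) x.
have [hv1 hv2] : \sum_a isq (v a) <= C1 * (\sum_b isq (avg eps N (phi_lc g b))) /\
    \sum_a isq (opc al be v a) <= C1 * (\sum_b isq (avg eps N (phi_lc g b))) + eta1.
  exact: HN0.
pose y a := avg eps N (phi_lc g a); pose z a := avg (- eps) N (y a).
have cy a : cs x0 (2 * r) (y a) by exact: avg_phi_lc_cs.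
have cz a : cs x0 (2 * r + `|- eps|) (z a) by exact: cs_avg.
have cv a : cs x0 r (v a).
  by apply: cs_sum => b; apply: cs_ext (csMl (cz b).1 (cm a b)) => x; rewrite mulrC.
have Y0 : 0 <= \sum_a isq (y a) by apply: sumr_ge0 => a _; exact: isq_ge0.
(* After the cancellation the integrand is [phi_lc g] times two averages, at [eps] and [- eps];
   adjointness moves the outer one back, leaving the square of [y]. *)
have pairE : rin (pl F v) g = \sum_a isq (y a).
  rewrite (rin_pl h_smooth ball_sub hka le14 cv sg).
  transitivity (Int (fun x => \sum_b phi_lc g b x * z b x)).
    congr Int; apply/funext => x; rewrite /pairing; have [xr|xr] := leP `|x - x0| r; last first.
      rewrite big1 ?mulr0 => [|a _]; last by rewrite big1// => b _; rewrite (cv a).2// mul0r.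
      by rewrite big1// => b _; rewrite /phi_lc cs_phih.2// !mul0r.
    have Vx := sub1 xr; have kx : ka x != 0 by rewrite gt_eqF// ka0.
    rewrite exchange_big mulr_sumr; apply: eq_bigr => b _ /=.
    under eq_bigr => a _ do rewrite mulrA.
    rewrite -mulr_suml.
    have -> : \sum_a v a x * gram F h x a b = phih x * (ka x)^-1 * z b x.
      under eq_bigr => a _ do rewrite mulr_suml.
      rewrite exchange_big /=.
      transitivity (\sum_b' phih x * (ka x)^-1 * z b' x * (invmx (gram F h x) *m gram F h x) b' b).
        apply: eq_bigr => b' _; rewrite !mxE mulr_sumr; apply: eq_bigr => a _.
        rewrite /m -/(y b') -/(z b'); ring.
      rewrite mulVmx ?gram_unit// (bigD1 b)//= mxE eqxx mulr1 big1 ?addr0// => b' bb.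
      by rewrite mxE (negbTE bb) mulr0.
    by rewrite /phi_lc; field.
  rewrite Int_sum => [|b]; last first.
    apply: (@cs_ccont _ _ x0 r).
    by apply: cs_ext (csMl (cz b).1 (phi_lc_cs b sg)) => x; rewrite mulrC.
  apply: eq_bigr => b _; rewrite /z -Int_avg_adj//.
    exact: cs_ccont (phi_lc_cs b sg).
  exact: cs_ccont (cy b).
have tv : test (pl F v) by exact: (pl_test M_hausdorff ball_sub le14).
have := weak _ _ tv s0; rewrite pairE D_pl; last by move=> a; apply: cs12.
have cO a : cs x0 r (opc al be v a) by exact: opc_cs.
have n1 := le_trans (HC v (fun a => cs_le le14 (cv a))) (ler_wpM2l C0 hv1).
have n2 := le_trans (HC _ (fun a => cs_le le14 (cO a))) (ler_wpM2l C0 hv2).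
have n3 := HC _ (fun a => cs24 (cy a)).
rewrite -/eps -/(y _) in n1 n2.
move: n1 n2 n3; rewrite -[local_moll i N g]/(pl F y).
have -> : \sum_c isq (avg eps N (phi_lc g c)) = \sum_a isq (y a) by [].
move: Y0; set Y := \sum_a isq (y a); set A1 := nsq _; set A2 := nsq _; set A3 := nsq _.
move=> Y0 n1 n2 n3 wk.
have wk2 : Y <= s * (C * (C1 * Y) + C * (C1 * Y + eta1)) + d / s.
  by apply: le_trans wk _; rewrite lerD2r; apply: ler_wpM2l; [exact: ltW|exact: lerD].
have wk3 : Y <= 2 * (d / s) + 2 * (s * C) * eta1.
  have := ler_wpM2r Y0 sC; move: wk2.
  have -> : s * (C * (C1 * Y) + C * (C1 * Y + eta1)) = s * (2 * (C * C1)) * Y + s * C * eta1.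
    by ring.
  lra.
apply: le_trans n3 _; apply: le_trans (ler_wpM2l C0 wk3) _.
have -> : C * (2 * (d / s) + 2 * (s * C) * eta1) = C * (2 / s) * d + C * (2 * (s * C)) * eta1.
  by field; rewrite gt_eqF.
rewrite lerD2l /eta1 [leLHS]mulrA ler_pdivrMr// [leLHS]mulrC ler_pM2l// lerDl//.
Qed.

End with_coefficients.

Lemma local_mollifier : mollifier S h mu D local_moll (pullR F phih).
Proof.
have [al [be [cs_al cs_be D_pl lc_D]]] := frame_operator M_hausdorff D_diff r0 ball_sub.
split.
- exact: (pullR_smooth M_hausdorff ball_sub le14 cs_phih).
- by move=> i N f [sf _]; exact: local_moll_test.
- by move=> i N f g _ _; exact: local_mollB.
- exact: local_moll_bounded.
- by move=> f eta; exact: (local_moll_cvg cs_al cs_be D_pl).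
- exact: (local_moll_commutator cs_al cs_be D_pl lc_D).
- exact: (local_moll_weak cs_al cs_be D_pl).
Qed.

End local_mollifier.

(** * Gluing and approximation *)

Section mollifier_sums.
Context {R : realType} {M : ptopologicalType} {n k : nat} {A : smooth_atlas R M n}.
Context {E : M -> lmodType R[i]} {S : vector_bundle A k E}.
Variables (h : hermitian_structure E) (mu : {measure set (borel M) -> \bar R}).
Hypotheses (M_hausdorff : hausdorff_space M) (M_countable : @second_countable M).
Hypothesis mu_smooth : nowhere_vanishing_smooth A mu.
Hypothesis h_smooth : smooth_hermitian S h.
Variable D : section E -> section E.
Hypothesis D_diff : differential_operator S D.
Local Notation test := (compactly_supported_smooth S).
Local Notation nsq := (nsq h mu).
Local Notation rin := (rin h mu).
Local Notation L2f := (@L2f R M n k A E S h mu).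
Local Notation mollifier := (mollifier S h mu D).
Implicit Types (u v f g : section E).

Let tL2 u : test u -> L2f u. Proof. exact: test_L2f. Qed.

Lemma nsq0 : nsq (fun=> 0) = 0.
Proof.
have t0 : L2f (fun=> 0) by exact/tL2/test0.
have := rinBl M_countable h_smooth t0 t0 t0; rewrite subrr.
by have -> : (fun p => (0 : E p) - 0) = (fun=> 0) by apply: section_ext => p; rewrite subr0.
Qed.

Lemma D_add u v : smooth_section S u -> smooth_section S v ->
  D (fun p => u p + v p) = (fun p => D u p + D v p).
Proof.
move=> su sv; have [_ H _ _] := D_diff; have := H 1 u v su sv.
have -> : (fun p => 1 *: u p + v p) = (fun p => u p + v p).
  by apply: section_ext => p; rewrite scale1r.
by move=> ->; apply: section_ext => p; rewrite scale1r.
Qed.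

Lemma mollifier0 : mollifier (fun _ _ _ => fun=> 0) (fun=> 0).
Proof.
have z f : (fun q => (0 : R)%:C%C *: f q) = (fun=> 0).
  by apply: section_ext => p; rewrite scale0r.
have zB : (fun p => (0 : E p) - 0) = (fun=> 0) by apply: section_ext => p; rewrite subr0.
split.
- exact: smooth_on_cst.
- by move=> *; exact: test0.
- by move=> *; rewrite zB.
- by exists 0 => // i N f _; rewrite nsq0 mul0r.
- move=> f eta _ eta0; exists 0%N => i N _; rewrite z.
  have -> : (fun p => 0 - (0 : R)%:C%C *: f p) = (fun=> 0).
    by apply: section_ext => p; rewrite scale0r subr0.
  have -> : (fun p => D (fun=> 0) p - D (fun=> 0) p) = (fun=> 0).
    by apply: section_ext => p; rewrite subrr.
  by rewrite nsq0; split; exact: ltW.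
- exists 0 => // i f eta _ eta0; exists 0%N => N _; rewrite (D_zero D_diff) zB nsq0 mul0r add0r.
  exact: ltW.
- move=> i; exists 0 => // g d eta _ _ eta0 _; exists 0%N => N _.
  by rewrite nsq0 mul0r add0r ltW.
Qed.

(** Every estimate survives addition up to the factor 2 of [nsqD_le], so each summand is given a
    quarter of the tolerance. The weak hypothesis on [g] involves no mollifier and serves both
    summands. *)
Lemma mollifierD (T T' : nat -> nat -> section E -> section E) (phi phi' : M -> R) :
  mollifier T phi -> mollifier T' phi' ->
  mollifier (fun i N f p => T i N f p + T' i N f p) (fun p => phi p + phi' p).
Proof.
move=> m m'; have nsqD u v a b : test u -> test v -> nsq u <= a -> nsq v <= b ->
    nsq (fun p => u p + v p) <= 2 * a + 2 * b.
  move=> tu tv ua vb; apply: le_trans (nsqD_le M_countable h_smooth (tL2 tu) (tL2 tv)) _.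
  by apply: lerD; apply: ler_wpM2l.
have quarter (eta : R) : 2 * (eta / 4) + 2 * (eta / 4) = eta by field.
have tD := test_D D_diff.
have tM (f : M -> R) u : smooth_on A setT f -> test u -> test (fun p => (f p)%:C%C *: u p).
  exact: testM.
have tT := moll_test m; have tT' := moll_test m'.
split.
- by apply: smooth_onD; [exact: openT|exact: moll_smooth m|exact: moll_smooth m'].
- by move=> i N f tf; apply: testD; [exact: tT|exact: tT'].
- move=> i N f g tf tg; rewrite (moll_sub m)// (moll_sub m')//.
  by apply: section_ext => p; rewrite opprD addrACA.
- have [C C0 HC] := moll_bounded m; have [C' C'0 HC'] := moll_bounded m'.
  exists (2 * C + 2 * C'); first by rewrite addr_ge0// mulr_ge0.
  move=> i N f tf; rewrite mulrDl -!mulrA; apply: nsqD; [exact: tT|exact: tT'|exact: HC|exact: HC'].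
- move=> f eta tf eta0; have e4 : 0 < eta / 4 by rewrite divr_gt0.
  have [i0 H0] := moll_cvg m tf e4; have [i1 H1] := moll_cvg m' tf e4.
  exists (maxn i0 i1) => i N; rewrite geq_max => /andP[/(H0 i N)[h1 h2] /(H1 i N)[h3 h4]].
  have sphi := moll_smooth m; have sphi' := moll_smooth m'.
  have -> : (fun p => T i N f p + T' i N f p - (phi p + phi' p)%:C%C *: f p) =
      (fun p => (T i N f p - (phi p)%:C%C *: f p) + (T' i N f p - (phi' p)%:C%C *: f p)).
    by apply: section_ext => p; rewrite rmorphD scalerDl opprD addrACA.
  have -> : (fun p => D (fun q => T i N f q + T' i N f q) p -
        D (fun q => (phi q + phi' q)%:C%C *: f q) p) =
      (fun p => (D (T i N f) p - D (fun q => (phi q)%:C%C *: f q) p) +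
                (D (T' i N f) p - D (fun q => (phi' q)%:C%C *: f q) p)).
    have -> : (fun q => (phi q + phi' q)%:C%C *: f q) =
        (fun q => (phi q)%:C%C *: f q + (phi' q)%:C%C *: f q).
      by apply: section_ext => q; rewrite rmorphD scalerDl.
    rewrite (D_add (tT i N f tf).1 (tT' i N f tf).1).
    rewrite (D_add (tM _ _ sphi tf).1 (tM _ _ sphi' tf).1).
    by apply: section_ext => p; rewrite opprD addrACA.
  rewrite -(quarter eta); split; apply: nsqD => //; apply: testB; rewrite //.
  + exact: tT.
  + exact: tM.
  + exact: tT'.
  + exact: tM.
  + exact/tD/tT.
  + exact/tD/tM.
  + exact/tD/tT'.
  + exact/tD/tM.
- have [C C0 HC] := moll_commutator m; have [C' C'0 HC'] := moll_commutator m'.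
  exists (2 * C + 2 * C'); first by rewrite addr_ge0// mulr_ge0.
  move=> i f eta tf eta0; have e4 : 0 < eta / 4 by rewrite divr_gt0.
  have [N0 H0] := HC i f _ tf e4; have [N1 H1] := HC' i f _ tf e4.
  exists (maxn N0 N1) => N; rewrite geq_max => /andP[/H0 h1 /H1 h2].
  have -> : (fun p => D (fun q => T i N f q + T' i N f q) p - (T i N (D f) p + T' i N (D f) p)) =
      (fun p => (D (T i N f) p - T i N (D f) p) + (D (T' i N f) p - T' i N (D f) p)).
    rewrite (D_add (tT i N f tf).1 (tT' i N f tf).1).
    by apply: section_ext => p; rewrite opprD addrACA.
  have -> : (2 * C + 2 * C') * nsq f + eta =
      2 * (C * nsq f + eta / 4) + 2 * (C' * nsq f + eta / 4) by field.
  apply: nsqD => //; apply: testB.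
  + exact/tD/tT.
  + exact/tT/tD.
  + exact/tD/tT'.
  + exact/tT'/tD.
- move=> i; have [C C0 HC] := moll_weak m i; have [C' C'0 HC'] := moll_weak m' i.
  exists (2 * C + 2 * C'); first by rewrite addr_ge0// mulr_ge0.
  move=> g d eta tg d0 eta0 weak; have e4 : 0 < eta / 4 by rewrite divr_gt0.
  have [N0 H0] := HC g d _ tg d0 e4 weak; have [N1 H1] := HC' g d _ tg d0 e4 weak.
  exists (maxn N0 N1) => N; rewrite geq_max => /andP[/H0 h1 /H1 h2].
  have -> : (2 * C + 2 * C') * d + eta = 2 * (C * d + eta / 4) + 2 * (C' * d + eta / 4) by field.
  by apply: nsqD => //; [exact: tT|exact: tT'].
Qed.

Definition bump_domain (P : set M) : Prop :=
  exists (F : frame S) (x0 : 'rV[R]_n) (r : R) (b : 'rV[R]_n -> R),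
    [/\ 0 < r, [set x | `|x - x0| <= 4 * r] `<=` cimg (fch F), cs x0 r b,
        forall x, 0 <= b x <= 1 & forall q, P q -> pullR F b q = 1].

Lemma bump_domain_exists (p : M) : exists P : set M, [/\ open P, P p & bump_domain P].
Proof.
have [F cp] := frame_exists S p; have [d d0 dV] := chart_ball cp.
pose r := d / 4; have r0 : 0 < r by rewrite divr_gt0.
have [|b [cb b01 b1]] := @cs_bump R n (cmap (fch F) p) (r / 2); first by rewrite divr_gt0.
pose B := ball (cmap (fch F) p) (r / 2).
exists (cdom (fch F) `&` cmap (fch F) @^-1` B); split.
- rewrite openE => q [cq Bq]; apply: filterI.
    by apply: open_nbhs_nbhs; split=> //; exact: cdom_open.
  apply: (cmap_continuous cq); apply: open_nbhs_nbhs; split=> //.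
  by apply: ball_open; rewrite divr_gt0.
- by split=> //; apply: ballxx; rewrite divr_gt0.
exists F, (cmap (fch F) p), r, b; split=> //.
- by apply: subset_trans dV => x /=; rewrite /r mulrC divfK.
- by apply: cs_le cb; rewrite mulrC divfK.
move=> q [cq]; rewrite /= /B -ball_normE /= distrC => /ltW hq.
by rewrite /pullR mem_set// b1.
Qed.

(** Each new frame receives the cutoff [b * (1 - phi)]. Then [phi + b * (1 - phi)] stays between 0
    and 1 and equals 1 wherever [phi] or [b] does, so no division by a sum of bumps occurs. *)
Lemma cover_mollifier (P : M -> set M) (s : seq M) : (forall p, bump_domain (P p)) ->
  exists (T : nat -> nat -> section E -> section E) (phi : M -> R) (Q : set M),
  [/\ mollifier T phi, forall q, 0 <= phi q <= 1,
      forall p q, p \in s -> P p q -> phi q = 1,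
      compact Q & forall q, ~ Q q -> phi q = 0].
Proof.
move=> HP; elim: s => [|p s [T [phi [Q [mT phi01 phi1 cQ phi0]]]]].
  exists (fun _ _ _ => fun=> 0), (fun=> 0), set0; split=> //; first exact: mollifier0.
    by move=> q; rewrite lexx ler01.
  exact: compact0.
have [F [x0 [r [b [r0 rV cb b01 b1]]]]] := HP p.
pose g x := b x * (1 - phi (cinv (fch F) x)).
have sub1 := ball_sub_le rV (le14 r0).
have cg : cs x0 r g.
  apply: (@cs_cutoff _ _ x0 r _ b (fun x => 1 - phi (cinv (fch F) x)) _ sub1 cb).
    exact: cimg_open.
  apply: smoothB; [exact: cimg_open|exact: smooth_cst|].
  have := moll_smooth mT (fch_ok F); rewrite chart_imgT; exact.
have gE q : pullR F g q = pullR F b q * (1 - phi q).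
  rewrite /pullR; case: ifPn => [/set_mem cq|_]; last by rewrite mul0r.
  by rewrite /g cmapK.
have pb01 q : 0 <= pullR F b q <= 1.
  by rewrite /pullR; case: ifPn => // _; rewrite lexx ler01.
have mg := local_mollifier M_hausdorff M_countable mu_smooth h_smooth D_diff r0 rV cg.
exists (fun i N f q => T i N f q + local_moll F r g i N f q), (fun q => phi q + pullR F g q),
  (Q `|` cinv (fch F) @` [set x | `|x - x0| <= r]); split.
- exact: mollifierD.
- move=> q; rewrite gE; have /andP[h1 h2] := phi01 q; have /andP[h3 h4] := pb01 q.
  by apply/andP; split; nra.
- move=> p' q; rewrite in_cons gE => /orP[/eqP -> /b1 ->|ps Pq]; first by rewrite mul1r subrKC.
  by rewrite (phi1 p' q ps Pq) subrr mulr0 addr0.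
- by apply: compactU => //; exact: compact_chart_image.
- move=> q nq; rewrite phi0 ?add0r; last by move=> Qq; apply: nq; left.
  rewrite /pullR; case: ifPn => // /set_mem cq; rewrite cg.2// ltNge; apply/negP => h1.
  by apply: nq; right; exists (cmap (fch F) q) => //; exact: cmapK.
Qed.

Lemma compact_mollifier (Q : set M) : compact Q ->
  exists (T : nat -> nat -> section E -> section E) (phi : M -> R) (O Q' : set M),
  [/\ mollifier T phi, forall q, 0 <= phi q <= 1,
      open O /\ Q `<=` O, forall q, O q -> phi q = 1 &
      compact Q' /\ forall q, ~ Q' q -> phi q = 0].
Proof.
move=> cQ; have /choice[P HP] := bump_domain_exists.
have [|s [_ Qs]] := @compact_finite_cover M Q P cQ; first by move=> p _; have [] := HP p.
have [|T [phi [Q' [mT phi01 phi1 cQ' phi0]]]] := @cover_mollifier P s.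
  by move=> p; have [] := HP p.
exists T, phi, (\bigcup_(p in [set p | p \in s]) P p), Q'; split=> //.
- split; last by move=> q /Qs[p ps Pq]; exists p.
  by apply: bigcup_open => p _; have [] := HP p.
- by move=> q [p /= ps Pq]; exact: phi1 Pq.
Qed.

End mollifier_sums.

(** * Approximation of a weak solution *)

Section friedrichs.
Context {R : realType} {M : ptopologicalType} {n k : nat} {A : smooth_atlas R M n}.
Context {E : M -> lmodType R[i]} {S : vector_bundle A k E}.
Variables (h : hermitian_structure E) (mu : {measure set (borel M) -> \bar R}).
Hypotheses (M_hausdorff : hausdorff_space M) (M_countable : @second_countable M).
Hypothesis mu_smooth : nowhere_vanishing_smooth A mu.
Hypothesis h_smooth : smooth_hermitian S h.
Variable D : section E -> section E.
Hypothesis D_diff : differential_operator S D.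
Local Notation test := (compactly_supported_smooth S).
Local Notation nsq := (nsq h mu).
Local Notation rin := (rin h mu).
Local Notation L2f := (@L2f R M n k A E S h mu).
Implicit Types (u v w f g : section E).

Let tL2 u : test u -> L2f u. Proof. exact: test_L2f. Qed.

Definition small (a : R) u : Prop := L2f u /\ nsq u <= a.

Lemma smallD a b u v : small a u -> small b v -> small (2 * (a + b)) (fun p => u p + v p).
Proof.
move=> [lu ua] [lv vb]; split; first exact: (L2fD M_countable h_smooth).
apply: le_trans (nsqD_le M_countable h_smooth lu lv) _.
by rewrite mulrDr; apply: lerD; apply: ler_wpM2l.
Qed.

Lemma small_le a b u : a <= b -> small a u -> small b u.
Proof. by move=> ab [lu ua]; split=> //; exact: le_trans ab. Qed.

Lemma small_trans a b u v w : small a (fun p => u p - v p) -> small b (fun p => v p - w p) ->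
  small (2 * (a + b)) (fun p => u p - w p).
Proof.
move=> h1 h2; have := smallD h1 h2.
by have -> : (fun p => u p - v p + (v p - w p)) = (fun p => u p - w p)
  by apply: section_ext => p; rewrite subrKA.
Qed.

Lemma small_sym a u v : small a (fun p => u p - v p) -> small a (fun p => v p - u p).
Proof.
move=> [lu ua]; have -> : (fun p => v p - u p) = (fun p => - (u p - v p)).
  by apply: section_ext => p; rewrite opprB.
by split; [exact: (L2fN M_countable h_smooth)|rewrite nsqN].
Qed.

Lemma nsq_ae u v : measurable_section S u -> measurable_section S v ->
  {ae mu, forall p : borel M, u p = v p} -> nsq u = nsq v.
Proof.
move=> mu_ mv uv; rewrite /nsq (rin_ae M_countable h_smooth mu_ mv mu_ uv) rinC.
exact: (rin_ae M_countable h_smooth mu_ mv mv uv).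
Qed.

Lemma L2_cvgP (x : nat -> section E) u : (forall m, L2f (fun p => x m p - u p)) ->
  L2_cvg h mu x u <->
  forall eta : R, 0 < eta -> exists m0, forall m, (m0 <= m)%N -> small eta (fun p => x m p - u p).
Proof.
move=> lx.
have E0 : (fun m => normsq h mu (fun p => x m p - u p)) =
    (EFin \o (fun m => nsq (fun p => x m p - u p))).
  by apply/funext => m; have [msx fin] := lx m; exact: (normsqE msx fin).
rewrite /L2_cvg E0; split=> [/fine_cvgP[_ /cvgrPdist_le cx] eta eta0|H].
  have [m0 _ Hm] := cx eta eta0; exists m0 => m /Hm /=.
  by rewrite sub0r normrN ger0_norm ?nsq_ge0// => hm; split.
apply/fine_cvgP; split; first exact: nearW.
apply/cvgrPdist_le => eta eta0; have [m0 Hm] := H eta eta0.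
exists m0 => // m /= /Hm[_ hm].
by rewrite sub0r normrN ger0_norm ?nsq_ge0.
Qed.

Lemma in_L2_small u : in_L2 S h mu u ->
  L2f u /\ exists2 x : nat -> section E, forall m, test (x m) &
    forall eta : R, 0 < eta ->
      exists m0, forall m, (m0 <= m)%N -> small eta (fun p => x m p - u p).
Proof.
move=> [mu_ nu [x tx cx]]; have lu : L2f u by split.
split=> //; exists x => //; apply/L2_cvgP => // m.
by apply: (L2fB M_countable h_smooth) => //; exact: tL2.
Qed.

Section approximation.
Variables (T : nat -> nat -> section E -> section E) (phi : M -> R).
Hypotheses (moll : mollifier S h mu D T phi) (phi01 : forall q, 0 <= phi q <= 1).
Variables (Q O : set M).
Hypotheses (Q_closed : closed Q) (QO : Q `<=` O)
  (phi1 : forall q, O q -> phi q = 1).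
Variables (u w : section E) (a b : nat -> section E).
Hypotheses (L2u : L2f u) (L2w : L2f w).
Hypotheses (a_test : forall m, test (a m)) (b_test : forall m, test (b m)).
Hypothesis a_supp : forall m q, ~ Q q -> a m q = 0.
Hypothesis a_cvg : forall eta : R, 0 < eta ->
  exists m0, forall m, (m0 <= m)%N -> small eta (fun p => a m p - u p).
Hypothesis b_cvg : forall eta : R, 0 < eta ->
  exists m0, forall m, (m0 <= m)%N -> small eta (fun p => b m p - w p).
Hypothesis D_sym : forall f g, test f -> test g -> rin (D f) g = rin f (D g).
Hypothesis weak : forall f, test f -> rin (D f) u = rin f w.

Lemma phi_scale f q : O q -> (phi q)%:C%C *: f q = f q.
Proof. by move=> /phi1 ->; rewrite scale1r. Qed.

Lemma phi_a m : (fun q => (phi q)%:C%C *: a m q) = a m.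
Proof.
apply: section_ext => q; have [/QO/phi_scale//|nQ] := pselect (Q q).
by rewrite a_supp// scaler0.
Qed.

(** By locality [D (a m)] also vanishes on the open complement of [Q]. *)
Lemma phi_Da m : (fun q => (phi q)%:C%C *: D (a m) q) = D (a m).
Proof.
apply: section_ext => q; have [/QO/phi_scale//|nQ] := pselect (Q q).
rewrite (D_local D_diff (U := ~` Q) (v := fun=> 0))//.
- by rewrite (D_zero D_diff) scaler0.
- exact: closed_openC.
- by have [] := a_test m.
- exact: smooth_section0.
- by move=> p; exact: a_supp.
Qed.

Lemma phi_small eta f : small eta f -> small eta (fun p => (phi p)%:C%C *: f p).
Proof.
move=> [lf fe]; have mphi := smooth_on_measurable (moll_smooth moll).
have p1 q : `|phi q| <= 1 by have /andP[h1 h2] := phi01 q; rewrite ger0_norm.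
split; first exact: (L2fM M_countable h_smooth mphi p1 lf).
apply: le_trans (nsqM_le M_countable h_smooth mphi p1 lf) _.
by rewrite expr1n mul1r.
Qed.

(** By symmetry of [D] on test sections and by [weak], the pairing is that of [D f] with [a m - u]
    minus that of [f] with [b m - w], and [rin_le] applies to both. This is the hypothesis of
    [moll_weak]. *)
Lemma weak_difference m f (s : R) : test f -> 0 < s ->
  rin f (fun p => D (a m) p - b m p) <=
  s * (nsq f + nsq (D f)) + (nsq (fun p => a m p - u p) + nsq (fun p => b m p - w p)) / s.
Proof.
move=> tf s0; have lf := tL2 tf; have lDf := tL2 (test_D D_diff tf).
have la := tL2 (a_test m); have lb := tL2 (b_test m).
have lau := L2fB M_countable h_smooth la L2u; have lbw := L2fB M_countable h_smooth lb L2w.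
have lDa := tL2 (test_D D_diff (a_test m)).
have -> : rin f (fun p => D (a m) p - b m p) =
    rin (D f) (fun p => a m p - u p) - rin f (fun p => b m p - w p).
  rewrite !(rinBr M_countable h_smooth)// -D_sym// weak//; ring.
have h1 := rin_le M_countable h_smooth s0 lDf lau.
have h2 := rin_le M_countable h_smooth s0 (L2fN M_countable h_smooth lf) lbw.
rewrite (rinNl M_countable h_smooth)// nsqN in h2.
rewrite mulrDl ![_ / s]mulrC; lra.
Qed.

(** Choices in order: [l] with [a l] and [b l] close to their limits; a scale [i] at which the
    mollifier is accurate on [a l], [D (a l)] and [b l]; then [m], in terms of the constant of
    [moll_weak] at that scale; the grid [N] last. The approximant is [T i N (a m)]. *)
Lemma friedrichs_approximation (eta : R) : 0 < eta -> exists x,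
  [/\ test x, small eta (fun p => x p - u p) &
      small eta (fun p => D x p - (phi p)%:C%C *: w p)].
Proof.
move=> eta0.
have [C1 C10 HC1] := moll_bounded moll; have [C3 C30 HC3] := moll_commutator moll.
have tT := moll_test moll; have tD := test_D D_diff.
(* The two factors 8 absorb the doublings that [smallD] accumulates in the final chains. *)
pose d := eta / (8 * (8 * (1 + C1 + C3))).
have CC : 0 < 1 + C1 + C3 by rewrite -addrA ltr_pwDl// addr_ge0.
have d0 : 0 < d by rewrite /d divr_gt0//; apply: mulr_gt0 => //; exact: mulr_gt0.
have dE : 8 * (8 * (d + C1 * d + C3 * d)) = eta by rewrite /d; field; rewrite gt_eqF.
have C1d : 0 <= C1 * d by rewrite mulr_ge0// ltW.
have C3d : 0 <= C3 * d by rewrite mulr_ge0// ltW.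
have [m0 Hm0] := a_cvg d0; have [m1 Hm1] := b_cvg d0.
pose l := maxn m0 m1.
have al : small d (fun p => a l p - u p) by apply: Hm0; exact: leq_maxl.
have bl : small d (fun p => b l p - w p) by apply: Hm1; exact: leq_maxr.
have [i0 Hi0] := moll_cvg moll (a_test l) d0.
have [i1 Hi1] := moll_cvg moll (tD _ (a_test l)) d0.
have [i2 Hi2] := moll_cvg moll (b_test l) d0.
pose i := maxn i0 (maxn i1 i2).
have ii0 : (i0 <= i)%N by exact: leq_maxl.
have ii1 : (i1 <= i)%N by rewrite /i leq_max leq_maxl orbT.
have ii2 : (i2 <= i)%N by rewrite /i leq_max leq_maxr orbT.
(* [C5] depends on the scale, which is why [m] is taken only after [i]; the tolerance below makes
   [C5 * d5] at most [d]. *)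
have [C5 C50 HC5] := moll_weak moll i.
have d50 : 0 < d / (2 * C5 + 1) by rewrite divr_gt0// ltr_wpDl// mulr_ge0.
have [m2 Hm2] := a_cvg d50; have [m3 Hm3] := b_cvg d50.
pose m := maxn l (maxn m2 m3).
have lm : (l <= m)%N by exact: leq_maxl.
have am : small d (fun p => a m p - u p).
  by apply: Hm0; apply: leq_trans lm; exact: leq_maxl.
have bm : small d (fun p => b m p - w p).
  by apply: Hm1; apply: leq_trans lm; exact: leq_maxr.
have [_ am5] : small (d / (2 * C5 + 1)) (fun p => a m p - u p).
  by apply: Hm2; rewrite /m leq_max leq_maxl orbT.
have [_ bm5] : small (d / (2 * C5 + 1)) (fun p => b m p - w p).
  by apply: Hm3; rewrite /m leq_max leq_maxr orbT.
have taml := testB (a_test m) (a_test l).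
have tg : test (fun p => D (a m) p - b m p) by apply: testB => //; exact: tD.
pose d5 := nsq (fun p => a m p - u p) + nsq (fun p => b m p - w p).
have d5_ge0 : 0 <= d5 by rewrite addr_ge0// nsq_ge0.
have [N0 HN0] := HC3 i _ d taml d0.
have [N1 HN1] := HC5 _ d5 d tg d5_ge0 d0 (fun psi s => @weak_difference m psi s).
pose N := maxn N0 N1.
have smallT f c : test f -> small c f -> small (C1 * c) (T i N f).
  move=> tf [_ fc]; split; first exact/tL2/tT.
  by apply: le_trans (HC1 i N f tf) _; rewrite ler_wpM2l.
have aml : small (2 * (d + d)) (fun p => a m p - a l p).
  by apply: small_trans am _; exact: small_sym.
have bml : small (2 * (d + d)) (fun p => b m p - b l p).
  by apply: small_trans bm _; exact: small_sym.
(* The uniform commutator bound, applied to the small difference [a m - a l]. *)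
have e1 : small (C3 * (2 * (d + d)) + d) (fun p => (D (T i N (a m)) p - D (T i N (a l)) p) -
    (T i N (D (a m)) p - T i N (D (a l)) p)).
  have := HN0 N (leq_maxl _ _); rewrite (moll_sub moll)//.
  rewrite (D_sub D_diff (a_test m).1 (a_test l).1).
  rewrite (D_sub D_diff (tT i N _ (a_test m)).1 (tT i N _ (a_test l)).1).
  rewrite (moll_sub moll i N (tD _ (a_test m)) (tD _ (a_test l))) => hN.
  split; first by apply: tL2; apply: testB; apply: testB; do ?apply: tD; do ?apply: tT; do ?apply: tD.
  apply: le_trans hN _; rewrite lerD2r; apply: ler_wpM2l => //; exact: aml.2.
have tTal : test (T i N (a l)) by exact: tT.
have [Hal HDal] := Hi0 i N ii0; have [HTDal _] := Hi1 i N ii1; have [Hbl _] := Hi2 i N ii2.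
rewrite phi_a in HDal.
(* On the fixed section [a l] the commutator is small because [D T] and [T D] both approach
   [D (a l)], [phi] being 1 on [Q]; see also [e3]. *)
have e2 : small d (fun p => D (T i N (a l)) p - D (a l) p).
  by split=> //; apply: tL2; apply: testB; exact: tD.
have phiDE f : (fun p => f p - (phi p)%:C%C *: D (a l) p) = (fun p => f p - D (a l) p).
  have := phi_Da l => e0; apply: section_ext => p; congr (_ - _).
  by rewrite -[in RHS]e0.
have phiaE f : (fun p => f p - (phi p)%:C%C *: a l p) = (fun p => f p - a l p).
  have := phi_a l => e0; apply: section_ext => p; congr (_ - _).
  by rewrite -[in RHS]e0.
rewrite phiDE in HTDal; rewrite phiaE in Hal.
have e3 : small d (fun p => T i N (D (a l)) p - D (a l) p).
  by split=> //; apply: tL2; apply: testB; [apply: tT|]; exact: tD.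
(* The difference [D (a m) - b m] is not controlled in L^2; only its weak smallness is, and the
   mollifier at the fixed scale converts it. *)
have e4 : small (2 * d) (fun p => T i N (D (a m)) p - T i N (b m) p).
  have := HN1 N (leq_maxr _ _); rewrite (moll_sub moll)//; last exact: tD.
  move=> hN; split; first by apply: tL2; apply: testB; apply: tT => //; exact: tD.
  apply: le_trans hN _.
  have : C5 * d5 <= C5 * (d / (2 * C5 + 1) + d / (2 * C5 + 1)).
    by apply: ler_wpM2l => //; exact: lerD.
  have : C5 * (d / (2 * C5 + 1) + d / (2 * C5 + 1)) <= d.
    rewrite -mulrDl mulrA ler_pdivrMr ?ltr_wpDl// ?mulr_ge0//.
    by rewrite [leRHS]mulrC -subr_ge0 (_ : _ - _ = d); [exact: ltW|ring].
  lra.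
have e5 : small (C1 * (2 * (d + d))) (fun p => T i N (b m) p - T i N (b l) p).
  by rewrite -(moll_sub moll)//; apply: smallT => //; exact: testB.
have tphi f : test f -> test (fun p => (phi p)%:C%C *: f p).
  by apply: testM; exact: moll_smooth moll.
have e6 : small d (fun p => T i N (b l) p - (phi p)%:C%C *: b l p).
  by split=> //; apply: tL2; apply: testB; [exact: tT|exact: tphi].
have e7 : small d (fun p => (phi p)%:C%C *: b l p - (phi p)%:C%C *: w p).
  have := phi_small bl.
  by have -> : (fun p => (phi p)%:C%C *: (b l p - w p)) =
      (fun p => (phi p)%:C%C *: b l p - (phi p)%:C%C *: w p)
    by apply: section_ext => p; rewrite scalerBr.
have e8 : small (2 * ((C3 * (2 * (d + d)) + d) + 2 * (d + d)))
    (fun p => D (T i N (a m)) p - T i N (D (a m)) p).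
  have := smallD e1 (small_trans e2 (small_sym e3)).
  have -> : (fun p => D (T i N (a m)) p - D (T i N (a l)) p -
      (T i N (D (a m)) p - T i N (D (a l)) p) + (D (T i N (a l)) p - T i N (D (a l)) p)) =
      (fun p => D (T i N (a m)) p - T i N (D (a m)) p) => //.
  apply: section_ext => p; move: (D (T i N (a m)) p) (D (T i N (a l)) p) => x y.
  move: (T i N (D (a m)) p) (T i N (D (a l)) p) => z t.
  by rewrite opprB [t - z]addrC addrACA subrK addrK.
exists (T i N (a m)); split; first exact: tT.
  have f1 : small (C1 * (2 * (d + d))) (fun p => T i N (a m) p - T i N (a l) p).
    by rewrite -(moll_sub moll)//; apply: smallT.
  have f2 : small d (fun p => T i N (a l) p - a l p).
    by split=> //; apply: tL2; apply: testB.
  apply: small_le (small_trans f1 (small_trans f2 al)); lra.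
(* The chain runs through [D T (a m)], [T D (a m)], [T (b m)], [T (b l)], [phi b l] and [phi w]. *)
apply: small_le (small_trans (small_trans e8 e4) (small_trans e5 (small_trans e6 e7))); lra.
Qed.

End approximation.

End friedrichs.

(** * Comparison of the closure with the adjoint *)

Section adjoint_and_closure.
Context {R : realType} {M : ptopologicalType} {n k : nat} {A : smooth_atlas R M n}.
Context {E : M -> lmodType R[i]} {S : vector_bundle A k E}.
Variables (h : hermitian_structure E) (mu : {measure set (borel M) -> \bar R}).
Hypotheses (M_hausdorff : hausdorff_space M) (M_countable : @second_countable M).
Hypothesis mu_smooth : nowhere_vanishing_smooth A mu.
Hypothesis h_smooth : smooth_hermitian S h.
Variable D : section E -> section E.
Hypothesis D_diff : differential_operator S D.
Hypothesis D_symmetric : symmetric_operator S h mu D.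
Local Notation test := (compactly_supported_smooth S).
Local Notation nsq := (nsq h mu).
Local Notation rin := (rin h mu).
Local Notation L2f := (@L2f R M n k A E S h mu).
Local Notation small := (@small R M n k A E S h mu).
Implicit Types (u v w f g : section E).

Let tL2 u : test u -> L2f u. Proof. exact: test_L2f. Qed.

(** The form is linear in its first argument, so identities for [rin] that hold for all test
    sections extend to [inner]. *)
Lemma Im_inner v u : complex.Im (inner h mu v u) = rin (fun p => - 'i%C *: v p) u.
Proof.
rewrite /inner /rin; congr Rintegral; apply/funext => p.
by rewrite /rh linearZl_LR ReM /=; ring.
Qed.

Lemma inner_eq v u v' u' : rin v u = rin v' u' ->
  rin (fun p => - 'i%C *: v p) u = rin (fun p => - 'i%C *: v' p) u' ->
  inner h mu v u = inner h mu v' u'.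
Proof.
rewrite -!Im_inner => h1 h2; apply/eqP; rewrite eq_complex; apply/andP.
by split; apply/eqP.
Qed.

Lemma D_scale (z : R[i]) v : smooth_section S v ->
  D (fun p => z *: v p) = (fun p => z *: D v p).
Proof.
have [_ H _ _] := D_diff => sv.
have s0 : smooth_section S (fun=> 0) by exact: smooth_section0.
have := H z v (fun=> 0) sv s0.
have -> : (fun p => z *: v p + 0) = (fun p => z *: v p).
  by apply: section_ext => p; rewrite addr0.
by move=> ->; apply: section_ext => p; rewrite (D_zero D_diff) addr0.
Qed.

Lemma test_scale (z : R[i]) v : test v -> test (fun p => z *: v p).
Proof.
move=> tv; have [sv cv] := tv.
apply: test_of_compact cv _ _; [|exact: closed_closure|].
  by apply: smooth_sectionM => //; [exact: openT|exact: csmooth_on_cst].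
by move=> p np; rewrite (test_off (p := p) tv)// scaler0.
Qed.

Lemma D_rin_sym f g : test f -> test g -> rin (D f) g = rin f (D g).
Proof. by move=> tf tg; have := congr1 (@complex.Re R) (D_symmetric tf tg). Qed.

(** One inequality suffices, since [- v] is again a test section; [closure_adjoint] derives the
    equality from it. *)
Lemma closure_weak_le u w (x : nat -> section E) v : L2f u -> L2f w -> test v ->
  (forall m, test (x m)) ->
  (forall eta : R, 0 < eta -> exists m0, forall m, (m0 <= m)%N ->
     small eta (fun p => x m p - u p)) ->
  (forall eta : R, 0 < eta -> exists m0, forall m, (m0 <= m)%N ->
     small eta (fun p => D (x m) p - w p)) ->
  rin v w <= rin (D v) u.
Proof.
move=> lu lw tv tx xu xw; have tDv := test_D D_diff tv.
pose q := nsq (D v) + nsq v.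
have q0 : 0 <= q by rewrite addr_ge0// nsq_ge0.
rewrite -subr_le0; apply/ler_addgt0Pl => eta eta0; rewrite addr0.
(* The approximation is made within [s * s], of which the weight [s^-1] in [rin_le] leaves [s]; two
   such terms together with [s * q] add up to [eta]. *)
pose s := eta / (q + 2).
have q2 : 0 < q + 2 by rewrite ltr_wpDl.
have s0 : 0 < s by rewrite divr_gt0.
have ss : 0 < s * s by rewrite mulr_gt0.
have [m0 Hm0] := xu _ ss; have [m1 Hm1] := xw _ ss.
have [lxu hu] := Hm0 _ (leq_maxl m0 m1); have [lxw hw] := Hm1 _ (leq_maxr m0 m1).
set m := maxn m0 m1 in lxu hu lxw hw.
have lx := tL2 (tx m); have lDx := tL2 (test_D D_diff (tx m)).
have lv := tL2 tv; have lDv := tL2 tDv.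
have h1 := rin_le M_countable h_smooth s0 lDv lxu.
have h2 := rin_le M_countable h_smooth s0 (L2fN M_countable h_smooth lv) lxw.
rewrite (rinNl M_countable h_smooth)// nsqN in h2.
rewrite !(rinBr M_countable h_smooth)// D_rin_sym// in h1 h2.
have k1 : s^-1 * nsq (fun p => x m p - u p) <= s by rewrite ler_pdivrMl.
have k2 : s^-1 * nsq (fun p => D (x m) p - w p) <= s by rewrite ler_pdivrMl.
have : s * (q + 2) = eta by rewrite /s divfK// gt_eqF.
rewrite /q; nra.
Qed.

Lemma closure_adjoint u : dom_closure S h mu D u -> dom_adjoint S h mu D u.
Proof.
move=> [uL2 [w wL2 [x [tx cu cw]]]]; split=> //; exists w => //.
have [lu _] := in_L2_small M_hausdorff M_countable mu_smooth h_smooth uL2.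
have [lw _] := in_L2_small M_hausdorff M_countable mu_smooth h_smooth wL2.
have tDx m := test_D D_diff (tx m).
have xu := (L2_cvgP (S := S) (fun m => L2fB M_countable h_smooth (tL2 (tx m)) lu)).1 cu.
have xw := (L2_cvgP (S := S) (fun m => L2fB M_countable h_smooth (tL2 (tDx m)) lw)).1 cw.
have le v : test v -> rin v w <= rin (D v) u.
  by move=> tv; exact: closure_weak_le xu xw.
have eqv v : test v -> rin (D v) u = rin v w.
  move=> tv; apply: le_anti; rewrite le//= andbT.
  have := le _ (test_scale (-1) tv); rewrite D_scale; last by have [] := tv.
  have -> : (fun p => -1 *: v p) = (fun p => - v p) by apply: section_ext => p; rewrite scaleN1r.
  have -> : (fun p => -1 *: D v p) = (fun p => - D v p).
    by apply: section_ext => p; rewrite scaleN1r.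
  rewrite !(rinNl M_countable h_smooth) ?lerN2//; [exact/tL2/test_D|exact: tL2].
move=> v tv; apply: inner_eq; first exact: eqv.
rewrite -D_scale; last by have [] := tv.
by apply: eqv; exact: test_scale.
Qed.

(** Two nested cutoffs: [chi] is 1 near [K] and vanishes off the compact set [Q], and [phi] is 1
    near [Q]. The section [u' = chi u] agrees with [u] almost everywhere and is the limit of test
    sections supported in [Q]. The images under [D] converge to [phi w], which is as good a limit as
    [w] for the domain of the closure. *)
Lemma adjoint_closure u : compactly_supported mu u ->
  dom_adjoint S h mu D u -> dom_closure S h mu D u.
Proof.
move=> [K cK uK] [uL2 [w wL2 adj]]; split=> //.
have [lu [a0 ta0 a0u]] := in_L2_small M_hausdorff M_countable mu_smooth h_smooth uL2.
have [lw [b tb bw]] := in_L2_small M_hausdorff M_countable mu_smooth h_smooth wL2.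
have cm := compact_mollifier M_hausdorff M_countable mu_smooth h_smooth D_diff.
have [T0 [chi [U [Q [mchi chi01 [U_open KU] chi1 [cQ chi0]]]]]] := cm K cK.
have [T [phi [W [Q' [mphi phi01 [W_open QO] phi1 _]]]]] := cm Q cQ.
pose u' p := (chi p)%:C%C *: u p.
have uu' : {ae mu, forall p : borel M, u' p = u p}.
  apply: filterS uK => p /= up; rewrite /u'; have [Kp|/up ->] := pselect (K p).
    by rewrite chi1 ?scale1r//; exact: KU.
  by rewrite scaler0.
have chi_small := phi_small M_countable h_smooth mchi chi01.
have lu' : L2f u'.
  by have [] := chi_small (nsq u) u; first by split.
pose a m p := (chi p)%:C%C *: a0 m p.
have ta m : test (a m) by apply: testM => //; exact: moll_smooth mchi.
have au (eta : R) : 0 < eta ->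
    exists m0, forall m, (m0 <= m)%N -> small eta (fun p => a m p - u' p).
  move=> /a0u[m0 Hm0]; exists m0 => m /Hm0/chi_small.
  by have -> : (fun p => (chi p)%:C%C *: (a0 m p - u p)) = (fun p => a m p - u' p)
    by apply: section_ext => p; rewrite scalerBr.
have adj_re v : test v -> rin (D v) u = rin v w.
  by move=> tv; have := congr1 (@complex.Re R) (adj v tv).
have weak v : test v -> rin (D v) u' = rin v w.
  move=> tv; rewrite -adj_re// rinC [RHS]rinC.
  by apply: (rin_ae M_countable h_smooth _ _ _ uu'); [exact: lu'.1|exact: lu.1|
    exact: (tL2 (test_D D_diff tv)).1].
have a_supp m q : ~ Q q -> a m q = 0 by move=> /chi0; rewrite /a => ->; rewrite scale0r.
have cvg0 m : 0 < m.+1%:R^-1 :> R by [].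
have clQ : closed Q by exact: compact_closed.
have /choice[x Hx] := fun m => friedrichs_approximation M_hausdorff M_countable mu_smooth
  h_smooth D_diff mphi phi01 clQ QO phi1 lu' lw ta tb a_supp au bw D_rin_sym weak (cvg0 m).
have small_inv (y : nat -> section E) : (forall m, small m.+1%:R^-1 (y m)) ->
    forall eta : R, 0 < eta -> exists m0, forall m, (m0 <= m)%N -> small eta (y m).
  move=> Hy eta eta0; exists (Num.truncn eta^-1) => m mm; apply: small_le (Hy m).
  rewrite invf_ple ?posrE//; apply/ltW; apply: (lt_le_trans (truncnS_gt eta^-1)).
  by rewrite ler_nat ltnS.
have phiS := phi_small M_countable h_smooth mphi phi01.
pose w' p := (phi p)%:C%C *: w p.
have lw' : L2f w' by have [] := phiS (nsq w) w; first by split.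
have tphib m : test (fun p => (phi p)%:C%C *: b m p).
  by apply: testM => //; exact: moll_smooth mphi.
exists w'.
  split; [exact: lw'.1|exact: lw'.2|exists (fun m p => (phi p)%:C%C *: b m p) => //].
  apply/(L2_cvgP (S := S)) => [m|eta]; first by apply: (L2fB M_countable h_smooth) => //; exact: tL2.
  move=> /bw[m0 Hm0]; exists m0 => m /Hm0/phiS.
  by have -> : (fun p => (phi p)%:C%C *: (b m p - w p)) =
      (fun p => (phi p)%:C%C *: b m p - w' p)
    by apply: section_ext => p; rewrite scalerBr.
have tx m : test (x m) by have [] := Hx m.
exists x; split=> //.
  apply/(L2_cvgP (S := S)) => [m|]; first by apply: (L2fB M_countable h_smooth) => //; exact: tL2.
  apply: small_inv => m; have [_ [lx' hx'] _] := Hx m.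
  have lx := L2fB M_countable h_smooth (tL2 (tx m)) lu; split=> //.
  rewrite (nsq_ae M_countable h_smooth (v := fun p => x m p - u' p))//; [exact: lx.1|exact: lx'.1|].
  by apply: filterS uu' => p /= ->.
apply/(L2_cvgP (S := S)) => [m|].
  by apply: (L2fB M_countable h_smooth) => //; apply: tL2; exact: test_D.
by apply: small_inv => m; have [] := Hx m.
Qed.

End adjoint_and_closure.

Theorem proposition5p2 (R : realType) (n k : nat) (M : ptopologicalType)
    (M_hausdorff : hausdorff_space M) (M_countable : @second_countable M)
    (A : smooth_atlas R M n)
    (mu : {measure set (borel M) -> \bar R})
    (mu_smooth : nowhere_vanishing_smooth A mu)
    (mu_bounded : uniformly_bounded_density A mu)
    (E : M -> lmodType R[i]) (S : vector_bundle A k E)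
    (h : hermitian_structure E) (h_smooth : smooth_hermitian S h)
    (D : section E -> section E)
    (D_diff : differential_operator S D)
    (D_symmetric : symmetric_operator S h mu D) :
  (forall u : section E, in_L2 S h mu u -> compactly_supported mu u ->
     (dom_closure S h mu D u <-> dom_adjoint S h mu D u)) /\
  (compact [set: M] -> essentially_self_adjoint S h mu D).
Proof.
have closure_adj := closure_adjoint M_hausdorff M_countable mu_smooth h_smooth D_diff D_symmetric.
have adj_closure := adjoint_closure M_hausdorff M_countable mu_smooth h_smooth D_diff D_symmetric.
split=> [u _ cu|cM]; first by split; [exact: closure_adj|exact: adj_closure].
split=> // u; split; [exact: closure_adj|apply: adj_closure].
(* With the whole space as the compact set, vanishing outside it is vacuous. *)
by exists setT => //; apply/nearW => p /(_ I).
Qed.
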